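(* In the network attack model described in the context (marked Poisson attacks of rate $\lambda$, exponential($\mu$) observation intervals, geometric($a$) numbers of nodes lost per attack with $b=1-a$, exponential($\xi$) weights per node, zero initial state), let $z,v,\theta\in\mathbb{C}$ and $\boldsymbol{\beta}\in\mathbb{C}^n$ satisfy $|z|\le 1$, $\mathrm{Re}(v)\ge 0$, $\mathrm{Re}(\theta)\ge 0$, and suppose that the transforms $m(\boldsymbol{\beta})$, $g\left(zl(v)m(\boldsymbol{\beta})\right)$ and $\gamma$ defined in the context converge absolutely (in the sense given there). Put $$d=z\,m(\boldsymbol{\beta})\,\frac{\lambda+b\theta}{\lambda+\theta},$$ and suppose $v+\xi(1-d)\neq 0$. Then $$E\left[z^{N_\rho}e^{-vW_\rho}e^{-\theta\tau_\rho}e^{\boldsymbol{\beta}\cdot\mathfrak{P}_\rho}\right]=1-(1-\gamma)\left(1+\frac{b\mu}{\lambda+b\theta}+\frac{a\lambda\mu}{(\lambda+b\theta)(\lambda+\theta)}\,\phi(z,v,\theta,\boldsymbol{\beta})\right),$$ where $$\phi(z,v,\theta,\boldsymbol{\beta})=\frac{\xi+v}{v+\xi(1-d)}-\frac{(d\xi)^M\left(1-e^{-(v+\xi)V}\sum_{j=0}^{M-2}\frac{[(\xi+v)V]^j}{j!}\right)}{(v+\xi(1-d))(\xi+v)^{M-1}}-\frac{d\xi e^{-(\xi+v)V}\sum_{j=0}^{M-2}\frac{(d\xi V)^j}{j!}}{\xi-d\xi+v}.$$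
   Context: Model. Let $\lambda,\mu,\xi>0$, $a\in(0,1)$, $b=1-a$, $M\in\{1,2,3,\dots\}$, $V>0$, and let $n\ge 1$ be an integer (number of passive components). Attacks occur at the points $0<t_1<t_2<\cdots$ of a Poisson process of rate $\lambda$ on $[0,\infty)$. The $k$th attack ($k\ge1$) incapacitates $n_k$ nodes, with total weight $w_k=w_{k1}+\cdots+w_{kn_k}$ and total passive change $\boldsymbol{p}_k=\boldsymbol{p}_{k1}+\cdots+\boldsymbol{p}_{kn_k}\in\mathbb{R}^n$. Here the $n_k$ are iid geometric, $P(n_k=j)=ab^{j-1}$ for $j\ge1$, with probability generating function $g(z)=\frac{az}{1-bz}$; the $w_{kj}$ are iid exponential with rate $\xi$, with Laplace–Stieltjes transform $l(u)=E[e^{-uw_{kj}}]=\frac{\xi}{\xi+u}$; the $\boldsymbol{p}_{kj}$ are iid $\mathbb{R}^n$-valued random vectors with moment generating function $m(\boldsymbol{\beta})=E[e^{\boldsymbol{\beta}\cdot\boldsymbol{p}_{kj}}]$. Set $$N(t)=\sum_{k:\,t_k\le t}n_k,\qquad W(t)=\sum_{k:\,t_k\le t}w_k,\qquad \mathfrak{P}(t)=\sum_{k:\,t_k\le t}\boldsymbol{p}_k,$$ so that the process starts at $(0,0,\boldsymbol{0})$. The process is observed only at times $\tau_0=0<\tau_1<\tau_2<\cdots$, where $\Delta_k=\tau_k-\tau_{k-1}$, $k\ge1$, are iid exponential with rate $\mu$. The families $(t_k)$, $(n_k)$, $(w_{kj})$, $(\boldsymbol{p}_{kj})$, $(\Delta_k)$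 are mutually independent. Write $N_k=N(\tau_k)$, $W_k=W(\tau_k)$, $\mathfrak{P}_k=\mathfrak{P}(\tau_k)$. The first observed passage index is $$\rho=\inf\{k\ge0:(N_k,W_k)\notin[0,M)\times[0,V)\},$$ and $\tau_\rho$ is the first observed passage time; $N_\rho=N(\tau_\rho)$, $W_\rho=W(\tau_\rho)$, $\mathfrak{P}_\rho=\mathfrak{P}(\tau_\rho)$. The increment transform is $$\gamma=\gamma(z,v,\theta,\boldsymbol{\beta})=E\left[z^{N_1}e^{-vW_1}e^{-\theta\tau_1}e^{\boldsymbol{\beta}\cdot\mathfrak{P}_1}\right],$$ which equals $\frac{\mu}{\mu+\theta^\ast}$ with $\theta^\ast=\theta+\lambda-\lambda g\left(zl(v)m(\boldsymbol{\beta})\right)$. Absolute convergence means: $m(\mathrm{Re}\,\boldsymbol{\beta})<\infty$, $E\left[\left(|z|\,l(\mathrm{Re}\,v)\,m(\mathrm{Re}\,\boldsymbol{\beta})\right)^{n_1}\right]<\infty$, and $E\left|z^{N_1}e^{-vW_1}e^{-\theta\tau_1}e^{\boldsymbol{\beta}\cdot\mathfrak{P}_1}\right|<\infty$. Empty sums (as when $M=1$) are $0$. *)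

(* Defs.v *)
From HB Require Import structures.
From mathcomp Require Import all_boot all_order all_algebra finmap.
From mathcomp Require Import complex.
From mathcomp Require Import all_classical all_reals all_analysis.

Set Implicit Arguments.
Unset Strict Implicit.
Unset Printing Implicit Defensive.

Import Order.TTheory GRing.Theory Num.Theory.
Import numFieldNormedType.Exports.

Local Open Scope classical_set_scope.
Local Open Scope ring_scope.
Local Open Scope complex_scope.

Definition expC {R : realType} (x : R[i]) : R[i] :=
  (expR (complex.Re x) * cos (complex.Im x))
  +i* (expR (complex.Re x) * sin (complex.Im x)).

(* The norm of [R[i]] takes its values in [R[i]]; this is the real modulus. *)
Definition absC {R : realType} (x : R[i]) : R := complex.Re `|x|.

Definition dot {R : realType} {n : nat} (u x : n.-tuple R) : R :=
  \sum_(i < n) tnth u i * tnth x i.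

Definition dotC {R : realType} {n : nat} (u : n.-tuple R[i])
    (x : n.-tuple R) : R[i] :=
  \sum_(i < n) tnth u i * (tnth x i)%:C.

Section complex_expectation.
Context {d : measure_display} {T : measurableType d} {R : realType}.
Variable P : probability T R.

Definition integrableC (X : T -> R[i]) : Prop :=
  P.-integrable setT (fun w => (complex.Re (X w))%:E) /\
  P.-integrable setT (fun w => (complex.Im (X w))%:E).

(* Meaningful only when [integrableC X] holds. *)
Definition expectationC (X : T -> R[i]) : R[i] :=
  fine 'E_P[fun w => complex.Re (X w)]
  +i* fine 'E_P[fun w => complex.Im (X w)].

End complex_expectation.

Section independence.
Context {d : measure_display} {T : measurableType d} {R : realType}.
Variable P : probability T R.

Definition mutually_independent {I : choiceType} (F : I -> set_system T) :=
  forall (J : {fset I}) (A : I -> set T),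
    (forall i, i \in J -> F i (A i)) ->
    P (\bigcap_(i in [set` J]) A i) = (\prod_(i <- J) P (A i))%E.

Definition sigma_gen {d' : measure_display} {T' : measurableType d'}
    {I : Type} (X : I -> T -> T') : set_system T :=
  <<s \bigcup_i preimage_set_system setT (X i) measurable >>.

Definition independent_RVs {d' : measure_display} {T' : measurableType d'}
    {I : choiceType} (X : I -> T -> T') :=
  mutually_independent
    (fun i => preimage_set_system setT (X i) measurable).

End independence.

(* Points [t 0 < t 1 < ...] of a Poisson process of rate [lambda] on [0, +oo[:
   the numbers of points in consecutive intervals ]s i, s i.+1] are independent
   and Poisson distributed with means [lambda * (s i.+1 - s i)]. The bounds are
   strictly increasing because [poisson_pmf 0] is not a mass function. *)
Definition poisson_points {d : measure_display} {T : measurableType d}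
    {R : realType} (P : probability T R) (lambda : R) (t : nat -> T -> R) :=
  (forall w, 0 < t 0%N w) /\
  (forall k w, t k w < t k.+1 w) /\
  (forall (m : nat) (s : nat -> R) (c : nat -> nat),
     0 <= s 0%N -> (forall i, s i < s i.+1) ->
     P [set w | forall i, (i < m)%N ->
                  ([set k | s i < t k w <= s i.+1] #= `I_(c i))%card] =
     (\prod_(i < m) (poisson_pmf (lambda * (s i.+1 - s i)) (c i))%:E)%E).

(* All sequences are indexed from 0: [attack_time k], [nodes k], [weight k j],
   [passive k j] and [delay k] stand for t_{k+1}, n_{k+1}, w_{k+1,j+1},
   p_{k+1,j+1} and Delta_{k+1}. *)
Record network_attack {d : measure_display} {T : measurableType d}
    {R : realType} (P : probability T R) (n : nat) (lambda mu xi a : R) := {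
  attack_time : nat -> {RV P >-> R};
  nodes : nat -> {RV P >-> nat};
  weight : nat -> nat -> {RV P >-> R};
  passive : nat -> nat -> {RV P >-> n.-tuple R};
  delay : nat -> {RV P >-> R};
  attack_time_poisson : poisson_points P lambda attack_time;
  nodes_geometric : forall k j, (0 < j)%N ->
    P [set w | nodes k w = j] = (a * (1 - a) ^+ j.-1)%:E;
  weight_exponential : forall k j (A : set R), measurable A ->
    distribution P (weight k j) A = exponential_prob xi A;
  passive_identical : forall k j (A : set (n.-tuple R)), measurable A ->
    distribution P (passive k j) A = distribution P (passive 0%N 0%N) A;
  delay_exponential : forall k (A : set R), measurable A ->
    distribution P (delay k) A = exponential_prob mu A;
  nodes_independent : independent_RVs P nodes;
  weight_independent :
    independent_RVs P (fun kj : nat * nat => weight kj.1 kj.2);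
  passive_independent :
    independent_RVs P (fun kj : nat * nat => passive kj.1 kj.2);
  delay_independent : independent_RVs P delay;
  families_independent : mutually_independent P (tnth [tuple
    sigma_gen attack_time;
    sigma_gen nodes;
    sigma_gen (fun kj : nat * nat => weight kj.1 kj.2);
    sigma_gen (fun kj : nat * nat => passive kj.1 kj.2);
    sigma_gen delay])
}.

Section processes.
Context {d : measure_display} {T : measurableType d} {R : realType}.
Context {P : probability T R} {n : nat} {lambda mu xi a : R}.
Variable S : network_attack P n lambda mu xi a.

(* Almost surely, only finitely many attacks occur up to time [s]; outcomes with
   infinitely many of them get the default value of [\big[_/_]_(_ \in _) _]. *)
Definition attacks_upto (s : R) (w : T) : set nat :=
  [set k | attack_time S k w <= s].

Definition total_nodes (s : R) (w : T) : nat :=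
  \big[addn/0%N]_(k \in attacks_upto s w) nodes S k w.

Definition total_weight (s : R) (w : T) : R :=
  \sum_(k \in attacks_upto s w) \sum_(j < nodes S k w) weight S k j w.

Definition total_passive (s : R) (w : T) : n.-tuple R :=
  [tuple \sum_(k \in attacks_upto s w)
           \sum_(j < nodes S k w) tnth (passive S k j w) i | i < n].

(* [tau k] is the k-th observation time, with [tau 0 = 0]. *)
Definition tau (k : nat) (w : T) : R := \sum_(i < k) delay S i w.

Definition passed (M : nat) (V : R) (k : nat) (w : T) : Prop :=
  ~ ((total_nodes (tau k w) w < M)%N /\ 0 <= total_weight (tau k w) w < V).

(* First observed passage index; 0 on the negligible event of no passage. *)
Definition rho (M : nat) (V : R) (w : T) : nat :=
  xget 0%N [set k | passed M V k w /\
                    forall j, (j < k)%N -> ~ passed M V j w].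

Definition state_transform (z v theta : R[i]) (beta : n.-tuple R[i])
    (k : nat) (w : T) : R[i] :=
  z ^+ total_nodes (tau k w) w
  * expC (- v * (total_weight (tau k w) w)%:C)
  * expC (- theta * (tau k w)%:C)
  * expC (dotC beta (total_passive (tau k w) w)).

Definition passive_mgf (beta : n.-tuple R[i]) : R[i] :=
  expectationC P (fun w => expC (dotC beta (passive S 0 0 w))).

Definition real_passive_mgf (beta : n.-tuple R) : \bar R :=
  'E_P[fun w => expR (dot beta (passive S 0 0 w))].

Definition real_weight_lst (u : R) : \bar R :=
  'E_P[fun w => (expR (- u * weight S 0 0 w))%R].

Definition converges_absolutely (z v theta : R[i])
    (beta : n.-tuple R[i]) : Prop :=
  let m := real_passive_mgf (map_tuple (@complex.Re R) beta) in
  let l := real_weight_lst (complex.Re v) in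
  [/\ (m < +oo)%E,
      ('E_P[fun w => ((absC z * fine l * fine m) ^+ nodes S 0 w)%R] < +oo)%E &
      ('E_P[fun w => absC (state_transform z v theta beta 1 w)] < +oo)%E].

End processes.

(* Main.v *)
Require Import Defs.
From HB Require Import structures.
From mathcomp Require Import all_boot all_order all_algebra finmap.
From mathcomp Require Import complex.
From mathcomp Require Import all_classical all_reals all_analysis.
From mathcomp Require Import measurable_realfun zify ring lra.

Set Implicit Arguments.
Unset Strict Implicit.
Unset Printing Implicit Defensive.

Import Order.TTheory GRing.Theory Num.Theory.
Import numFieldNormedType.Exports.

Local Open Scope classical_set_scope.
Local Open Scope ring_scope.
Local Open Scope complex_scope.

(** The transform is computed from two independent mechanisms: the marks of the
    attacks and the clock made of attack times and observation times.

    Write [Y k] for the transform variable at the [k]-th observation, [A k] for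
    its mean over the event that both thresholds are still respected at that
    time, and [gamma] for the mean of [Y 1]. The increment over the next delay is
    independent of the past and has transform [gamma], so that the mean of
    [Y (k + 1)] over the same event is [gamma * A k] ([expectationC_renewal]).
    Passage is first observed at [k + 1] when the thresholds are respected at [k]
    and not at [k + 1], because the process increases; this event contributes
    [gamma * A k - A (k + 1)]. As [A 0 = 1] and [A k] tends to 0, the sum over [k]
    telescopes to [1 - (1 - gamma) * sum_k A k] ([expectationC_passage]).
    Absolute convergence follows from the same formulas at the moduli and real
    parts of the arguments, because [A k] decays geometrically there.

    To sum [A k], split by the number [i] of attacks up to the observation. Marks
    and clock being independent, [A k] is the sum over [i < M] of [box_mean i],
    the mean transform of the marks of [i] attacks that stay below the
    thresholds, times [clock_transform k i]
    ([expectationC_marks], [expectationC_inside_at]). The clock transforms obey a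
    convolution recursion in [k] ([clock_transformS]) whose kernel is the transform
    of one exponential delay split by the number of attacks in it. Convolution
    with it contracts a weighted norm, and the sum over [k] is the potential
    [(i == 0) + mu / (lambda + theta) * (lambda / (lambda + theta)) ^ i]
    ([clock_total_limit]). With the numbers of nodes frozen, [box_mean i] is a sum
    over the number [r] of nodes lost, in which the weights enter through the
    transform of a Gamma variable restricted to [0, V[
    ([expectationC_truncated_weights]). Summing over [i] first gives a renewal sum
    of geometric variables, which is itself geometric in [r] ([sum_node_renewal],
    [node_renewal]); the remaining sum over [r < M] is [phi]
    ([sum_gamma_transform]).

    Every use of independence goes through two tools: disjoint blocks of a
    mutually independent family generate independent sigma-algebras
    ([indep_blocks]), and the expectation of a function of two independent
    sources is computed with one of them frozen ([freezing_systems]). *)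

Local Notation Re := complex.Re.
Local Notation Im := complex.Im.

(** * Complex-valued integrands *)


Section complex_numbers.
Context {R : realType}.
Implicit Types x y : R[i].

Lemma complex_ext x y : Re x = Re y -> Im x = Im y -> x = y.
Proof. by case: x => ? ?; case: y => ? ? /= -> ->. Qed.

Lemma complexReD x y : Re (x + y) = Re x + Re y.
Proof. by case: x; case: y. Qed.

Lemma complexImD x y : Im (x + y) = Im x + Im y.
Proof. by case: x; case: y. Qed.

Lemma complexReN x : Re (- x) = - Re x. Proof. by case: x. Qed.

Lemma complexImN x : Im (- x) = - Im x. Proof. by case: x. Qed.

Lemma complexReM x y : Re (x * y) = Re x * Re y - Im x * Im y.
Proof. by case: x; case: y. Qed.

Lemma complexImM x y : Im (x * y) = Re x * Im y + Im x * Re y.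
Proof. by case: x; case: y. Qed.

Lemma complexRe_sum (I : Type) (r : seq I) (p : pred I) (F : I -> R[i]) :
  Re (\sum_(i <- r | p i) F i) = \sum_(i <- r | p i) Re (F i).
Proof. by elim/big_rec2: _ => // i y x _ <-; rewrite complexReD. Qed.

Lemma absCE x : absC x = Num.sqrt (Re x ^+ 2 + Im x ^+ 2).
Proof. by case: x. Qed.

Lemma absC_norm x : (absC x)%:C = `|x|.
Proof. by case: x. Qed.

Lemma absC_ge0 x : 0 <= absC x.
Proof. by rewrite -ler0c absC_norm. Qed.

Lemma absCM x y : absC (x * y) = absC x * absC y.
Proof. exact: Normc.normcM. Qed.

Lemma absCD x y : absC (x + y) <= absC x + absC y.
Proof. by rewrite -lecR rmorphD /= !absC_norm ler_normD. Qed.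

Lemma absCN x : absC (- x) = absC x.
Proof. by apply: complexI; rewrite !absC_norm normrN. Qed.

Lemma absC_sum (I : Type) (r : seq I) (p : pred I) (F : I -> R[i]) :
  absC (\sum_(i <- r | p i) F i) <= \sum_(i <- r | p i) absC (F i).
Proof.
rewrite -lecR rmorph_sum /= absC_norm (le_trans (ler_norm_sum _ _ _))//.
Qed.

Lemma absCV x : absC x^-1 = (absC x)^-1.
Proof. by apply: complexI; rewrite fmorphV /= !absC_norm normfV. Qed.

Lemma absC_real (r : R) : absC r%:C = `|r|.
Proof. by rewrite absCE /= expr0n addr0 sqrtr_sqr. Qed.

Lemma absC0 : absC (0 : R[i]) = 0.
Proof. by rewrite -[0]/((0 : R)%:C) absC_real normr0. Qed.

Lemma absC1 : absC (1 : R[i]) = 1.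
Proof. by rewrite -[1]/((1 : R)%:C) absC_real normr1. Qed.

Lemma absCX x n : absC (x ^+ n) = absC x ^+ n.
Proof. by elim: n => [|n IH]; rewrite ?absC1// !exprS absCM IH. Qed.

Lemma absC_prod (I : Type) (r : seq I) (p : pred I) (F : I -> R[i]) :
  absC (\prod_(i <- r | p i) F i) = \prod_(i <- r | p i) absC (F i).
Proof. by elim/big_rec2: _ => [|i y x _ <-]; rewrite ?absC1// absCM. Qed.

Lemma Re_le_absC x : `|Re x| <= absC x.
Proof. by rewrite absCE -sqrtr_sqr ler_wsqrtr// lerDl sqr_ge0. Qed.

Lemma Im_le_absC x : `|Im x| <= absC x.
Proof. by rewrite absCE -sqrtr_sqr ler_wsqrtr// lerDr sqr_ge0. Qed.

Lemma Re_gt0_neq0 x : 0 < Re x -> x != 0.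
Proof. by apply: contraTneq => ->; rewrite ltxx. Qed.

Lemma complex_realM (r s : R) : (r * s)%:C = r%:C * s%:C :> R[i].
Proof. exact: rmorphM. Qed.

Lemma absC_le x : absC x <= `|Re x| + `|Im x|.
Proof.
have -> : `|Re x| + `|Im x| = Num.sqrt ((`|Re x| + `|Im x|) ^+ 2).
  by rewrite sqrtr_sqr [RHS]ger0_norm ?addr_ge0.
rewrite absCE; apply: ler_wsqrtr.
by rewrite sqrrD !real_normK ?num_real// lerD2r lerDl mulrn_wge0// mulr_ge0.
Qed.

Lemma expC0 : expC (0 : R[i]) = 1.
Proof. by rewrite /expC /= expR0 cos0 sin0 mulr1 mulr0. Qed.

Lemma expCD x y : expC (x + y) = expC x * expC y.
Proof.
apply: complex_ext; rewrite /expC ?complexReM ?complexImM /= complexReD complexImD;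
  by rewrite expRD ?cosD ?sinD; ring.
Qed.

Lemma expC_sum (I : Type) (r : seq I) (p : pred I) (F : I -> R[i]) :
  expC (\sum_(i <- r | p i) F i) = \prod_(i <- r | p i) expC (F i).
Proof. by elim/big_rec2: _ => [|i y x _ <-]; rewrite ?expC0// expCD. Qed.

Lemma expC_real (r : R) : expC r%:C = (expR r)%:C.
Proof. by rewrite /expC /= cos0 sin0 mulr1 mulr0. Qed.

Lemma absC_expC x : absC (expC x) = expR (Re x).
Proof.
rewrite absCE /= !exprMn -mulrDr cos2Dsin2 mulr1 sqrtr_sqr ger0_norm// expR_ge0.
Qed.

End complex_numbers.

(** Measurability is stated coordinatewise because no sigma-algebra is fixed on
    the complex numbers. *)
Definition cmeasurable {d} {T : measurableType d} {R : realType}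
    (f : T -> R[i]) : Prop :=
  measurable_fun setT (fun w => Re (f w)) /\
  measurable_fun setT (fun w => Im (f w)).

Section measurableC_theory.
Context {d : measure_display} {T : measurableType d} {R : realType}.
Implicit Types f g : T -> R[i].

Lemma measurableC_cst (c : R[i]) : cmeasurable (fun _ : T => c).
Proof. by split; exact: measurable_cst. Qed.

Lemma measurableC_real (f : T -> R) :
  measurable_fun setT f -> cmeasurable (fun w => (f w)%:C).
Proof. by move=> mf; split => //=; exact: measurable_cst. Qed.

Lemma measurableCD f g :
  cmeasurable f -> cmeasurable g -> cmeasurable (fun w => f w + g w).
Proof.
move=> [f1 f2] [g1 g2]; split.
  by under eq_fun do rewrite complexReD; exact: measurable_funD.
by under eq_fun do rewrite complexImD; exact: measurable_funD.
Qed.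

Lemma measurableCM f g :
  cmeasurable f -> cmeasurable g -> cmeasurable (fun w => f w * g w).
Proof.
move=> [f1 f2] [g1 g2]; split.
  by under eq_fun do rewrite complexReM; apply: measurable_funB; exact: measurable_funM.
by under eq_fun do rewrite complexImM; apply: measurable_funD; exact: measurable_funM.
Qed.

Lemma measurableC_sum (I : Type) (r : seq I) (F : I -> T -> R[i]) :
  (forall i, cmeasurable (F i)) -> cmeasurable (fun w => \sum_(i <- r) F i w).
Proof.
move=> mF; elim: r => [|i r IH].
  by under eq_fun do rewrite big_nil; exact: measurableC_cst.
by under eq_fun do rewrite big_cons; exact: measurableCD.
Qed.

Lemma measurableC_prod (I : Type) (r : seq I) (F : I -> T -> R[i]) :
  (forall i, cmeasurable (F i)) -> cmeasurable (fun w => \prod_(i <- r) F i w).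
Proof.
move=> mF; elim: r => [|i r IH].
  by under eq_fun do rewrite big_nil; exact: measurableC_cst.
by under eq_fun do rewrite big_cons; exact: measurableCM.
Qed.

Lemma measurableC_exp f : cmeasurable f -> cmeasurable (fun w => expC (f w)).
Proof.
move=> [f1 f2]; split; rewrite /expC /=; apply: measurable_funM;
  apply: measurableT_comp => //; apply: continuous_measurable_fun.
- exact: continuous_cos.
- exact: continuous_sin.
Qed.

Lemma measurableC_absC f :
  cmeasurable f -> measurable_fun setT (fun w => absC (f w)).
Proof.
move=> [f1 f2]; under eq_fun do rewrite absCE.
apply: (measurableT_comp (f := @Num.sqrt R)).
  by apply: continuous_measurable_fun; exact: sqrt_continuous.
by apply: measurable_funD; exact: measurable_funX.
Qed.

Lemma measurableC_indic (A : set T) :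
  measurable A -> cmeasurable (fun w => (\1_A w)%:C : R[i]).
Proof. by move=> mA; apply: measurableC_real; exact: measurable_indic. Qed.

Lemma measurableC_comp d' (T' : measurableType d') (h : T' -> T) f :
  measurable_fun setT h -> cmeasurable f -> cmeasurable (fun w => f (h w)).
Proof.
move=> mh [f1 f2]; split.
  exact: (measurableT_comp f1 mh).
exact: (measurableT_comp f2 mh).
Qed.

End measurableC_theory.

Section expectationC_theory.
Context {d : measure_display} {T : measurableType d} {R : realType}.
Variable P : probability T R.
Implicit Types f g : T -> R[i].
Local Open Scope ereal_scope.

Lemma expectation_integral (X : T -> R) : 'E_P[X] = \int[P]_w (X w)%:E.
Proof. by rewrite unlock. Qed.

Lemma integrableC_measurable f : integrableC P f -> cmeasurable f.
Proof.
by move=> [/measurable_int /measurable_EFinP ? /measurable_int /measurable_EFinP].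
Qed.

(** The modulus dominates both coordinates and is dominated by their sum. *)
Lemma integrableC_absP f :
  integrableC P f <-> cmeasurable f /\ \int[P]_w (absC (f w))%:E < +oo.
Proof.
split => [fi|[mf foo]].
  have mf := integrableC_measurable fi; split => //.
  have [/integrable_abse/integrableP[_ f1] /integrable_abse/integrableP[_ f2]] := fi.
  apply: (@le_lt_trans _ _ (\int[P]_w (`|Re (f w)|%:E + `|Im (f w)|%:E))).
    apply: ge0_le_integral => //=.
    - by move=> w _; rewrite lee_fin absC_ge0.
    - by apply/measurable_EFinP; exact: measurableC_absC.
    - apply: emeasurable_funD; apply/measurable_EFinP;
        apply: measurableT_comp => //; by case: mf.
    - by move=> w _; rewrite -EFinD lee_fin absC_le.
  rewrite ge0_integralD//=.
  - apply: lte_add_pinfty.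
      by move: f1; under eq_integral do rewrite /= normr_id.
    by move: f2; under eq_integral do rewrite /= normr_id.
  - by apply/measurable_EFinP; apply: measurableT_comp => //; case: mf.
  - by apply/measurable_EFinP; apply: measurableT_comp => //; case: mf.
have absi : P.-integrable setT (fun w => (absC (f w))%:E).
  apply/integrableP; split.
    by apply/measurable_EFinP; exact: measurableC_absC.
  by under eq_integral do rewrite /= (ger0_norm (absC_ge0 _)).
split; apply: le_integrable absi => //.
- by apply/measurable_EFinP; case: mf.
- by move=> w _ /=; rewrite lee_fin (ger0_norm (absC_ge0 _)) Re_le_absC.
- by apply/measurable_EFinP; case: mf.
- by move=> w _ /=; rewrite lee_fin (ger0_norm (absC_ge0 _)) Im_le_absC.
Qed.

Lemma integrableC_le f g : cmeasurable f -> integrableC P g ->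
  (forall w, absC (f w) <= absC (g w))%R -> integrableC P f.
Proof.
move=> mf /integrableC_absP[mg goo] fg; apply/integrableC_absP; split => //.
apply: le_lt_trans goo; apply: ge0_le_integral => //=.
- by move=> w _; rewrite lee_fin absC_ge0.
- by apply/measurable_EFinP; exact: measurableC_absC.
- by apply/measurable_EFinP; exact: measurableC_absC.
- by move=> w _; rewrite lee_fin fg.
Qed.

Lemma integrableC_indicM f (A : set T) : integrableC P f -> measurable A ->
  integrableC P (fun w => f w * (\1_A w)%:C)%R.
Proof.
move=> fi mA; apply: (integrableC_le _ fi).
  exact: measurableCM (integrableC_measurable fi) (measurableC_indic mA).
move=> w; rewrite absCM absC_real ler_piMr ?absC_ge0// indicE.
by case: (w \in _); rewrite ?normr1 ?normr0.
Qed.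

Lemma ae_eq_integral_absC f g : cmeasurable f -> cmeasurable g ->
  {ae P, forall w, f w = g w} ->
  \int[P]_w (absC (f w))%:E = \int[P]_w (absC (g w))%:E.
Proof.
move=> mf mg fg; apply: ge0_ae_eq_integral => //=.
- by apply/measurable_EFinP; exact: measurableC_absC.
- by apply/measurable_EFinP; exact: measurableC_absC.
- by move=> w _; rewrite lee_fin absC_ge0.
- by move=> w _; rewrite lee_fin absC_ge0.
- by apply: filterS fg => w + _ => ->.
Qed.

Lemma integrableC_ae f g : cmeasurable g -> integrableC P f ->
  {ae P, forall w, f w = g w} -> integrableC P g.
Proof.
move=> mg /integrableC_absP[mf foo] fg; apply/integrableC_absP; split => //.
by rewrite -(ae_eq_integral_absC mf mg fg).
Qed.

Lemma expectationC_ae f g : cmeasurable f -> cmeasurable g ->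
  {ae P, forall w, f w = g w} -> expectationC P f = expectationC P g.
Proof.
move=> [f1 f2] [g1 g2] fg; rewrite /expectationC !unlock.
congr (fine _ +i* fine _); apply: ae_eq_integral => //=;
  try exact/measurable_EFinP.
- by apply: filterS fg => w + _ => ->.
- by apply: filterS fg => w + _ => ->.
Qed.

Lemma integrableC_real (f : T -> R) :
  P.-integrable setT (EFin \o f) -> integrableC P (fun w => (f w)%:C).
Proof. by move=> fi; split => //=; exact: integrable0. Qed.

Lemma integrableC_cst (c : R[i]) : integrableC P (fun _ => c).
Proof. by split; exact: finite_measure_integrable_cst. Qed.

Lemma expectationC_cst (c : R[i]) : expectationC P (fun _ => c) = c.
Proof.
by rewrite /expectationC; apply: complex_ext; rewrite /= expectation_cst.
Qed.

Lemma expectationC_real (f : T -> R) :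
  expectationC P (fun w => (f w)%:C) = (fine 'E_P[f])%:C.
Proof. by apply: complex_ext => //=; rewrite expectation_cst. Qed.

Lemma integrableCD f g : integrableC P f -> integrableC P g ->
  integrableC P (fun w => f w + g w)%R.
Proof.
move=> [f1 f2] [g1 g2]; split.
  by under eq_fun do rewrite complexReD EFinD; exact: integrableD.
by under eq_fun do rewrite complexImD EFinD; exact: integrableD.
Qed.

Lemma expectationCD f g : integrableC P f -> integrableC P g ->
  expectationC P (fun w => f w + g w)%R = (expectationC P f + expectationC P g)%R.
Proof.
move=> [f1 f2] [g1 g2]; apply: complex_ext; rewrite ?complexReD ?complexImD /= !unlock.
  under eq_integral do rewrite complexReD EFinD.
  by rewrite integralD//= fineD//; exact: integrable_fin_num.
under eq_integral do rewrite complexImD EFinD.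
by rewrite integralD//= fineD//; exact: integrable_fin_num.
Qed.

Lemma integrableCZ (c : R[i]) f : integrableC P f ->
  integrableC P (fun w => c * f w)%R.
Proof.
move=> [f1 f2]; split.
  under eq_fun do rewrite complexReM EFinB !EFinM.
  by apply: integrableB => //; exact: integrableZl.
under eq_fun do rewrite complexImM EFinD !EFinM.
by apply: integrableD => //; exact: integrableZl.
Qed.

Lemma expectationCZ (c : R[i]) f : integrableC P f ->
  expectationC P (fun w => c * f w)%R = (c * expectationC P f)%R.
Proof.
move=> [f1 f2].
have fin1 := integrable_fin_num measurableT f1.
have fin2 := integrable_fin_num measurableT f2.
apply: complex_ext; rewrite ?complexReM ?complexImM /= !unlock.
  under eq_integral do rewrite complexReM EFinB !EFinM.
  rewrite integralB//=; [|exact: integrableZl|exact: integrableZl].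
  by rewrite !integralZl//= fineB ?fin_numM// !fineM.
under eq_integral do rewrite complexImM EFinD !EFinM.
rewrite integralD//=; [|exact: integrableZl|exact: integrableZl].
by rewrite !integralZl//= fineD ?fin_numM// !fineM.
Qed.

Lemma integrableC_sum (I : Type) (r : seq I) (F : I -> T -> R[i]) :
  (forall i, integrableC P (F i)) ->
  integrableC P (fun w => \sum_(i <- r) F i w)%R.
Proof.
move=> iF; elim: r => [|i r IH].
  by under eq_fun do rewrite big_nil; exact: integrableC_cst.
by under eq_fun do rewrite big_cons; exact: integrableCD.
Qed.

Lemma expectationC_sum (I : Type) (r : seq I) (F : I -> T -> R[i]) :
  (forall i, integrableC P (F i)) ->
  expectationC P (fun w => \sum_(i <- r) F i w)%R =
  (\sum_(i <- r) expectationC P (F i))%R.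
Proof.
move=> iF; elim: r => [|i r IH].
  by under eq_fun do rewrite big_nil; rewrite big_nil expectationC_cst.
under eq_fun do rewrite big_cons.
by rewrite big_cons expectationCD ?IH//; exact: integrableC_sum.
Qed.

Lemma integral_absC f : integrableC P f ->
  \int[P]_w (absC (f w))%:E =
  (Re (expectationC P (fun w => (absC (f w))%:C)))%:E.
Proof.
move=> /integrableC_absP[mf foo].
rewrite expectationC_real /= unlock fineK// ge0_fin_numE//.
by apply: integral_ge0 => w _; rewrite lee_fin absC_ge0.
Qed.

End expectationC_theory.

Section expectationC_modulus.
Context {d : measure_display} {T : measurableType d} {R : realType}.
Variable P : probability T R.

Lemma integrableC_abs (f g : T -> R[i]) : integrableC P f ->
  (forall w, (absC (f w))%:C = g w) -> integrableC P g.
Proof.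
move=> /integrableC_absP[mf foo] fg.
have gE : g = fun w => (absC (f w))%:C by apply/funext => w; rewrite fg.
rewrite gE; apply: integrableC_real; apply/integrableP; split.
  by apply/measurable_EFinP; exact: measurableC_absC.
by under eq_integral do rewrite /= (ger0_norm (absC_ge0 _)).
Qed.

Lemma absC_expectationC (f : T -> R[i]) : integrableC P f ->
  absC (expectationC P f) <= Re (expectationC P (fun w => (absC (f w))%:C)).
Proof.
move=> fi; set m := expectationC P f.
have iabs : integrableC P (fun w => (absC (f w))%:C).
  exact: (integrableC_abs fi).
have [m0|m0] := eqVneq m 0.
  rewrite m0 absC0 expectationC_real /=; apply: fine_ge0; apply: expectation_ge0 => w.
  exact: absC_ge0.
(* rotate the mean onto the positive half-line *)
pose u : R[i] := `|m| / m.
have u1 : absC u = 1.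
  by rewrite /u -absC_norm absCM absCV absC_real ger0_norm ?absC_ge0// divff// gt_eqF//
    lt_neqAle absC_ge0 andbT eq_sym; apply: contra_neq m0 => m0; apply/eqP;
    rewrite -normr_eq0 -absC_norm m0.
have -> : absC m = Re (expectationC P (fun w => u * f w)).
  by rewrite expectationCZ// -/m /u mulfVK// -absC_norm.
rewrite expectationC_real /= /expectationC /=; apply: fine_le.
- by have [] := integrableCZ u fi; rewrite !expectation_integral => /integrable_fin_num->.
- by case: iabs; rewrite !expectation_integral => /integrable_fin_num->.
rewrite !expectation_integral; apply: le_integral => //.
- by have [] := integrableCZ u fi.
- by case: iabs.
move=> w _; rewrite lee_fin (le_trans (ler_norm _))// (le_trans (Re_le_absC _))//.
by rewrite absCM u1 mul1r.
Qed.

End expectationC_modulus.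

(** * Independent sigma-algebras *)

Section independent_systems.
Context {d : measure_display} {T : measurableType d} {R : realType}.
Variable P : probability T R.
Implicit Types G H : set_system T.
Local Open Scope ereal_scope.

Definition indep_systems G H :=
  forall A B, <<s G >> A -> <<s H >> B -> P (A `&` B) = P A * P B.

Lemma sub_g_sigma_sigma G H : G `<=` <<s H >> -> <<s G >> `<=` <<s H >>.
Proof. by move=> GH; apply: smallest_sub => //; exact: smallest_sigma_algebra. Qed.

Lemma g_sigma_measurable G : G `<=` measurable -> <<s G >> `<=` measurable.
Proof. by move=> GM; apply: smallest_sub => //; exact: sigma_algebra_measurable. Qed.

Lemma indep_systems_sub G H G' H' : indep_systems G H ->
  G' `<=` <<s G >> -> H' `<=` <<s H >> -> indep_systems G' H'.
Proof.
move=> GH sG sH A B GA HB; apply: GH.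
  by apply: (sub_g_sigma_sigma sG).
by apply: (sub_g_sigma_sigma sH).
Qed.

(** Uniqueness of measures on a pi-system, with [B] fixed. *)
Let indep_pi_left G (B : set T) : G `<=` measurable -> setI_closed G ->
  G setT -> measurable B -> (forall A, G A -> P (A `&` B) = P A * P B) ->
  forall A, <<s G >> A -> P (A `&` B) = P A * P B.
Proof.
move=> GM GI GT mB GB A GA.
have PB0 : (0 <= fine (P B))%R by exact: fine_ge0.
have mE : forall A', mrestr P mB A' = P (A' `&` B) by [].
have sE : forall A', mscale (NngNum PB0) P A' = P A' * P B.
  by move=> A'; rewrite /mscale /= fineK ?fin_num_measure// muleC.
rewrite -mE -sE; apply: (@g_sigma_algebra_measure_unique _ R T G GM (fun=> setT)) => //.
- by rewrite bigcup_const//; exists 0%N.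
- by move=> A' GA'; rewrite -[LHS]/(P (A' `&` B)) GB// -sE.
- move=> _; rewrite -[X in X < _]/(P (setT `&` B)) setTI.
  by rewrite (le_lt_trans (probability_le1 _ _))// ltry.
Qed.

Lemma indep_systems_pi G H :
  G `<=` measurable -> setI_closed G -> G setT ->
  H `<=` measurable -> setI_closed H -> H setT ->
  (forall A B, G A -> H B -> P (A `&` B) = P A * P B) -> indep_systems G H.
Proof.
move=> GM GI GT HM HI HT GH A B GA HB.
have mA : measurable A by apply: (g_sigma_measurable GM).
rewrite setIC muleC; apply: (indep_pi_left HM HI HT mA _ HB) => B' HB'.
rewrite setIC muleC; apply: (indep_pi_left GM GI GT (HM _ HB') _ GA) => A' GA'.
exact: GH.
Qed.

Definition block {I : Type} (F : I -> set_system T) (J : set I) : set_system T :=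
  \bigcup_(i in J) F i.

Let finite_meets {I : choiceType} (F : I -> set_system T) (J : set I) : set_system T :=
  [set X | exists (K : {fset I}) (A : I -> set T), [/\ [set` K] `<=` J,
    (forall i, i \in K -> F i (A i)) & X = \bigcap_(i in [set` K]) A i]].

(** Disjoint blocks of a mutually independent family are independent: finite
    meets of events of a block form a pi-system that generates it, and on such
    meets mutual independence over the union of the two finite index sets is
    the product rule. *)
Lemma indep_blocks {I : choiceType} (F : I -> set_system T) (J1 J2 : set I) :
  mutually_independent P F -> (forall i, F i `<=` measurable) ->
  (forall i, setI_closed (F i)) -> J1 `&` J2 = set0 ->
  indep_systems (block F J1) (block F J2).
Proof.
move=> indF FM FI J120.
have piM J : finite_meets F J `<=` measurable.
  move=> _ [K [A [KJ FA ->]]]; apply: fin_bigcap_measurable => //.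
  by move=> i Ki; apply: FM; exact: FA.
have piI J : setI_closed (finite_meets F J).
  move=> _ _ [K1 [A1 [KJ1 FA1 ->]]] [K2 [A2 [KJ2 FA2 ->]]].
  exists (K1 `|` K2)%fset, (fun i => if i \in K1 then
    if i \in K2 then A1 i `&` A2 i else A1 i else A2 i); split.
  - by move=> i /=; rewrite inE => /orP[/KJ1|/KJ2].
  - move=> i; rewrite inE; case: ifPn => K1i /=.
      by move=> _; case: ifPn => K2i; [apply: FI; [exact: FA1|exact: FA2]|exact: FA1].
    by move=> K2i; exact: FA2.
  - apply/seteqP; split => [w [w1 w2] i /=|w h].
      rewrite inE => Ki; case: ifPn => K1i; last first.
        by apply: w2; move: Ki; rewrite /= (negbTE K1i).
      by case: ifPn => K2i; [split; [exact: w1|exact: w2]|exact: w1].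
    split => i /= Ki; have := h i; rewrite /= inE Ki ?orbT => /(_ isT).
      by case: ifPn => // _ [].
    by case: ifPn => // _ [].
have piT J : finite_meets F J setT.
  exists fset0, (fun=> setT); split => //.
  by apply/seteqP; split => // w _ i.
have sub J : block F J `<=` <<s finite_meets F J >>.
  move=> X [i Ji FX]; apply: sub_sigma_algebra.
  exists [fset i]%fset, (fun=> X); split.
  - by move=> j /=; rewrite inE => /eqP ->.
  - by move=> j; rewrite inE => /eqP ->.
  - apply/seteqP; split => [w Xw j //|w]; apply; by rewrite /= inE.
apply: indep_systems_sub (sub J1) (sub J2).
apply: indep_systems_pi => //.
move=> _ _ [K1 [A1 [KJ1 FA1 ->]]] [K2 [A2 [KJ2 FA2 ->]]].
have K12 i : i \in K1 -> i \in K2 -> False.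
  by move=> /KJ1 ? /KJ2 ?; have : (J1 `&` J2) i by []; rewrite J120.
pose A i := if i \in K1 then A1 i else A2 i.
have -> : \bigcap_(i in [set` K1]) A1 i `&` \bigcap_(i in [set` K2]) A2 i =
          \bigcap_(i in [set` (K1 `|` K2)%fset]) A i.
  apply/seteqP; split => [w [w1 w2] i /=|w h].
    rewrite inE /A; case: ifPn => K1i; first by move=> _; exact: w1.
    by move=> K2i; exact: w2.
  split => i /= Ki; have := h i; rewrite /= inE Ki ?orbT => /(_ isT); rewrite /A.
    by rewrite Ki.
  by case: ifPn => // /K12 /(_ Ki).
rewrite (indF _ A); last first.
  move=> i; rewrite inE /A; case: ifPn => K1i; first by move=> _; exact: FA1.
  by move=> K2i; exact: FA2.
rewrite (indF _ A1)// (indF _ A2)//.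
have -> : \prod_(i <- (K1 `|` K2)%fset) P (A i) = \prod_(i <- K1 ++ K2) P (A i).
  apply: perm_big; apply: uniq_perm; rewrite ?fset_uniq//.
    rewrite cat_uniq !fset_uniq andbT /=; apply/hasPn => i K2i.
    by apply/negP => K1i; exact: (K12 i).
  by move=> i; rewrite mem_cat inE.
rewrite big_cat /=; congr (_ * _).
  by apply: eq_big_seq => i K1i; rewrite /A K1i.
apply: eq_big_seq => i K2i; rewrite /A; case: ifPn => // K1i.
by case: (K12 i).
Qed.

End independent_systems.

(** * Freezing one of two independent arguments *)

Section law_integral.
Context {d d' : measure_display} {T : measurableType d} {T' : measurableType d'}
  {R : realType}.
Variable P : probability T R.
Local Open Scope ereal_scope.

(** Both sides are differences of integrals of nonnegative functions, for which
    the formula is the definition of the law. *)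
Lemma integral_law (Z : {mfun T >-> T'}) (g : T' -> \bar R) :
  measurable_fun setT g ->
  \int[distribution P Z]_z g z = \int[P]_w g (Z w).
Proof.
move=> mg; rewrite integralE [RHS]integralE; congr (_ - _).
  rewrite (@ge0_integral_distribution _ _ _ _ _ P Z g^\+)// -?(funepos_comp g Z)//.
  exact: measurable_funepos.
rewrite (@ge0_integral_distribution _ _ _ _ _ P Z g^\-)// -?(funeneg_comp g Z)//.
exact: measurable_funeneg.
Qed.

Lemma integral_eq_law (Y Z : {mfun T >-> T'}) (g : T' -> \bar R) :
  (forall A, measurable A -> distribution P Y A = distribution P Z A) ->
  measurable_fun setT g -> \int[P]_w g (Y w) = \int[P]_w g (Z w).
Proof.
move=> YZ mg; rewrite -!integral_law//; apply: eq_measure_integral => A mA _.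
exact: YZ.
Qed.

Lemma expectationC_eq_law (Y Z : {mfun T >-> T'}) (g : T' -> R[i]) :
  (forall A, measurable A -> distribution P Y A = distribution P Z A) ->
  cmeasurable g ->
  expectationC P (fun w => g (Y w)) = expectationC P (fun w => g (Z w)).
Proof.
move=> YZ [mg1 mg2]; apply: complex_ext; rewrite /expectationC /= !expectation_integral.
  by rewrite (integral_eq_law (g := fun y => (Re (g y))%:E) YZ)//; exact/measurable_EFinP.
by rewrite (integral_eq_law (g := fun y => (Im (g y))%:E) YZ)//; exact/measurable_EFinP.
Qed.

Lemma integrableC_eq_law (Y Z : {mfun T >-> T'}) (g : T' -> R[i]) :
  (forall A, measurable A -> distribution P Y A = distribution P Z A) ->
  cmeasurable g ->
  integrableC P (fun w => g (Y w)) -> integrableC P (fun w => g (Z w)).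
Proof.
move=> YZ mg /integrableC_absP[_ goo]; apply/integrableC_absP; split.
  exact: (measurableC_comp (@measurable_funP _ _ _ _ setT Z) mg).
rewrite -(integral_eq_law (g := fun y => (absC (g y))%:E) YZ)//.
by apply/measurable_EFinP; exact: measurableC_absC.
Qed.

End law_integral.

Section freezing.
Context {d d1 d2 : measure_display} {T : measurableType d}
  {T1 : measurableType d1} {T2 : measurableType d2} {R : realType}.
Variables (P : probability T R) (X : {mfun T >-> T1}) (Y : {mfun T >-> T2}).
Hypothesis XY : forall A B, measurable A -> measurable B ->
  P (X @^-1` A `&` Y @^-1` B) = (P (X @^-1` A) * P (Y @^-1` B))%E.
Local Open Scope ereal_scope.

Let mpair : measurable_fun setT (fun w => (X w, Y w)).
Proof. by apply: measurable_fun_pair. Qed.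

Let Z : {mfun T >-> (T1 * T2)%type} :=
  HB.pack (fun w => (X w, Y w)) (isMeasurableFun.Build _ _ _ _ _ mpair).

Let joint_law A : measurable A ->
  (distribution P X \x distribution P Y) A = distribution P Z A.
Proof.
apply: product_measure_unique => A1 B1 mA1 mB1.
by rewrite /distribution /= /pushforward /= -XY.
Qed.

Let ge0_integral_joint (f : T1 * T2 -> \bar R) :
  measurable_fun setT f -> (forall z, 0 <= f z) ->
  \int[P]_w f (X w, Y w) = \int[P]_w \int[P]_w' f (X w, Y w').
Proof.
move=> mf f0.
rewrite -[LHS]/(\int[P]_w (f \o Z) w) -ge0_integral_distribution//.
rewrite (eq_measure_integral (distribution P X \x distribution P Y)); last first.
  by move=> A mA _; exact/esym/joint_law.
rewrite fubini_tonelli1// ge0_integral_distribution//; last first.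
- by move=> y; apply: integral_ge0.
- exact: measurable_fun_fubini_tonelli_F.
apply: eq_integral => w _ /=; rewrite /fubini_F ge0_integral_distribution//.
by apply: measurableT_comp => //; exact: measurable_pair1.
Qed.

Let integral_joint (f : T1 * T2 -> \bar R) :
  measurable_fun setT f -> \int[P]_w \int[P]_w' `|f (X w, Y w')| < +oo ->
  [/\ P.-integrable setT (fun w => f (X w, Y w)),
    P.-integrable setT (fun w => \int[P]_w' f (X w, Y w')) &
    \int[P]_w f (X w, Y w) = \int[P]_w \int[P]_w' f (X w, Y w')].
Proof.
move=> mf foo.
have fZ : P.-integrable setT (f \o Z).
  apply/integrableP; split; first exact: measurableT_comp.
  by rewrite (ge0_integral_joint (f := fun z => `|f z|))//; exact: measurableT_comp.
have fi : (distribution P X \x distribution P Y).-integrable setT f.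
  apply/integrableP; split => //.
  rewrite (eq_measure_integral (distribution P Z)); last first.
    by move=> A mA _; exact: joint_law.
  rewrite ge0_integral_distribution//; last exact: measurableT_comp.
  by have /integrableP[] := fZ.
have FE w : \int[P]_w' f (X w, Y w') = fubini_F (distribution P Y) f (X w).
  by rewrite /fubini_F integral_law//; apply: measurableT_comp => //; exact: measurable_pair1.
have Fi := integrable_fubini_F fi.
have mF := measurable_int _ Fi.
split => //.
  under eq_fun do rewrite FE.
  apply/integrableP; split; first exact: measurableT_comp.
  rewrite -[X in X < _]/(\int[P]_w ((abse \o fubini_F (distribution P Y) f) \o X) w).
  rewrite -ge0_integral_distribution; first by have /integrableP[] := Fi.
    exact: measurableT_comp.
  by move=> x; exact: abse_ge0.
under [RHS]eq_integral do rewrite FE.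
rewrite -[LHS]/(\int[P]_w (f \o Z) w) -integral_law//.
rewrite (eq_measure_integral (distribution P X \x distribution P Y)); last first.
  by move=> A mA _; exact/esym/joint_law.
by rewrite -integral12_prod_meas1// integral_law.
Qed.

Let measurable_inner (g : T1 * T2 -> R) : measurable_fun setT g ->
  measurable_fun setT (fun w => \int[P]_w' `|(g (X w, Y w'))%:E|).
Proof.
move=> mg; pose k (z : T1 * T2) := `|(g z)%:E|.
have mk : measurable_fun setT k.
  by apply: measurableT_comp => //; exact/measurable_EFinP.
rewrite [X in measurable_fun _ X](_ : _ = fubini_F (distribution P Y) k \o X).
  apply: measurableT_comp => //; apply: measurable_fun_fubini_tonelli_F => //.
  by move=> z; exact: abse_ge0.
apply/funext => w /=; rewrite /fubini_F integral_law//.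
by apply: measurableT_comp => //; exact: measurable_pair1.
Qed.

(** Independence makes the joint law of [X] and [Y] a product measure, so that
    Fubini's theorem applies to the coordinates of [f]. *)
Lemma freezingC (f : T1 -> T2 -> R[i]) :
  cmeasurable (fun z : T1 * T2 => f z.1 z.2) ->
  \int[P]_w \int[P]_w' (absC (f (X w) (Y w')))%:E < +oo ->
  [/\ integrableC P (fun w => f (X w) (Y w)),
    cmeasurable (fun w => expectationC P (fun w' => f (X w) (Y w'))) &
    expectationC P (fun w => f (X w) (Y w)) =
    expectationC P (fun w => expectationC P (fun w' => f (X w) (Y w')))].
Proof.
move=> mf foo.
have [mRe mIm] := mf.
have bound (g : R[i] -> R) : (forall x, `|g x| <= absC x)%R ->
    measurable_fun setT (fun z : T1 * T2 => g (f z.1 z.2)) ->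
    \int[P]_w \int[P]_w' `|(g (f (X w) (Y w')))%:E| < +oo.
  move=> gle mg; apply: le_lt_trans foo.
  have absE w : \int[P]_w' (absC (f (X w) (Y w')))%:E =
      \int[P]_w' `|(absC (f (X w) (Y w')))%:E|.
    by apply: eq_integral => w' _; rewrite /= (ger0_norm (absC_ge0 _)).
  under [leRHS]eq_integral do rewrite absE.
  have mabs := measurableC_absC mf.
  have sec (h : R[i] -> R) w : measurable_fun setT (fun z : T1 * T2 => h (f z.1 z.2)) ->
      measurable_fun setT (fun w' => `|(h (f (X w) (Y w')))%:E|).
    move=> mh; apply: measurableT_comp => //; apply/measurable_EFinP.
    have : measurable_fun setT ((fun y => h (f (X w) y)) \o Y); last by [].
    apply: measurableT_comp => //.
    exact: (measurableT_comp mh (measurable_pair1 (X w))).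
  apply: ge0_le_integral => //=.
  - by move=> w _; apply: integral_ge0.
  - exact: (measurable_inner mg).
  - exact: (measurable_inner mabs).
  - move=> w _; apply: ge0_le_integral => //=.
    + exact: sec.
    + exact: sec.
    + by move=> w' _; rewrite lee_fin (ger0_norm (absC_ge0 _)).
have mfRe : measurable_fun setT (fun z : T1 * T2 => (Re (f z.1 z.2))%:E).
  exact/measurable_EFinP.
have mfIm : measurable_fun setT (fun z : T1 * T2 => (Im (f z.1 z.2))%:E).
  exact/measurable_EFinP.
have [iR jR eR] := integral_joint mfRe (bound _ (@Re_le_absC R) mRe).
have [iI jI eI] := integral_joint mfIm (bound _ (@Im_le_absC R) mIm).
split; first by split.
  split; rewrite /expectationC /= unlock; apply: measurableT_comp => //.
    exact: measurable_int jR.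
  exact: measurable_int jI.
have fin_ae (u : T -> \bar R) : P.-integrable setT u ->
    \int[P]_w u w = \int[P]_w (fine (u w))%:E.
  move=> ui; have mu := measurable_int _ ui.
  apply: ae_eq_integral => //.
    by apply/measurable_EFinP; exact: measurableT_comp.
  have /= := integrable_ae measurableT ui.
  by apply: filterS => w /(_ I) uw _; rewrite /= fineK.
apply: complex_ext; rewrite /= !unlock.
  by rewrite eR fin_ae//=; congr fine; apply: eq_integral => w _; rewrite unlock.
by rewrite eI fin_ae//=; congr fine; apply: eq_integral => w _; rewrite unlock.
Qed.

(** In the applications, the inner expectation and a bound on the inner absolute
    moment are known in closed form, but only for almost every frozen outcome. *)
Lemma freezingC_ae (f : T1 -> T2 -> R[i]) (h : T -> R[i]) (k : T -> \bar R) :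
  cmeasurable (fun z : T1 * T2 => f z.1 z.2) ->
  cmeasurable h -> measurable_fun setT k -> (forall w, 0 <= k w) ->
  \int[P]_w k w < +oo ->
  {ae P, forall w, \int[P]_w' (absC (f (X w) (Y w')))%:E <= k w} ->
  {ae P, forall w, expectationC P (fun w' => f (X w) (Y w')) = h w} ->
  integrableC P (fun w => f (X w) (Y w)) /\
  expectationC P (fun w => f (X w) (Y w)) = expectationC P h.
Proof.
move=> mf mh mk k0 koo fk fh.
have [|fi mE ->] := freezingC mf.
- apply: le_lt_trans koo; apply: ae_ge0_le_integral => //.
  + by move=> w _; apply: integral_ge0 => w' _; rewrite lee_fin absC_ge0.
  + have := measurable_inner (measurableC_absC mf).
    congr (measurable_fun _ _); apply/funext => w.
    by apply: eq_integral => w' _; rewrite /= (ger0_norm (absC_ge0 _)).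
  + by apply: filterS fk => w + _.
- by split => //; exact: expectationC_ae.
Qed.

End freezing.

Section freezing_systems.
Context {d : measure_display} {T : measurableType d} {R : realType}.
Variable P : probability T R.
Local Open Scope ereal_scope.

Definition measurable_wrt (G : set_system T) {d'} {T' : measurableType d'}
    (X : T -> T') : Prop :=
  measurable_fun (setT : set (g_sigma_algebraType G)) X.

Definition measurableC_wrt (G : set_system T) (f : T -> R[i]) : Prop :=
  @cmeasurable _ (g_sigma_algebraType G) R f.

Lemma measurable_wrt_preimage (G : set_system T) d' (T' : measurableType d')
    (X : T -> T') :
  preimage_set_system setT X measurable `<=` G -> measurable_wrt G X.
Proof.
move=> XG _ B mB; apply: sub_sigma_algebra; apply: XG.
by exists B.
Qed.

Lemma measurable_wrtW (G : set_system T) d' (T' : measurableType d')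
    (X : T -> T') :
  G `<=` measurable -> measurable_wrt G X -> measurable_fun setT X.
Proof. by move=> GM mX _ B mB; apply: (g_sigma_measurable GM); exact: mX. Qed.

Lemma measurableC_wrtW (G : set_system T) (f : T -> R[i]) :
  G `<=` measurable -> measurableC_wrt G f -> cmeasurable f.
Proof. by move=> GM [f1 f2]; split; apply: (measurable_wrtW GM). Qed.

Let measurable_id_sub (G : set_system T) : G `<=` measurable ->
  @measurable_fun _ _ T (g_sigma_algebraType G) setT (fun w => w).
Proof. by move=> GM _ A GA; rewrite setTI; exact: (g_sigma_measurable GM). Qed.

Let id_mfun (G : set_system T) (GM : G `<=` measurable) :
  {mfun T >-> g_sigma_algebraType G} :=
  HB.pack (fun w : T => w : g_sigma_algebraType G)
    (isMeasurableFun.Build _ _ T (g_sigma_algebraType G) (fun w : T => w)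
      (measurable_id_sub GM)).

(** The identity of [T], read as a variable with values in [T] equipped with the
    sigma-algebra generated by [G], turns independence of sigma-algebras into
    independence of variables. *)
Lemma freezing_systems (G H : set_system T) (f : T -> T -> R[i])
    (h : T -> R[i]) (k : T -> \bar R) :
  G `<=` measurable -> H `<=` measurable -> indep_systems P G H ->
  @cmeasurable _ (g_sigma_algebraType G * g_sigma_algebraType H)%type R
    (fun z => f z.1 z.2) ->
  cmeasurable h -> measurable_fun setT k -> (forall w, 0 <= k w) ->
  \int[P]_w k w < +oo ->
  {ae P, forall w, \int[P]_w' (absC (f w w'))%:E <= k w} ->
  {ae P, forall w, expectationC P (f w) = h w} ->
  integrableC P (fun w => f w w) /\
  expectationC P (fun w => f w w) = expectationC P h.
Proof.
move=> GM HM GH mf mh mk k0 koo fk fh.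
exact: (@freezingC_ae _ _ _ _ _ _ _ P (id_mfun GM) (id_mfun HM) GH f h k).
Qed.

Lemma expectationC_indepM (G H : set_system T) (u v : T -> R[i]) :
  G `<=` measurable -> H `<=` measurable -> indep_systems P G H ->
  measurableC_wrt G u -> measurableC_wrt H v ->
  integrableC P u -> integrableC P v ->
  integrableC P (fun w => u w * v w)%R /\
  expectationC P (fun w => u w * v w)%R = (expectationC P u * expectationC P v)%R.
Proof.
move=> GM HM GH mu mv ui vi.
have [muT uoo] := (integrableC_absP P u).1 ui.
have [mvT voo] := (integrableC_absP P v).1 vi.
have v0 : 0 <= \int[P]_w (absC (v w))%:E.
  by apply: integral_ge0 => w _; rewrite lee_fin absC_ge0.
have vE : (fine (\int[P]_w (absC (v w))%:E))%:E = \int[P]_w (absC (v w))%:E.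
  by rewrite fineK// ge0_fin_numE.
have mabs : measurable_fun setT (fun w => (absC (u w))%:E).
  by apply/measurable_EFinP; exact: measurableC_absC.
have mabsv : measurable_fun setT (fun w => (absC (v w))%:E).
  by apply/measurable_EFinP; exact: measurableC_absC.
have [|||||||uvi ->] := @freezing_systems G H (fun w w' => u w * v w')%R
  (fun w => expectationC P v * u w)%R
  (fun w => \int[P]_w' (absC (v w'))%:E * (absC (u w))%:E) GM HM GH.
- apply: measurableCM.
    exact: (measurableC_comp (h := fst) measurable_fst mu).
  exact: (measurableC_comp (h := snd) measurable_snd mv).
- by apply: measurableCM => //; exact: measurableC_cst.
- by rewrite -vE; apply: emeasurable_funM => //; exact: measurable_cst.
- by move=> w; rewrite mule_ge0// lee_fin absC_ge0.
- rewrite ge0_integralZl//; last by move=> w _; rewrite lee_fin absC_ge0.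
  by rewrite lte_mul_pinfty// ge0_fin_numE.
- apply: aeW => w /=; under eq_integral do rewrite absCM EFinM.
  rewrite ge0_integralZl// ?lee_fin ?absC_ge0//; last first.
    by move=> w' _; rewrite lee_fin absC_ge0.
  by rewrite muleC.
- by apply: aeW => w; rewrite expectationCZ// mulrC.
- by split => //; rewrite expectationCZ// mulrC.
Qed.

End freezing_systems.

(** * Partitions, random indices and products of independent factors *)

Section partition.
Context {d : measure_display} {T : measurableType d} {R : realType}.
Variables (P : probability T R) (B : (set T)^nat).
Hypotheses (mB : forall k, measurable (B k)) (tB : trivIset setT B).
Hypothesis covB : {ae P, forall w, exists k, B k w}.
Local Open Scope ereal_scope.

Let mU : measurable (\bigcup_k B k).
Proof. exact: bigcupT_measurable. Qed.

Let ae_restrict (g : T -> \bar R) : {ae P, forall w, g w = (g \_ (\bigcup_k B k)) w}.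
Proof.
apply: filterS covB => w [k Bk]; rewrite patchE mem_set//.
by exists k.
Qed.

Lemma integral_absC_partition (f : T -> R[i]) : cmeasurable f ->
  \int[P]_w (absC (f w))%:E =
  \sum_(k <oo) \int[P]_w (absC (f w * (\1_(B k) w)%:C))%:E.
Proof.
move=> mf.
have mabs : measurable_fun setT (fun w => (absC (f w))%:E).
  by apply/measurable_EFinP; exact: measurableC_absC.
rewrite (ge0_ae_eq_integral (g := (fun w => (absC (f w))%:E) \_ (\bigcup_k B k)))//.
- rewrite -integral_mkcond ge0_integral_bigcup//=; last 2 first.
  + exact: measurable_funTS.
  + by move=> w _; rewrite lee_fin absC_ge0.
  apply: eq_eseriesr => k _; rewrite integral_mkcond; apply: eq_integral => w _.
  rewrite patchE indicE; case: ifPn => _.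
    by rewrite mulr1.
  by rewrite mulr0 absC0.
- by apply/(measurable_restrictT _ _).1 => //; exact: measurable_funTS.
- by move=> w _; rewrite lee_fin absC_ge0.
- by move=> w _; rewrite patchE; case: ifPn => // _; rewrite lee_fin absC_ge0.
- by apply: filterS (ae_restrict (fun w => (absC (f w))%:E)) => w + _.
Qed.

Let cvg_partition (g : T -> R) : P.-integrable setT (EFin \o g) ->
  fine (\int[P]_w (g w * \sum_(k < n) \1_(B k) w)%:E) @[n --> \oo] -->
  fine (\int[P]_w (g w)%:E).
Proof.
move=> gi; have mg := measurable_int _ gi.
have partial n w : (\sum_(k < n) \1_(B k) w = \1_(\bigcup_(k < n) B k) w :> R)%R.
  have [[k /= kn Bk]|nB] := pselect ((\bigcup_(k < n) B k) w); last first.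
    rewrite indicE memNset// big1// => k _; rewrite indicE memNset// => Bk.
    by apply: nB; exists (val k) => //=.
  rewrite (bigD1 (Ordinal kn))//= !indicE !mem_set//; last by exists k.
  rewrite big1 ?addr0// => j jk; rewrite indicE memNset// => Bj.
  move/negP: jk; apply; apply/eqP/val_inj => /=.
  by apply: tB => //; exists w.
apply/fine_cvg; rewrite fineK; last exact: integrable_fin_num gi.
have [|||||_ _] := @dominated_convergence _ _ _ P setT measurableT
  (fun n w => (g w * \sum_(k < n) \1_(B k) w)%:E) (EFin \o g)
  (fun w => `|(g w)%:E|).
- move=> n; apply/measurable_EFinP; apply: measurable_funM; first exact/measurable_EFinP.
  under eq_fun do rewrite partial; apply: measurable_indic.
  by apply: bigcup_measurable => k _.
- exact: measurable_int gi.
- apply: filterS covB => w [k Bk] _; apply: cvg_near_cst.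
  near=> n; rewrite partial indicE mem_set ?mulr1//.
  by exists k => //=; near: n; exists k.+1.
- exact: integrable_abse.
- apply: aeW => w n _ /=; rewrite lee_fin normrM ler_piMr// partial indicE.
  by case: (w \in _); rewrite ?normr1 ?normr0.
- by apply.
Unshelve. all: by end_near. Qed.

(** Dominated convergence along the partial unions of the partition. *)
Lemma expectationC_partition (f : T -> R[i]) : integrableC P f ->
  Re (\sum_(k < n) expectationC P (fun w => f w * (\1_(B k) w)%:C))%R @[n --> \oo] -->
    Re (expectationC P f) /\
  Im (\sum_(k < n) expectationC P (fun w => f w * (\1_(B k) w)%:C))%R @[n --> \oo] -->
    Im (expectationC P f).
Proof.
move=> fi; have iB k := integrableC_indicM fi (mB k).
have sumE n : (\sum_(k < n) expectationC P (fun w => f w * (\1_(B k) w)%:C) =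
    expectationC P (fun w => f w * (\sum_(k < n) \1_(B k) w)%:C))%R.
  rewrite -(big_mkord xpredT (fun k => expectationC P (fun w => f w * (\1_(B k) w)%:C)%R)).
  rewrite -expectationC_sum//; congr expectationC; apply/funext => w.
  by rewrite big_mkord rmorph_sum /= mulr_sumr.
have ReE n : Re (\sum_(k < n) expectationC P (fun w => f w * (\1_(B k) w)%:C))%R =
    fine (\int[P]_w (Re (f w) * \sum_(k < n) \1_(B k) w)%:E).
  rewrite sumE /expectationC /= unlock; congr fine; apply: eq_integral => w _.
  by rewrite complexReM /= mulr0 subr0.
have ImE n : Im (\sum_(k < n) expectationC P (fun w => f w * (\1_(B k) w)%:C))%R =
    fine (\int[P]_w (Im (f w) * \sum_(k < n) \1_(B k) w)%:E).
  rewrite sumE /expectationC /= unlock; congr fine; apply: eq_integral => w _.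
  by rewrite complexImM /= mulr0 add0r.
split.
  rewrite (funext ReE) /expectationC /= expectation_integral.
  by apply: cvg_partition; have [] := fi.
rewrite (funext ImE) /expectationC /= expectation_integral.
by apply: cvg_partition; have [] := fi.
Qed.

End partition.

Section random_index.
Context {d : measure_display} {T : measurableType d}.

(** The fibres of the index form a countable measurable partition. *)
Lemma measurable_fun_random_index d' (T' : measurableType d')
    (N : T -> nat) (F : nat -> T -> T') :
  measurable_fun setT N -> (forall n, measurable_fun setT (F n)) ->
  measurable_fun setT (fun w => F (N w) w).
Proof.
move=> mN mF _ A mA; rewrite setTI.
have -> : (fun w => F (N w) w) @^-1` A =
    \bigcup_n (N @^-1` [set n] `&` F n @^-1` A).
  apply/seteqP; split => [w Aw|w [n _ [/= -> //]]].
  by exists (N w).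
apply: bigcupT_measurable => n; apply: measurableI.
  by rewrite -[X in measurable X]setTI; exact: mN.
by rewrite -[X in measurable X]setTI; exact: mF.
Qed.

Lemma measurableC_random_index {R : realType} (N : T -> nat) (F : nat -> T -> R[i]) :
  measurable_fun setT N -> (forall n, cmeasurable (F n)) ->
  cmeasurable (fun w => F (N w) w).
Proof.
move=> mN mF; split.
  exact: (measurable_fun_random_index (F := fun n w => Re (F n w)) mN (fun n => (mF n).1)).
exact: (measurable_fun_random_index (F := fun n w => Im (F n w)) mN (fun n => (mF n).2)).
Qed.

End random_index.

Section independent_products.
Context {d d' : measure_display} {T : measurableType d} {T' : measurableType d'}
  {R : realType}.
Variable P : probability T R.
Context {I : choiceType}.
Variable X : I -> T -> T'.
Hypothesis mX : forall i, measurable_fun setT (X i).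
Hypothesis iX : independent_RVs P X.

Definition RV_block (J : set I) : set_system T :=
  block (fun i => preimage_set_system setT (X i) measurable) J.

Lemma RV_block_measurable J : RV_block J `<=` measurable.
Proof. by move=> _ [i _ [A mA <-]]; exact: mX. Qed.

Lemma sub_RV_block J1 J2 : J1 `<=` J2 -> RV_block J1 `<=` RV_block J2.
Proof. by move=> J12 A [i Ji Ai]; exists i => //; exact: J12. Qed.

Lemma measurable_wrt_RV_block J i : J i -> measurable_wrt (RV_block J) (X i).
Proof.
by move=> Ji; apply: measurable_wrt_preimage => A XA; exists i.
Qed.

Lemma measurableC_wrt_sub (G H : set_system T) (f : T -> R[i]) :
  G `<=` <<s H >> -> measurableC_wrt G f -> measurableC_wrt H f.
Proof.
move=> GH [f1 f2]; split => mT B mB.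
  by apply: (sub_g_sigma_sigma GH); exact: f1.
by apply: (sub_g_sigma_sigma GH); exact: f2.
Qed.

Lemma indep_RV_blocks J1 J2 : J1 `&` J2 = set0 ->
  indep_systems P (RV_block J1) (RV_block J2).
Proof.
move=> J12; apply: indep_blocks => //.
  by move=> i _ [A mA <-]; exact: mX.
move=> i _ _ [A mA <-] [B mB <-]; exists (A `&` B); first exact: measurableI.
by rewrite !setTI preimage_setI.
Qed.

(** Multiplying [u] by one factor after the other keeps it measurable with
    respect to a block of variables disjoint from the remaining factors. *)
Lemma expectationC_indep_prod (g : T' -> R[i]) (J : set I) (u : T -> R[i]) (s : seq I) :
  cmeasurable g -> (forall i, integrableC P (fun w => g (X i w))) ->
  measurableC_wrt (RV_block J) u -> integrableC P u ->
  uniq s -> (forall i, i \in s -> ~ J i) ->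
  integrableC P (fun w => u w * \prod_(i <- s) g (X i w)) /\
  expectationC P (fun w => u w * \prod_(i <- s) g (X i w)) =
  expectationC P u * \prod_(i <- s) expectationC P (fun w => g (X i w)).
Proof.
move=> mg ig; elim: s => [|i s IH] in J u *.
  move=> mu iu _ _; under eq_fun do rewrite big_nil mulr1.
  by rewrite big_nil mulr1.
move=> mu iu /andP[is_ us] sJ.
have mgi (K : set I) : K i -> measurableC_wrt (RV_block K) (fun w => g (X i w)).
  by move=> Ki; apply: (measurableC_comp _ mg); exact: measurable_wrt_RV_block.
have [ugi ugE] : integrableC P (fun w => u w * g (X i w)) /\
    expectationC P (fun w => u w * g (X i w)) =
    expectationC P u * expectationC P (fun w => g (X i w)).
  apply: (@expectationC_indepM _ _ _ _ (RV_block J) (RV_block [set i])) => //.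
  - exact: RV_block_measurable.
  - exact: RV_block_measurable.
  - apply: indep_RV_blocks; apply/seteqP; split => // j [/= Jj ji].
    by move: Jj; rewrite ji; apply: sJ; exact: mem_head.
  - exact: mgi.
have [||||] := IH (J `|` [set i]) (fun w => u w * g (X i w)) => //.
- apply: measurableCM.
    by apply: measurableC_wrt_sub mu; apply: subset_trans (@sub_sigma_algebra _ setT _);
      apply: sub_RV_block => j; left.
  by apply: mgi; right.
- move=> j js [Jj|/= ji].
    by apply: (sJ j) => //; rewrite inE js orbT.
  by move/negP: is_; apply; rewrite -ji.
- move=> IHi IHE; split.
    by under eq_fun do rewrite big_cons mulrA.
  under eq_fun do rewrite big_cons mulrA.
  by rewrite IHE ugE big_cons mulrA.
Qed.

End independent_products.

(** * Complex integrals against an exponential law *)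

Section complex_derivative.
Context {R : realType}.
Implicit Types (F G : R -> R[i]) (x : R) (k l : R[i]).

Definition is_deriveC F x l : Prop :=
  is_derive x 1 (fun y => Re (F y)) (Re l) /\
  is_derive x 1 (fun y => Im (F y)) (Im l).

Lemma is_deriveC_cst k x : is_deriveC (fun=> k) x 0.
Proof. by split; exact: is_derive_cst. Qed.

Lemma is_deriveC_eq F x k l : is_deriveC F x k -> k = l -> is_deriveC F x l.
Proof. by move=> + <-. Qed.

Lemma is_deriveCD F G x k l : is_deriveC F x k -> is_deriveC G x l ->
  is_deriveC (fun y => F y + G y) x (k + l).
Proof.
move=> [F1 F2] [G1 G2]; split.
  by under eq_fun do rewrite complexReD; rewrite complexReD; exact: is_deriveD.
by under eq_fun do rewrite complexImD; rewrite complexImD; exact: is_deriveD.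
Qed.

Lemma is_deriveCM F G x k l : is_deriveC F x k -> is_deriveC G x l ->
  is_deriveC (fun y => F y * G y) x (F x * l + k * G x).
Proof.
move=> [F1 F2] [G1 G2]; split.
  under eq_fun do rewrite complexReM.
  apply: is_derive_eq (is_deriveB (is_deriveM F1 G1) (is_deriveM F2 G2)) _.
  by rewrite /GRing.scale /= complexReD !complexReM; ring.
under eq_fun do rewrite complexImM.
apply: is_derive_eq (is_deriveD (is_deriveM F1 G2) (is_deriveM F2 G1)) _.
by rewrite /GRing.scale /= complexImD !complexImM; ring.
Qed.

Lemma is_deriveCZ F k x l : is_deriveC F x l ->
  is_deriveC (fun y => k * F y) x (k * l).
Proof.
move=> dF; apply: is_deriveC_eq (is_deriveCM (is_deriveC_cst k x) dF) _.
by rewrite mul0r addr0.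
Qed.

Lemma is_deriveC_sum n (F : nat -> R -> R[i]) (l : nat -> R[i]) x :
  (forall j, is_deriveC (F j) x (l j)) ->
  is_deriveC (fun y => \sum_(j < n) F j y) x (\sum_(j < n) l j).
Proof.
move=> dF; elim: n => [|n IH].
  by under eq_fun do rewrite big_ord0; rewrite big_ord0; exact: is_deriveC_cst.
by under eq_fun do rewrite big_ord_recr /=; rewrite big_ord_recr /=; exact: is_deriveCD.
Qed.

Lemma is_deriveC_real x : is_deriveC (fun y => y%:C) x 1.
Proof. by split => /=; [exact: is_derive_id|exact: is_derive_cst]. Qed.

Lemma is_deriveCX F x l n : is_deriveC F x l ->
  is_deriveC (fun y => F y ^+ n.+1) x (n.+1%:R * F x ^+ n * l).
Proof.
move=> dF; elim: n => [|n IH].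
  by under eq_fun do rewrite expr1; rewrite expr0 mulr1 mul1r.
under eq_fun do rewrite exprS.
apply: is_deriveC_eq (is_deriveCM dF IH) _.
by rewrite -[in RHS]natr1 exprS; ring.
Qed.

Lemma is_deriveC_expC F x l : is_deriveC F x l ->
  is_deriveC (fun y => expC (F y)) x (expC (F x) * l).
Proof.
move=> [F1 F2].
have dE := is_derive1_comp (is_derive_expR (Re (F x))) F1.
have dC := is_derive1_comp (is_derive_cos (Im (F x))) F2.
have dS := is_derive1_comp (is_derive_sin (Im (F x))) F2.
split; rewrite /expC /=.
  apply: is_derive_eq (is_deriveM dE dC) _.
  by rewrite /GRing.scale /= complexReM /=; ring.
apply: is_derive_eq (is_deriveM dE dS) _.
by rewrite /GRing.scale /= complexImM /=; ring.
Qed.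

Lemma is_deriveC_continuous F l x : is_deriveC F x l ->
  {for x, continuous (fun y => Re (F y))} /\
  {for x, continuous (fun y => Im (F y))}.
Proof.
by move=> [F1 F2]; split; apply: differentiable_continuous;
  apply/derivable1_diffP; exact: ex_derive.
Qed.

End complex_derivative.

Section exponential_law.
Context {d : measure_display} {T : measurableType d} {R : realType}.
Variables (P : probability T R) (Z : {RV P >-> R}) (rate : R).
Hypothesis rate_gt0 : 0 < rate.
Hypothesis lawZ : forall A : set R, measurable A ->
  distribution P Z A = exponential_prob rate A.
Notation mu := (@lebesgue_measure R).
Local Open Scope ereal_scope.

(** [Z] with values in the measurable type that carries the Lebesgue measure. *)
Let mZL : @measurable_fun _ _ T (measurableTypeR R) setT Z.
Proof.
by move=> mT B mB; rewrite setTI; exact: (@measurable_funPTI _ _ _ _ Z B mB).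
Qed.

Let ZL : {mfun T >-> measurableTypeR R} :=
  HB.pack (Z : T -> measurableTypeR R)
    (isMeasurableFun.Build _ _ T (measurableTypeR R) Z mZL).

Let law_dominated : distribution P ZL `<< mu.
Proof.
apply/null_content_dominatesP => A mA muA0.
rewrite -[LHS]/(distribution P Z A) lawZ//.
apply: null_set_integral => //; apply/measurable_EFinP; apply: measurable_funTS.
exact: measurable_exponential_pdf.
Qed.

Let mpdf : measurable_fun setT (EFin \o @exponential_pdf R rate).
Proof. by apply/measurable_EFinP; exact: measurable_exponential_pdf. Qed.

(** The density is the Radon-Nikodym derivative of the law. *)
Lemma integral_exponential_law (f : R -> R) : measurable_fun setT f ->
  P.-integrable setT (fun w => (f (Z w))%:E) ->
  \int[P]_w (f (Z w))%:E = \int[mu]_x (f x * exponential_pdf rate x)%:E.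
Proof.
move=> mf fi.
have mfE : measurable_fun (setT : set (measurableTypeR R)) (EFin \o f).
  exact/measurable_EFinP.
have fL : (distribution P ZL).-integrable setT (EFin \o f).
  exact: (integrable_pushforward (phi := ZL) _ mfE fi measurableT).
have <- : \int[distribution P ZL]_x (EFin \o f) x = \int[P]_w (f (Z w))%:E.
  exact: (integral_pushforward (phi := ZL) _ mfE fi measurableT).
refine (etrans (esym (@Radon_Nikodym_change_of_variables _ _ R
  (distribution P ZL) mu law_dominated _ setT measurableT fL)) _).
apply: ae_eq_integral => //.
- exact: emeasurable_funM.
- apply/measurable_EFinP; apply: measurable_funM => //.
  exact: measurable_exponential_pdf.
- rewrite [X in ae_eq _ _ _ X](_ : _ = (EFin \o f) \* (EFin \o exponential_pdf rate))//.
  apply: ae_eqe_mul2l.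
  apply: integral_ae_eq => //=.
  + exact: Radon_Nikodym_integrable.
  + by move=> E _ mE; rewrite -Radon_Nikodym_integral//; exact: lawZ.
Qed.

Lemma exponential_law_gt0 : {ae P, forall w, (0 < Z w)%R}.
Proof.
exists (Z @^-1` `]-oo, 0%R]); split.
- by rewrite -[X in measurable X]setTI; exact: measurable_funP.
- rewrite -[LHS]/(distribution P Z `]-oo, 0%R]) lawZ// /exponential_prob.
  rewrite -integral_itv_bndo_bndc; last exact: measurable_funTS.
  apply: integral0_eq => x /=; rewrite in_itv /= => x0.
  by rewrite lt0_exponential_pdf.
- by move=> w /= /negP; rewrite in_itv /= -leNgt.
Qed.

Let continuous_bounded (g : R -> R) (b : R) : (0 <= b)%R -> continuous g ->
  exists m : R, forall x : R, (0 <= x <= b)%R -> (`|g x| <= m)%R.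
Proof.
move=> b0 cg.
have [|c _ gc] := @EVT_max R (fun x => `|g x|)%R 0%R b b0.
  apply: continuous_subspaceT => x; apply: continuous_comp; first exact: cg.
  exact: norm_continuous.
by exists `|g c|%R => x xb; apply: gc; rewrite in_itv.
Qed.

Let FTC_coordinate (f F : R -> R) (b : R) : (0 < b)%R -> continuous f ->
  (forall x : R, is_derive x (1%R : R) F (f x * (rate * expR (- rate * x)))%R) ->
  P.-integrable setT (fun w => (f (Z w) * \1_(`[0%R, b[%classic) (Z w))%:E) /\
  \int[P]_w (f (Z w) * \1_(`[0%R, b[%classic) (Z w))%:E = (F b - F 0%R)%:E.
Proof.
move=> b0 cf dF.
have mf : measurable_fun setT f by exact: continuous_measurable_fun.
have mfi : measurable_fun setT (fun x => f x * \1_(`[0%R, b[%classic) x)%R.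
  by apply: measurable_funM => //; exact: measurable_indic.
have [m fm] := continuous_bounded (ltW b0) cf.
have fi : P.-integrable setT (fun w => (f (Z w) * \1_(`[0%R, b[%classic) (Z w))%:E).
  apply: (@le_integrable _ _ _ _ _ _ _ (fun=> (Num.max 0 m)%:E)) => //.
  - by apply/measurable_EFinP; exact: (measurableT_comp mfi (@measurable_funP _ _ _ _ setT Z)).
  - move=> w _ /=; rewrite lee_fin indicE; case: (boolP (_ \in _)) => [|_].
      rewrite inE /= in_itv /= => /andP[Z0 Zb]; rewrite mulr1.
      apply: (@le_trans _ _ m); first by apply: fm; rewrite Z0 ltW.
      by rewrite (le_trans _ (ler_norm _))// le_max lexx orbT.
    by rewrite mulr0 normr0.
  - exact: finite_measure_integrable_cst.
split => //.
rewrite (integral_exponential_law mfi fi).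
pose g x := (f x * (rate * expR (- rate * x)))%R.
have cg : continuous g.
  move=> x; apply: (@continuousM R R^o f); first exact: cf.
  apply: (@continuousM R R^o (fun=> rate)); first exact: cst_continuous.
  apply: continuous_comp; last exact: continuous_expR.
  by apply: (@continuousM R R^o (fun=> - rate)%R) => //; exact: cst_continuous.
have mg : measurable_fun setT g by exact: continuous_measurable_fun.
transitivity (\int[mu]_(x in `[0%R, b[) (g x)%:E).
  rewrite [RHS]integral_mkcond; apply: eq_integral => x _.
  rewrite patchE indicE; case: ifPn => [|_]; last by rewrite mulr0 mul0r.
  rewrite inE /= in_itv /= => /andP[x0 _].
  by rewrite mulr1 exponential_pdfE.
rewrite integral_itv_bndo_bndc; last by apply: measurable_funTS; exact/measurable_EFinP.
have cF : continuous F.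
  by move=> x; apply: differentiable_continuous; apply/derivable1_diffP; exact: ex_derive.
rewrite (@continuous_FTC2 _ g F)//.
- exact: continuous_subspaceT.
- split.
  + by move=> x _; exact: ex_derive.
  + by apply: cvg_at_right_filter; exact: cF.
  + by apply: cvg_at_left_filter; exact: cF.
- by move=> x _; rewrite derive1E; exact: derive_val.
Qed.

(** The function [F] is a primitive of [f] times the exponential density, to
    which the fundamental theorem of calculus applies coordinatewise. *)
Lemma expectationC_exponential_itv (f F : R -> R[i]) (b : R) : (0 < b)%R ->
  (forall x, exists l, is_deriveC f x l) ->
  (forall x, is_deriveC F x (f x * (rate * expR (- rate * x))%:C)%R) ->
  integrableC P (fun w => f (Z w) * (\1_(`[0%R, b[%classic) (Z w))%:C)%R /\
  expectationC P (fun w => f (Z w) * (\1_(`[0%R, b[%classic) (Z w))%:C)%R =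
  (F b - F 0)%R.
Proof.
move=> b0 df dF.
have cf1 : continuous (fun x => Re (f x)).
  by move=> x; have [l /is_deriveC_continuous[]] := df x.
have cf2 : continuous (fun x => Im (f x)).
  by move=> x; have [l /is_deriveC_continuous[]] := df x.
have [|i1 e1] := FTC_coordinate (F := fun x => Re (F x)) b0 cf1.
  move=> x; have [+ _] := dF x.
  by rewrite complexReM /= mulr0 subr0.
have [|i2 e2] := FTC_coordinate (F := fun x => Im (F x)) b0 cf2.
  move=> x; have [_ +] := dF x.
  by rewrite complexImM /= mulr0 add0r.
have ReE w : Re (f (Z w) * (\1_(`[0%R, b[%classic) (Z w))%:C)%R =
    (Re (f (Z w)) * \1_(`[0%R, b[%classic) (Z w))%R.
  by rewrite complexReM /= mulr0 subr0.
have ImE w : Im (f (Z w) * (\1_(`[0%R, b[%classic) (Z w))%:C)%R =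
    (Im (f (Z w)) * \1_(`[0%R, b[%classic) (Z w))%R.
  by rewrite complexImM /= mulr0 add0r.
split.
  by split; [under eq_fun do rewrite ReE|under eq_fun do rewrite ImE].
apply: complex_ext; rewrite /expectationC /= expectation_integral.
  by under eq_integral do rewrite ReE; rewrite e1 complexReD complexReN.
by under eq_integral do rewrite ImE; rewrite e2 complexImD complexImN.
Qed.

End exponential_law.

Section exponential_expectations.
Context {d : measure_display} {T : measurableType d} {R : realType}.
Variables (P : probability T R) (Z : {RV P >-> R}) (rate : R).
Hypothesis rate_gt0 : 0 < rate.
Hypothesis lawZ : forall A : set R, measurable A ->
  distribution P Z A = exponential_prob rate A.

(** The half-line is exhausted by the intervals [k, k + 1[, over which the
    theorem on bounded intervals telescopes. *)
Lemma expectationC_exponential (f F : R -> R[i]) :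
  (forall x, exists l, is_deriveC f x l) ->
  (forall x, is_deriveC F x (f x * (rate * expR (- rate * x))%:C)) ->
  integrableC P (fun w => f (Z w)) ->
  absC (F n%:R) @[n --> \oo] --> (0 : R) ->
  expectationC P (fun w => f (Z w)) = - F 0.
Proof.
move=> df dF fi F0.
pose B k := Z @^-1` `[k%:R, k.+1%:R[%classic.
have mB k : measurable (B k).
  by rewrite -[X in measurable X]setTI; exact: measurable_funP.
have tB : trivIset setT B.
  apply/trivIsetP => i j _ _ ij; apply/seteqP; split => // w [].
  rewrite /B /= !in_itv /= => /andP[i1 i2] /andP[j1 j2].
  have ij1 : (i < j.+1)%N by rewrite -(ltr_nat R) (le_lt_trans i1).
  have ji1 : (j < i.+1)%N by rewrite -(ltr_nat R) (le_lt_trans j1).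
  by move/negP: ij; apply; rewrite eqn_leq -ltnS ij1.
have covB : {ae P, forall w, exists k, B k w}.
  apply: filterS (exponential_law_gt0 lawZ) => w Z0.
  by exists (Num.truncn (Z w)); rewrite /B /= in_itv /= truncn_itv ?ltW.
have [cRe cIm] := expectationC_partition mB tB covB fi.
have iB k := integrableC_indicM fi (mB k).
have sumB n w : \sum_(k < n) \1_(B k) w = \1_(`[0, n%:R[%classic) (Z w) :> R.
  have itvE (a b : R) : (Z w \in (`[a, b[%classic : set R)) = (a <= Z w < b).
    by apply/idP/idP => [|h]; [rewrite inE /= in_itv|rewrite inE /= in_itv].
  have itv1 b : \1_(`[0, b[%classic) (Z w) = (0 <= Z w < b)%R%:R :> R.
    by rewrite indicE itvE.
  elim: n => [|n IH].
    by rewrite big_ord0 indicE itvE; case: leP.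
  rewrite big_ord_recr /= IH !itv1.
  have -> : \1_(B n) w = (n%:R <= Z w < n.+1%:R)%R%:R :> R.
    by rewrite indicE -itvE; congr (_%:R); apply/idP/idP; rewrite !inE.
  have [n0|n0] := ltP (Z w) n%:R; rewrite ?andbT ?andbF /=.
    by rewrite addr0 (lt_trans n0) ?ltr_nat// andbT.
  by rewrite add0r (le_trans _ n0).
have sumE n : \sum_(k < n.+1) expectationC P (fun w => f (Z w) * (\1_(B k) w)%:C) =
    F n.+1%:R - F 0.
  have [_ <-] := expectationC_exponential_itv lawZ (ltr0Sn R n) df dF.
  rewrite -(big_mkord xpredT (fun k => expectationC P (fun w => f (Z w) * (\1_(B k) w)%:C))).
  rewrite -expectationC_sum//; congr expectationC; apply/funext => w.
  by rewrite big_mkord -mulr_sumr -rmorph_sum /= sumB.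
have lim (g : R[i] -> R) : (forall x, `|g x| <= absC x) ->
    {morph g : x y / x + y} ->
    g (\sum_(k < n) expectationC P (fun w => f (Z w) * (\1_(B k) w)%:C)) @[n --> \oo]
    --> g (expectationC P (fun w => f (Z w))) ->
    g (expectationC P (fun w => f (Z w))) = g (- F 0).
  move=> gle gD; rewrite -cvg_shiftS => cg.
  have c2 : g (F n.+1%:R - F 0) @[n --> \oo] --> 0 + g (- F 0).
    under eq_fun do rewrite gD.
    apply: cvgD; last exact: cvg_cst.
    apply/norm_cvg0P; have cF : absC (F n.+1%:R) @[n --> \oo] --> (0 : R).
      by have := F0; rewrite -cvg_shiftS.
    apply: squeeze_cvgr cF; last exact: cvg_cst.
    by apply: nearW => n; rewrite normr_ge0 /=.
  have c1 : g (F n.+1%:R - F 0) @[n --> \oo] --> g (expectationC P (fun w => f (Z w))).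
    apply: cvg_trans cg; apply: near_eq_cvg; apply: nearW => n /=.
    by rewrite -sumE.
  by have := cvg_unique _ c1 c2; rewrite add0r; apply.
apply: complex_ext.
  exact: (lim (fun x => Re x) (@Re_le_absC R) (@complexReD R)).
exact: (lim (fun x => Im x) (@Im_le_absC R) (@complexImD R)).
Qed.

End exponential_expectations.

Section truncated_exponential_series.
Context {R : realType}.
Implicit Types (u k : R[i]) (x : R).

(** Taylor polynomial of the exponential with [r] terms. *)
Definition exp_poly u r : R[i] := \sum_(j < r) u ^+ j / (j`!)%:R.

Lemma exp_poly0 r : exp_poly 0 r.+1 = 1.
Proof.
rewrite /exp_poly big_ord_recl expr0 fact0 divr1 big1 ?addr0// => j _.
by rewrite expr0n mul0r.
Qed.

Lemma is_deriveC_linear k x : is_deriveC (fun y => k * y%:C) x k.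
Proof.
by apply: is_deriveC_eq (is_deriveCZ k (is_deriveC_real x)) _; rewrite mulr1.
Qed.

Lemma is_deriveC_exp_linear k x :
  is_deriveC (fun y => expC (k * y%:C)) x (expC (k * x%:C) * k).
Proof. exact: is_deriveC_expC (is_deriveC_linear k x). Qed.

Let fact_unit j : (j.+1%:R * (j`!)%:R : R[i]) = (j.+1`!)%:R.
Proof. by rewrite factS natrM. Qed.

Let fact_neq0 j : (j`!)%:R != 0 :> R[i].
Proof. by rewrite pnatr_eq0 -lt0n fact_gt0. Qed.

Lemma is_deriveC_monomial (F : R -> R[i]) k x j : is_deriveC F x k ->
  is_deriveC (fun y => F y ^+ j.+1 / (j.+1`!)%:R) x (F x ^+ j / (j`!)%:R * k).
Proof.
move=> dF; apply: (@is_deriveC_eq _ (fun y => F y ^+ j.+1 / (j.+1`!)%:R)).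
  have := is_deriveCZ (j.+1`!)%:R^-1 (is_deriveCX j dF).
  by under eq_fun do rewrite mulrC; apply.
by rewrite -fact_unit; field; rewrite fact_neq0 nat1r pnatr_eq0.
Qed.

(** Differentiating the product telescopes to its last term. *)
Lemma is_deriveC_exp_poly k x r :
  is_deriveC (fun y => exp_poly (k * y%:C) r.+1 * expC (- k * y%:C)) x
    (- (k * (k * x%:C) ^+ r / (r`!)%:R * expC (- k * x%:C))).
Proof.
elim: r => [|r IH].
  under eq_fun do rewrite /exp_poly big_ord_recl big_ord0 expr0 fact0 addr0 divr1 mul1r.
  by apply: is_deriveC_eq (is_deriveC_exp_linear (- k) x) _; rewrite expr0 fact0; field.
have E y : exp_poly (k * y%:C) r.+2 * expC (- k * y%:C) =
    exp_poly (k * y%:C) r.+1 * expC (- k * y%:C) +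
    (k * y%:C) ^+ r.+1 / (r.+1`!)%:R * expC (- k * y%:C).
  by rewrite /exp_poly big_ord_recr /= mulrDl.
under eq_fun do rewrite E.
apply: is_deriveC_eq (is_deriveCD IH (is_deriveCM
  (is_deriveC_monomial r (is_deriveC_linear k x))
  (is_deriveC_exp_linear (- k) x))) _.
ring.
Qed.

(** By its power series, [expR (Re k * n)] exceeds every power of [n], so that
    each monomial contributes at most a multiple of [1 / n]. *)
Lemma exp_poly_decay k r : 0 < Re k ->
  absC (exp_poly (k * n%:R) r * expC (- k * n%:R)) @[n --> \oo] --> (0 : R).
Proof.
move=> k0.
have term j : exists K : R, forall n,
    absC ((k * n%:R) ^+ j / (j`!)%:R * expC (- k * n%:R)) <= K * harmonic n.
  exists (absC k ^+ j * (expR (Re k) * (j.+1`!)%:R / Re k ^+ j.+1)) => n.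
  have n0 : 0 < n.+1%:R :> R by [].
  have c0 : 0 < Re k * n.+1%:R by rewrite mulr_gt0.
  have e1 : (Re k * n.+1%:R) ^+ j.+1 / (j.+1)`!%:R <= expR (Re k * n.+1%:R).
    by apply: le_trans (expR_ge1Dxn j (ltW c0)); rewrite lerDr.
  have e2 : expR (- (Re k * n%:R)) <=
      expR (Re k) * ((j.+1)`!%:R / (Re k * n.+1%:R) ^+ j.+1).
    have -> : - (Re k * n%:R) = Re k - Re k * n.+1%:R by rewrite -natr1; ring.
    rewrite expRD ler_wpM2l ?expR_ge0// expRN -invf_div lef_pV2//.
      by rewrite posrE expR_gt0.
    by rewrite posrE divr_gt0 ?exprn_gt0// ltr0n fact_gt0.
  rewrite !absCM absCV absCX absCM absC_expC.
  have -> : Re (- k * n%:R) = - (Re k * n%:R).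
    by rewrite -(rmorph_nat (real_complex R)) complexReM complexReN /= mulr0 subr0 mulNr.
  have nE m : absC (m%:R : R[i]) = m%:R.
    by rewrite -(rmorph_nat (real_complex R)) absC_real ger0_norm.
  rewrite !nE exprMn -!mulrA ler_wpM2l ?exprn_ge0 ?absC_ge0//.
  apply: (@le_trans _ _ (n.+1%:R ^+ j *
      (expR (Re k) * ((j.+1)`!%:R / (Re k * n.+1%:R) ^+ j.+1)))).
    apply: ler_pM => //.
    - by rewrite lerXn2r ?nnegrE// ler_nat.
    - apply: le_trans e2; rewrite ler_piMl ?expR_ge0// invf_le1 ?ltr0n ?fact_gt0//.
      by rewrite ler1n fact_gt0.
  rewrite /harmonic /= exprMn (exprS n.+1%:R) le_eqVlt; apply/orP; left; apply/eqP.
  by field; rewrite !gt_eqF ?exprn_gt0.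
have [K HK] : exists K : R, forall n,
    absC (exp_poly (k * n%:R) r * expC (- k * n%:R)) <= K * harmonic n.
  elim: r => [|r [K IH]].
    by exists 0 => n; rewrite /exp_poly big_ord0 !mul0r absC0.
  have [K' HK'] := term r; exists (K + K') => n.
  rewrite /exp_poly big_ord_recr /= mulrDl (le_trans (absCD _ _))// mulrDl.
  by rewrite lerD ?HK'//; exact: IH.
have Kh : K * harmonic n @[n --> \oo] --> (0 : R).
  by rewrite -[0](mulr0 K); apply: cvgMr; exact: cvg_harmonic.
apply: squeeze_cvgr Kh; last exact: cvg_cst.
by apply: nearW => n; rewrite HK absC_ge0.
Qed.

End truncated_exponential_series.

Section integrable_bounded.
Context {d : measure_display} {T : measurableType d} {R : realType}.
Variable P : probability T R.

Lemma integrableC_bounded (f : T -> R[i]) (m : R) : cmeasurable f ->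
  {ae P, forall w, absC (f w) <= m} -> integrableC P f.
Proof.
move=> mf fm; apply/integrableC_absP; split => //.
apply: (@le_lt_trans _ _ (\int[P]_w (Num.max 0 m)%:E)%E); last first.
  have /integrableP[_] := @finite_measure_integrable_cst _ _ _ P setT (Num.max 0 m) measurableT.
  apply: le_lt_trans; apply: ge0_le_integral => //=.
  - by move=> w _; rewrite lee_fin le_max lexx.
  - by move=> w _; rewrite lee_fin ler_norm.
apply: ae_ge0_le_integral => //.
- by move=> w _; rewrite lee_fin absC_ge0.
- by apply/measurable_EFinP; exact: measurableC_absC.
- by move=> w _; rewrite lee_fin le_max lexx.
- by apply: filterS fm => w + _; rewrite lee_fin le_max => ->; rewrite orbT.
Qed.

End integrable_bounded.

Section exponential_transforms.
Context {d : measure_display} {T : measurableType d} {R : realType}.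
Variables (P : probability T R) (Z : {RV P >-> R}) (rate : R).
Hypothesis rate_gt0 : 0 < rate.
Hypothesis lawZ : forall A : set R, measurable A ->
  distribution P Z A = exponential_prob rate A.

Let mZ (f : R -> R[i]) : (forall x, exists l, is_deriveC f x l) ->
  cmeasurable (fun w => f (Z w)).
Proof.
move=> df; apply: (measurableC_comp (h := Z) (@measurable_funP _ _ _ _ setT Z)).
by split; apply: continuous_measurable_fun => x;
  have [l /is_deriveC_continuous[]] := df x.
Qed.

Lemma poisson_term_le1 (x : R) l : 0 <= x -> x ^+ l / (l`!)%:R * expR (- x) <= 1.
Proof.
move=> x0; rewrite expRN ler_pdivrMr ?expR_gt0// mul1r.
case: l => [|l]; first by rewrite expr0 fact0 divr1 -expR0 ler_expR.
by apply: le_trans (expR_ge1Dxn l x0); rewrite lerDr.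
Qed.

(** The Laplace transform of an exponential time on the event that [l] points of
    an independent Poisson process of rate [lam] precede it: up to a constant, a
    primitive is [exp_poly] times an exponential, which vanishes at infinity. *)
Lemma expectationC_exponential_poisson (lam : R) (theta : R[i]) (l : nat) :
  0 < lam -> 0 <= Re theta ->
  integrableC P (fun w => expC (- theta * (Z w)%:C)
                          * (poisson_pmf (lam * Z w) l)%:C) /\
  expectationC P (fun w => expC (- theta * (Z w)%:C)
                           * (poisson_pmf (lam * Z w) l)%:C) =
  rate%:C * lam%:C ^+ l / (lam%:C + theta + rate%:C) ^+ l.+1.
Proof.
move=> lam0 th0.
pose f (x : R) : R[i] := expC (- (lam%:C + theta) * x%:C) * ((lam%:C * x%:C) ^+ l / (l`!)%:R).
pose k : R[i] := lam%:C + theta + rate%:C.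
have k0 : 0 < Re k by rewrite /k !complexReD addr_gt0// ltr_wpDr.
have kneq0 := Re_gt0_neq0 k0.
have mono x : exists j, is_deriveC (fun y : R => (lam%:C * y%:C) ^+ l / (l`!)%:R) x j.
  case: (l) => [|n].
    by exists 0; under eq_fun do rewrite expr0; exact: is_deriveC_cst.
  by eexists; apply: is_deriveC_monomial; exact: is_deriveC_linear.
have df x : exists j, is_deriveC f x j.
  have [j dj] := mono x.
  by eexists; apply: is_deriveCM dj; exact: is_deriveC_exp_linear.
have ae0 := exponential_law_gt0 lawZ.
have fE (x : R) : 0 < x ->
    f x = expC (- theta * x%:C) * (poisson_pmf (lam * x) l)%:C.
  move=> x0; rewrite /f /poisson_pmf mulr_gt0// !rmorphM /= rmorphXn /= rmorphM /=.
  rewrite fmorphV rmorph_nat -expC_real rmorphN rmorphM /=.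
  have -> : - (lam%:C + theta) * x%:C = - theta * x%:C + - (lam%:C * x%:C) by ring.
  by rewrite expCD; ring.
have mf := mZ df.
have fi : integrableC P (fun w => f (Z w)).
  apply: (@integrableC_bounded _ _ _ _ _ 1) => //.
  apply: filterS ae0 => w Z0; rewrite fE// absCM absC_expC absC_real /poisson_pmf.
  rewrite mulr_gt0// complexReM complexReN /= mulr0 subr0 ger0_norm; last first.
    by rewrite !mulr_ge0 ?expR_ge0 ?exprn_ge0 ?mulr_ge0 ?ltW// invr_ge0.
  rewrite mulr_ile1 ?expR_ge0//.
  - by rewrite !mulr_ge0 ?expR_ge0 ?exprn_ge0 ?mulr_ge0 ?ltW// invr_ge0.
  - by rewrite -expR0 ler_expR mulNr oppr_le0 mulr_ge0// ltW.
  - by rewrite poisson_term_le1// mulr_ge0 ?ltW.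
pose c := rate%:C * lam%:C ^+ l / k ^+ l.+1.
pose F (x : R) : R[i] := - c * (exp_poly (k * x%:C) l.+1 * expC (- k * x%:C)).
have dF x : is_deriveC F x (f x * (rate * expR (- rate * x))%:C).
  apply: is_deriveC_eq (is_deriveCZ (- c) (is_deriveC_exp_poly k x l)) _.
  rewrite /f /c rmorphM /= -expC_real rmorphM rmorphN /=.
  have -> : - k * x%:C = - (lam%:C + theta) * x%:C + - rate%:C * x%:C.
    by rewrite /k; ring.
  rewrite expCD !exprMn exprS; field.
  by rewrite kneq0 expf_neq0// pnatr_eq0 -lt0n fact_gt0.
have E : expectationC P (fun w => f (Z w)) = c.
  rewrite (expectationC_exponential lawZ df dF fi).
    by rewrite /F !rmorph0 !mulr0 exp_poly0 expC0 !mulr1 opprK.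
  have : absC (- c) * absC (exp_poly (k * n%:R) l.+1 * expC (- k * n%:R)) @[n --> \oo]
      --> absC (- c) * (0 : R) by apply: cvgMr; exact: exp_poly_decay.
  rewrite mulr0; apply: cvg_trans; apply: near_eq_cvg; apply: nearW => n.
  by rewrite /F -absCM rmorph_nat.
have mp : cmeasurable (fun w => expC (- theta * (Z w)%:C) * (poisson_pmf (lam * Z w) l)%:C).
  apply: measurableCM.
    by apply: (mZ (f := fun x => expC (- theta * x%:C))) => x;
      eexists; exact: is_deriveC_exp_linear.
  apply: measurableC_real; apply: (measurableT_comp (f := fun r => poisson_pmf r l)).
    exact: measurable_poisson_pmf.
  by apply: measurable_funM => //; exact: measurable_cst.
have aeE : {ae P, forall w, f (Z w) =
    expC (- theta * (Z w)%:C) * (poisson_pmf (lam * Z w) l)%:C}.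
  by apply: filterS ae0 => w; exact: fE.
split; first exact: (integrableC_ae mp fi aeE).
by rewrite -(expectationC_ae mf mp aeE).
Qed.

(** Closed form of the integral of [xi^r x^(r-1)/(r-1)! e^(-ux)] over [0, V]:
    the transform of a Gamma variable restricted to [0, V[. *)
Definition gamma_transform (xi : R) (u : R[i]) (V : R) (r : nat) : R[i] :=
  (xi%:C / u) ^+ r * (1 - expC (- u * V%:C) * exp_poly (u * V%:C) r).

(** Adding one exponential variable to a Gamma variable below the threshold [V]
    leaves room [V - Z] for the latter. *)
Lemma gamma_transform_step (v : R[i]) (V : R) (r : nat) :
  0 <= Re v -> 0 < V ->
  integrableC P (fun w => expC (- v * (Z w)%:C)
    * gamma_transform rate (rate%:C + v) (V - Z w) r * (\1_(`[0, V[%classic) (Z w))%:C) /\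
  expectationC P (fun w => expC (- v * (Z w)%:C)
    * gamma_transform rate (rate%:C + v) (V - Z w) r * (\1_(`[0, V[%classic) (Z w))%:C) =
  gamma_transform rate (rate%:C + v) V r.+1.
Proof.
move=> v0 V0; set u := rate%:C + v.
have u0 : 0 < Re u by rewrite /u complexReD ltr_wpDr.
have uneq0 := Re_gt0_neq0 u0.
pose f (x : R) : R[i] := expC (- v * x%:C) * gamma_transform rate u (V - x) r.
pose q := rate%:C / u.
pose G (x : R) : R[i] := \sum_(j < r) (u * (V - x)%:C) ^+ j.+1 / (j.+1`!)%:R.
pose F (x : R) : R[i] :=
  q ^+ r.+1 * (- expC (- u * x%:C) + expC (- u * V%:C) * G x).
have dlin x : is_deriveC (fun y : R => u * (V - y)%:C) x (- u).
  have := is_deriveCD (is_deriveC_cst (u * V%:C) x) (is_deriveC_linear (- u) x).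
  by under eq_fun do rewrite mulNr -mulrBr -rmorphB; rewrite add0r.
have dpoly x : exists j, is_deriveC (fun y : R => exp_poly (u * (V - y)%:C) r) x j.
  rewrite /exp_poly.
  have dj (n : nat) : exists j, is_deriveC
      (fun y : R => (u * (V - y)%:C) ^+ n / (n`!)%:R) x j.
    case: n => [|n].
      by exists 0; under eq_fun do rewrite expr0; exact: is_deriveC_cst.
    by eexists; apply: is_deriveC_monomial; exact: dlin.
  have [l dl] := choice dj.
  by eexists; exact: (@is_deriveC_sum _ r (fun n (y : R) => (u * (V - y)%:C) ^+ n / (n`!)%:R)).
have df x : exists l, is_deriveC f x l.
  have [j dj] := dpoly x.
  eexists; apply: is_deriveCM; first exact: is_deriveC_exp_linear.
  apply: is_deriveCZ; apply: is_deriveCD; first exact: is_deriveC_cst.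
  have -> : (fun y : R => - (expC (- u * (V - y)%:C) * exp_poly (u * (V - y)%:C) r)) =
            (fun y : R => (- 1) * (expC (- u * (V - y)%:C) * exp_poly (u * (V - y)%:C) r)).
    by apply/funext => y; rewrite mulN1r.
  apply: is_deriveCZ; apply: is_deriveCM dj; apply: is_deriveC_expC.
  have := is_deriveCZ (- 1) (dlin x).
  by under eq_fun do rewrite mulN1r -mulNr; apply.
have dG x : is_deriveC G x (- u * exp_poly (u * (V - x)%:C) r).
  have := @is_deriveC_sum _ r (fun n (y : R) => (u * (V - y)%:C) ^+ n.+1 / (n.+1`!)%:R)
    _ _ (fun n => is_deriveC_monomial n (dlin x)).
  move/is_deriveC_eq; apply.
  by rewrite /exp_poly mulr_sumr; apply: eq_bigr => j _; ring.
have dF x : is_deriveC F x (f x * (rate * expR (- rate * x))%:C).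
  have dE : is_deriveC (fun y : R => - expC (- u * y%:C)) x (u * expC (- u * x%:C)).
    have := is_deriveCZ (- 1) (is_deriveC_exp_linear (- u) x).
    under eq_fun do rewrite mulN1r.
    by move/is_deriveC_eq; apply; ring.
  apply: is_deriveC_eq (is_deriveCZ (q ^+ r.+1)
    (is_deriveCD dE (is_deriveCZ (expC (- u * V%:C)) (dG x)))) _.
  rewrite /f /gamma_transform rmorphM /= -expC_real rmorphM rmorphN /= -/q.
  have E1 : expC (- u * x%:C) = expC (- v * x%:C) * expC (- rate%:C * x%:C).
    by rewrite -expCD; congr expC; rewrite /u; ring.
  have E2 : expC (- u * V%:C) = expC (- u * (V - x)%:C) * expC (- u * x%:C).
    by rewrite -expCD; congr expC; rewrite rmorphB /=; ring.
  rewrite E2 E1 exprS.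
  have -> : rate%:C = q * u by rewrite /q divfK.
  ring.
have [fi ->] := expectationC_exponential_itv lawZ V0 df dF.
split => //.
have GV : G V = 0.
  by rewrite /G big1// => j _; rewrite subrr rmorph0 mulr0 expr0n mul0r.
have G0 : G 0 = exp_poly (u * V%:C) r.+1 - 1.
  rewrite /G /exp_poly big_ord_recl /= expr0 fact0 divr1 subr0 addrC addKr.
  by apply: eq_bigr => j _.
by rewrite /F /gamma_transform -/q GV G0 rmorph0 !mulr0 expC0; ring.
Qed.

End exponential_transforms.

(** * Sums of independent exponential variables below a threshold *)

Section frozen_measurability.
Context {d : measure_display} {T : measurableType d} {R : realType}.
Variables G H : set_system T.
Local Notation TG := (g_sigma_algebraType G).
Local Notation TH := (g_sigma_algebraType H).

Lemma measurable_wrt_fst d' (T' : measurableType d') (g : T -> T') :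
  measurable_wrt G g ->
  measurable_fun setT (fun z : TG * TH => g z.1).
Proof. by move=> mg; exact: (measurableT_comp mg measurable_fst). Qed.

Lemma measurable_wrt_snd d' (T' : measurableType d') (g : T -> T') :
  measurable_wrt H g ->
  measurable_fun setT (fun z : TG * TH => g z.2).
Proof. by move=> mg; exact: (measurableT_comp mg measurable_snd). Qed.

Lemma measurableC_wrt_fst (g : T -> R[i]) : measurableC_wrt G g ->
  cmeasurable (fun z : TG * TH => g z.1).
Proof.
by move=> [g1 g2]; split;
  [exact: (measurable_wrt_fst g1)|exact: (measurable_wrt_fst g2)].
Qed.

Lemma measurableC_wrt_snd (g : T -> R[i]) : measurableC_wrt H g ->
  cmeasurable (fun z : TG * TH => g z.2).
Proof.
by move=> [g1 g2]; split;
  [exact: (measurable_wrt_snd g1)|exact: (measurable_wrt_snd g2)].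
Qed.

End frozen_measurability.

Section bool_indicators.
Context {d : measure_display} {T : measurableType d} {R : realType}.

Lemma measurableC_bool (b : T -> bool) :
  measurable_fun setT b -> cmeasurable (fun w => (b w)%:R : R[i]).
Proof.
move=> mb; split.
  have -> : (fun w => Re ((b w)%:R : R[i])) = (fun w => if b w then 1 else 0 : R).
    by apply/funext => w; case: (b w).
  by apply: measurable_fun_ifT => //; exact: measurable_cst.
have -> : (fun w => Im ((b w)%:R : R[i])) = (fun=> 0 : R).
  by apply/funext => w; case: (b w).
exact: measurable_cst.
Qed.

Lemma measurableC_indicator (b : T -> bool) : measurable [set w | b w] ->
  cmeasurable (fun w => (b w)%:R : R[i]).
Proof.
move=> mb; rewrite (_ : (fun w => _) = fun w => (\1_[set w | b w] w)%:C).
  exact: measurableC_indic.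
apply/funext => w; rewrite indicE; case: (boolP (b w)) => bw.
  by rewrite mem_set.
by rewrite memNset//; exact/negP.
Qed.

Lemma absC_bool (b : bool) : absC (b%:R : R[i]) = b%:R.
Proof. by case: b; rewrite ?absC1 ?absC0. Qed.

Lemma ae_seq (P : probability T R) (I : eqType) (s : seq I) (Q : I -> T -> Prop) :
  (forall i, {ae P, forall w, Q i w}) ->
  {ae P, forall w, forall i, i \in s -> Q i w}.
Proof.
move=> aeQ; elim: s => [|i s IH]; first by apply: aeW.
apply: filterS2 (aeQ i) IH => w Qi Qs j; rewrite inE => /orP[/eqP -> //|].
exact: Qs.
Qed.

End bool_indicators.

Section exponential_family.
Context {d : measure_display} {T : measurableType d} {R : realType}.
Variables (P : probability T R).
Context {I : choiceType}.
Variables (X : I -> {RV P >-> R}) (xi : R).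
Hypothesis xi_gt0 : 0 < xi.
Hypothesis lawX : forall i (A : set R), measurable A ->
  distribution P (X i) A = exponential_prob xi A.
Hypothesis iX : independent_RVs P X.

Let mX i : measurable_fun setT (X i).
Proof. exact: measurable_funP. Qed.

Let block_sum J (s : seq I) : (forall i, i \in s -> J i) ->
  measurable_wrt (RV_block X J) (fun w => \sum_(i <- s) X i w).
Proof.
elim: s => [|i s IH] sJ.
  rewrite (_ : (fun w => _) = fun=> 0); first exact: measurable_cst.
  by apply/funext => w; rewrite big_nil.
rewrite (_ : (fun w => _) = fun w => X i w + \sum_(j <- s) X j w); last first.
  by apply/funext => w; rewrite big_cons.
apply: measurable_funD.
  by apply: measurable_wrt_RV_block; apply: sJ; exact: mem_head.
by apply: IH => j js; apply: sJ; rewrite inE js orbT.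
Qed.

Let block_prod J (s : seq I) (g : R -> R[i]) : cmeasurable g ->
  (forall i, i \in s -> J i) ->
  measurableC_wrt (RV_block X J) (fun w => \prod_(i <- s) g (X i w)).
Proof.
move=> mg; elim: s => [|i s IH] sJ.
  rewrite (_ : (fun w => _) = fun=> 1); first exact: measurableC_cst.
  by apply/funext => w; rewrite big_nil.
rewrite (_ : (fun w => _) = fun w => g (X i w) * \prod_(j <- s) g (X j w)); last first.
  by apply/funext => w; rewrite big_cons.
apply: measurableCM.
  apply: (measurableC_comp _ mg).
  by apply: measurable_wrt_RV_block; apply: sJ; exact: mem_head.
by apply: IH => j js; apply: sJ; rewrite inE js orbT.
Qed.

Let mexp (v : R[i]) : cmeasurable (fun x : R => expC (- v * x%:C)).
Proof.
apply: measurableC_exp; apply: measurableCM; first exact: measurableC_cst.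
by apply: measurableC_real.
Qed.

Lemma measurableC_truncated_weights J (s : seq I) (v : R[i]) (V : R) :
  (forall i, i \in s -> J i) ->
  measurableC_wrt (RV_block X J)
    (fun w => \prod_(i <- s) expC (- v * (X i w)%:C) * (\sum_(i <- s) X i w < V)%R%:R).
Proof.
move=> sJ; apply: measurableCM; first exact: block_prod (mexp v) sJ.
apply: measurableC_bool; apply: measurable_fun_ltr; last exact: measurable_cst.
exact: block_sum.
Qed.

Let positive (s : seq I) : {ae P, forall w, forall i, i \in s -> 0 < X i w}.
Proof. by apply: ae_seq => i; exact: (exponential_law_gt0 (lawX i)). Qed.

Let prod_le1 (s : seq I) (v : R[i]) w : 0 <= Re v ->
  (forall i, i \in s -> 0 < X i w) ->
  absC (\prod_(i <- s) expC (- v * (X i w)%:C)) <= 1.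
Proof.
move=> v0 X0; rewrite absC_prod big_seq; apply: prodr_ile1 => i /X0 Xi.
rewrite absC_ge0 /= absC_expC complexReM complexReN /= mulr0 subr0.
by rewrite -expR0 ler_expR mulNr oppr_le0 mulr_ge0// ltW.
Qed.

(** The sum of the [size s] weights has a Gamma law; one weight is added at a
    time, the others being frozen. *)
Lemma expectationC_truncated_weights (s : seq I) (v : R[i]) (V : R) :
  uniq s -> 0 <= Re v -> 0 < V ->
  integrableC P (fun w => \prod_(i <- s) expC (- v * (X i w)%:C)
                          * (\sum_(i <- s) X i w < V)%R%:R) /\
  expectationC P (fun w => \prod_(i <- s) expC (- v * (X i w)%:C)
                           * (\sum_(i <- s) X i w < V)%R%:R) =
  gamma_transform xi (xi%:C + v) V (size s).
Proof.
move=> us v0; elim: s V us => [|i s IH] V us V0.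
  under eq_fun do rewrite !big_nil V0 mulr1; split; first exact: integrableC_cst.
  by rewrite expectationC_cst /gamma_transform /exp_poly big_ord0 mulr0 subr0 expr0 mul1r.
have /andP[is_ us'] := us.
pose h (w : T) : R[i] := expC (- v * (X i w)%:C)
  * gamma_transform xi (xi%:C + v) (V - X i w) (size s) * (\1_(`[0, V[%classic) (X i w))%:C.
have [hi hE] := gamma_transform_step xi_gt0 (lawX i) (size s) v0 V0.
pose f (w w' : T) : R[i] := expC (- v * (X i w)%:C)
  * (\prod_(j <- s) expC (- v * (X j w')%:C) * (\sum_(j <- s) X j w' < V - X i w)%R%:R).
have fE w : \prod_(j <- i :: s) expC (- v * (X j w)%:C)
    * (\sum_(j <- i :: s) X j w < V)%R%:R = f w w.
  by rewrite !big_cons /f ltrBrDl [RHS]mulrA.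
under eq_fun do rewrite fE.
rewrite /= -hE.
apply: (@freezing_systems _ _ _ P (RV_block X [set i]) (RV_block X [set` s]) f h (fun=> 1%E)).
- exact: RV_block_measurable.
- exact: RV_block_measurable.
- apply: indep_RV_blocks => //; apply/seteqP; split => // j [/= -> js].
  by rewrite js in is_.
- have mi : measurable_wrt (RV_block X [set i]) (X i) by exact: measurable_wrt_RV_block.
  apply: measurableCM.
    by apply: (measurableC_wrt_fst _ (g := fun w => expC (- v * (X i w)%:C)));
      exact: measurableC_comp mi (mexp v).
  apply: measurableCM.
    by apply: (measurableC_wrt_snd _ (g := fun w => \prod_(j <- s) expC (- v * (X j w)%:C)));
      exact: block_prod (mexp v) _.
  apply: measurableC_bool; apply: measurable_fun_ltr.
    by apply: (measurable_wrt_snd _ (g := fun w => \sum_(j <- s) X j w)); exact: block_sum.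
  apply: measurable_funB; first exact: measurable_cst.
  exact: measurable_wrt_fst.
- exact: integrableC_measurable hi.
- exact: measurable_cst.
- by [].
- by rewrite integral_cst// mul1e (le_lt_trans (probability_le1 _ _))// ltry.
- apply: filterS (exponential_law_gt0 (lawX i)) => w Xi0.
  rewrite -[leRHS](_ : \int[P]_w' 1 = 1)%E; last first.
    by rewrite integral_cst// mul1e; exact: probability_setT.
  have mfw : cmeasurable (f w).
    apply: measurableCM; first exact: measurableC_cst.
    apply: measurableC_wrtW (measurableC_truncated_weights (J := [set` s]) v _ _) => //.
    exact: RV_block_measurable.
  apply: ae_ge0_le_integral => //.
  + by move=> w' _; rewrite lee_fin absC_ge0.
  + by apply/measurable_EFinP; exact: measurableC_absC.
  + apply: filterS (positive s) => w' Xs _; rewrite lee_fin /f !absCM absC_bool.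
    have := prod_le1 v0 Xs; have : absC (expC (- v * (X i w)%:C)) <= 1.
      have := @prod_le1 [:: i] v w v0; rewrite big_seq1; apply => j.
      by rewrite inE => /eqP ->.
    move=> e1 e2; rewrite mulr_ile1 ?absC_ge0 ?mulr_ge0 ?absC_ge0//.
    by rewrite mulr_ile1 ?absC_ge0//; case: (_ < _).
- apply: filterS (exponential_law_gt0 (lawX i)) => w Xi0.
  rewrite /f /h.
  have [XV|XV] := ltP (X i w) V.
    have [si sE] := IH (V - X i w) us' (ltac:(by rewrite subr_gt0)).
    rewrite expectationCZ// sE indicE mem_set ?mulr1//.
    by rewrite /= in_itv /= XV ltW.
  rewrite indicE memNset ?mulr0; last by rewrite /= in_itv /= ltNge XV andbF.
  rewrite -[RHS](expectationC_cst P); apply: expectationC_ae.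
  + apply: measurableCM; first exact: measurableC_cst.
    apply: measurableC_wrtW (measurableC_truncated_weights (J := [set` s]) v _ _) => //.
    exact: RV_block_measurable.
  + exact: measurableC_cst.
  + apply: filterS (positive s) => w' Xs.
    have -> : (\sum_(j <- s) X j w' < V - X i w) = false; last by rewrite !mulr0.
    apply/negbTE; rewrite -leNgt.
    apply: (@le_trans _ _ 0); first by rewrite subr_le0.
    by rewrite big_seq sumr_ge0// => j /Xs /ltW.
Qed.

End exponential_family.

(** * Marks of the attacks *)

Section families.
Context {d : measure_display} {T : measurableType d} {R : realType}.
Context {P : probability T R} {n : nat} {lambda mu xi a : R}.
Variable S : network_attack P n lambda mu xi a.

Let family : 'I_5 -> set_system T := tnth [tuple
    sigma_gen (attack_time S);
    sigma_gen (nodes S);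
    sigma_gen (fun kj : nat * nat => weight S kj.1 kj.2);
    sigma_gen (fun kj : nat * nat => passive S kj.1 kj.2);
    sigma_gen (delay S)].

Let sigma_gen_measurable d' (T' : measurableType d') (I : Type)
    (X : I -> {mfun T >-> T'}) : sigma_gen X `<=` measurable.
Proof.
apply: g_sigma_measurable => _ [i _ [A mA <-]].
exact: (@measurable_funP _ _ _ _ setT (X i)).
Qed.

Let sigma_gen_setI d' (T' : measurableType d') (I : Type)
    (X : I -> {mfun T >-> T'}) : setI_closed (sigma_gen X).
Proof.
by move=> A B XA XB; apply: (@measurableI _ (g_sigma_algebraType
  (\bigcup_i preimage_set_system setT (X i) measurable))).
Qed.

Let family_measurable i : family i `<=` measurable.
Proof.
by case: i => [[|[|[|[|[|]]]]] ?] //; rewrite /family (tnth_nth setT) /=;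
  exact: sigma_gen_measurable.
Qed.

Let family_setI i : setI_closed (family i).
Proof.
by case: i => [[|[|[|[|[|]]]]] ?] //; rewrite /family (tnth_nth setT) /=;
  exact: sigma_gen_setI.
Qed.

(** Events determined by the families with number in [s]: attack times (0),
    numbers of nodes (1), weights (2), passive changes (3) and delays (4). *)
Definition families (s : seq nat) : set_system T :=
  block family [set i | val i \in s].

Lemma families_measurable s : families s `<=` measurable.
Proof. by move=> A [i _ iA]; exact: family_measurable iA. Qed.

Lemma indep_families s1 s2 : (forall x, x \in s1 -> x \notin s2) ->
  indep_systems P (families s1) (families s2).
Proof.
move=> s12; apply: indep_blocks => //.
- exact: families_independent.
- apply/seteqP; split => // i [/= i1 i2].
  by have /negP := s12 _ i1.
Qed.

Let measurable_family s d' (T' : measurableType d') (I : Type)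
    (X : I -> T -> T') (f : 'I_5) i :
  family f = sigma_gen X -> val f \in s -> measurable_wrt (families s) (X i).
Proof.
move=> fX fs; apply: measurable_wrt_preimage => A XA; exists f => //.
by rewrite fX; apply: sub_sigma_algebra; exists i.
Qed.

Lemma measurable_attack_time s k : 0%N \in s ->
  measurable_wrt (families s) (attack_time S k).
Proof.
exact: (@measurable_family s _ _ _ (attack_time S) (@Ordinal 5 0 isT) k erefl).
Qed.

Lemma measurable_nodes s k : 1%N \in s ->
  measurable_wrt (families s) (nodes S k).
Proof.
exact: (@measurable_family s _ _ _ (nodes S) (@Ordinal 5 1 isT) k erefl).
Qed.

Lemma measurable_weight s k : 2%N \in s ->
  measurable_wrt (families s) (weight S k.1 k.2).
Proof.
exact: (@measurable_family s _ _ _ (fun kj : nat * nat => weight S kj.1 kj.2)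
  (@Ordinal 5 2 isT) k erefl).
Qed.

Lemma measurable_passive s k : 3%N \in s ->
  measurable_wrt (families s) (passive S k.1 k.2).
Proof.
exact: (@measurable_family s _ _ _ (fun kj : nat * nat => passive S kj.1 kj.2)
  (@Ordinal 5 3 isT) k erefl).
Qed.

Lemma measurable_delay s k : 4%N \in s ->
  measurable_wrt (families s) (delay S k).
Proof.
exact: (@measurable_family s _ _ _ (delay S) (@Ordinal 5 4 isT) k erefl).
Qed.

End families.

Section slots.
Implicit Types (nu : nat -> nat).

(** Nodes lost in the attacks [i], ..., [j - 1] when attack [l] takes [nu l]. *)
Definition slots (i j : nat) nu : seq (nat * nat) :=
  [seq (l, x) | l <- index_iota i j, x <- iota 0 (nu l)].

Lemma slots_uniq i j nu : uniq (slots i j nu).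
Proof.
apply: allpairs_uniq_dep; [exact: iota_uniq| |].
  by move=> l _; exact: iota_uniq.
by move=> [l x] [l' x'] _ _ /= [-> ->].
Qed.

Lemma mem_slots i j nu y :
  (y \in slots i j nu) = (i <= y.1 < j)%N && (y.2 < nu y.1)%N.
Proof.
case: y => l x; apply/allpairsPdep/idP => /= [[l' [x' [+ + [-> ->]]]]|].
  by rewrite mem_index_iota mem_iota /= add0n => -> ->.
by move=> /andP[h1 h2]; exists l, x; rewrite mem_index_iota mem_iota.
Qed.

Lemma size_slots i j nu : size (slots i j nu) = (\sum_(i <= l < j) nu l)%N.
Proof.
rewrite -sum1_size /slots big_allpairs_dep; apply: eq_bigr => l _.
by rewrite sum1_size size_iota.
Qed.

Lemma big_slots (V : Type) (idx : V) (op : Monoid.law idx) i j nu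
    (F : nat * nat -> V) :
  \big[op/idx]_(y <- slots i j nu) F y =
  \big[op/idx]_(i <= l < j) \big[op/idx]_(0 <= x < nu l) F (l, x).
Proof.
rewrite /slots big_allpairs_dep; apply: eq_bigr => l _.
by rewrite /index_iota subn0.
Qed.

Lemma slots_cat i j k nu : (i <= j)%N -> (j <= k)%N ->
  perm_eq (slots i k nu) (slots i j nu ++ slots j k nu).
Proof.
move=> ij jk; apply: uniq_perm; first exact: slots_uniq.
  rewrite cat_uniq !slots_uniq andbT /=; apply/hasPn => y.
  rewrite !mem_slots => /andP[/andP[j1 _] _].
  by rewrite (ltnNge _ j) j1 andbF.
move=> y; rewrite mem_cat !mem_slots; case: (y.2 < _)%N; rewrite ?andbF ?andbT//.
apply/idP/idP.
  by move=> /andP[-> ->]; case: leqP.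
by move=> /orP[] /andP[h1 h2]; rewrite ?h1 ?h2 /= ?andbT;
  [exact: leq_trans jk|exact: leq_trans h1].
Qed.

End slots.

Lemma prodr_const_seq (K : pzSemiRingType) (I : Type) (s : seq I) (x : K) :
  \prod_(i <- s) x = x ^+ size s.
Proof. by rewrite big_const_seq count_predT iter_mulr_1. Qed.

Section marks.
Context {d : measure_display} {T : measurableType d} {R : realType}.
Context {P : probability T R} {n : nat} {lambda mu xi a : R}.
Variable S : network_attack P n lambda mu xi a.
Hypothesis xi_gt0 : 0 < xi.
Implicit Types (z v : R[i]) (beta : n.-tuple R[i]).

Definition weight_exp v (y : nat * nat) (w : T) : R[i] :=
  expC (- v * (weight S y.1 y.2 w)%:C).

Definition passive_exp beta (y : nat * nat) (w : T) : R[i] :=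
  expC (dotC beta (passive S y.1 y.2 w)).

Definition weight_lst v : R[i] := expectationC P (weight_exp v (0, 0)%N).

Let mwexp v : cmeasurable (fun x : R => expC (- v * x%:C)).
Proof.
apply: measurableC_exp; apply: measurableCM; first exact: measurableC_cst.
exact: measurableC_real.
Qed.

Let mpexp beta : cmeasurable (fun x : n.-tuple R => expC (dotC beta x)).
Proof.
apply: measurableC_exp; rewrite /dotC.
apply: (@measurableC_sum _ _ _ _ _ (fun i (x : n.-tuple R) => tnth beta i * (tnth x i)%:C)) => i.
apply: measurableCM; first exact: measurableC_cst.
by apply: measurableC_real; exact: measurable_tnth.
Qed.

Lemma weight_gt0 k j : {ae P, forall w, 0 < weight S k j w}.
Proof. exact: (exponential_law_gt0 (weight_exponential S k j)). Qed.

Lemma integrableC_weight_exp v y : 0 <= Re v -> integrableC P (weight_exp v y).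
Proof.
move=> v0; apply: (@integrableC_bounded _ _ _ _ _ 1).
  exact: (measurableC_comp (@measurable_funP _ _ _ _ setT (weight S y.1 y.2)) (mwexp v)).
apply: filterS (weight_gt0 y.1 y.2) => w W0.
rewrite absC_expC complexReM complexReN /= mulr0 subr0.
by rewrite -expR0 ler_expR mulNr oppr_le0 mulr_ge0// ltW.
Qed.

Lemma expectationC_weight_exp v y :
  expectationC P (weight_exp v y) = weight_lst v.
Proof.
apply: (expectationC_eq_law (Y := weight S y.1 y.2) (Z := weight S 0 0) _ (mwexp v)).
by move=> A mA; rewrite !weight_exponential.
Qed.

Lemma expectationC_passive_exp beta y :
  expectationC P (passive_exp beta y) = passive_mgf S beta.
Proof.
apply: (expectationC_eq_law (Y := passive S y.1 y.2) (Z := passive S 0 0) _ (mpexp beta)).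
by move=> A mA; rewrite passive_identical.
Qed.

Lemma integrableC_passive_exp beta y :
  integrableC P (passive_exp beta (0, 0)%N) -> integrableC P (passive_exp beta y).
Proof.
apply: (integrableC_eq_law (Y := passive S 0 0) (Z := passive S y.1 y.2) _ (mpexp beta)).
by move=> A mA; rewrite [RHS]passive_identical.
Qed.

(** With the node numbers frozen, weights and passive changes factor. *)
Lemma expectationC_frozen_marks z v beta (V : R) (s1 s2 : seq (nat * nat)) :
  0 <= Re v -> integrableC P (passive_exp beta (0, 0)%N) -> 0 < V ->
  uniq (s1 ++ s2) ->
  let f w := (\sum_(y <- s1) weight S y.1 y.2 w < V)%R%:R *
    \prod_(y <- s1 ++ s2) (z * weight_exp v y w * passive_exp beta y w) in
  integrableC P f /\
  expectationC P f =
  (z * passive_mgf S beta) ^+ size s1 * gamma_transform xi (xi%:C + v) V (size s1)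
  * (z * weight_lst v * passive_mgf S beta) ^+ size s2.
Proof.
move=> v0 ib V0 u12 f.
have /and3P[u1 dis u2] : [&& uniq s1, ~~ has (mem s1) s2 & uniq s2].
  by rewrite -cat_uniq.
pose W (y : nat * nat) := weight S y.1 y.2.
pose X (y : nat * nat) := passive S y.1 y.2.
have mW y : measurable_fun setT (W y) by exact: measurable_funP.
have mX y : measurable_fun setT (X y) by exact: measurable_funP.
pose A (w : T) : R[i] := \prod_(y <- s1) expC (- v * (W y w)%:C)
  * (\sum_(y <- s1) W y w < V)%R%:R.
have iW := @weight_independent _ _ _ _ _ _ _ _ _ S.
have iX := @passive_independent _ _ _ _ _ _ _ _ _ S.
have [Ai AE] := expectationC_truncated_weights xi_gt0
  (fun y => weight_exponential S y.1 y.2) iW u1 v0 V0.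
have mA : measurableC_wrt (RV_block W [set` s1]) A.
  exact: measurableC_truncated_weights.
have [Bi BE] := expectationC_indep_prod mW iW (mwexp v)
  (fun y => integrableC_weight_exp y v0) mA Ai u2
  (fun y ys2 ys1 => negP (hasPn dis _ ys2) ys1).
have [Ci CE] := @expectationC_indep_prod _ _ _ _ _ P _ X mX iX
  (fun x => expC (dotC beta x)) set0 (fun=> 1) (s1 ++ s2) (mpexp beta)
  (fun y => integrableC_passive_exp y ib) (measurableC_cst _) (integrableC_cst _ _)
  u12 (fun _ _ h => h).
have mWf y : measurableC_wrt (families S [:: 2]%N) (weight_exp v y).
  by apply: (measurableC_comp _ (mwexp v)); exact: measurable_weight.
have mWp s : measurableC_wrt (families S [:: 2]%N) (fun w => \prod_(y <- s) weight_exp v y w).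
  exact: (@measurableC_prod _ (g_sigma_algebraType (families S [:: 2]%N))).
have [] := @expectationC_indepM _ _ _ P (families S [:: 2]%N) (families S [:: 3]%N)
  _ _ _ _ _ _ _ Bi Ci.
- exact: families_measurable.
- exact: families_measurable.
- by apply: indep_families => x; rewrite !inE => /eqP ->.
- apply: measurableCM; last first.
    exact: mWp.
  apply: measurableCM; first exact: mWp.
  apply: measurableC_bool; apply: measurable_fun_ltr; last exact: measurable_cst.
  by apply: measurable_sum => y; exact: measurable_weight.
- apply: measurableCM; first exact: measurableC_cst.
  apply: (@measurableC_prod _ (g_sigma_algebraType (families S [:: 3]%N)) R _ _
    (passive_exp beta)) => y.
  by apply: (measurableC_comp _ (mpexp beta)); exact: measurable_passive.
have fE w : f w = z ^+ (size s1 + size s2) *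
    (A w * \prod_(y <- s2) expC (- v * (W y w)%:C) *
     (1 * \prod_(y <- s1 ++ s2) expC (dotC beta (X y w)))).
  rewrite /f /A mul1r !big_split /= prodr_const_seq size_cat.
  rewrite [\prod_(y <- s1 ++ s2) weight_exp v y w]big_cat /=.
  rewrite /weight_exp /passive_exp; ring.
move=> Di DE.
have -> : f = fun w => z ^+ (size s1 + size s2) *
    (A w * \prod_(y <- s2) expC (- v * (W y w)%:C) *
     (1 * \prod_(y <- s1 ++ s2) expC (dotC beta (X y w)))) by exact/funext.
split; first exact: integrableCZ.
rewrite expectationCZ// DE BE CE AE expectationC_cst.
have -> : \prod_(y <- s1 ++ s2) expectationC P (fun w => expC (dotC beta (X y w))) =
    passive_mgf S beta ^+ size (s1 ++ s2).
  by rewrite -prodr_const_seq; apply: eq_bigr => y _; exact: expectationC_passive_exp.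
have -> : \prod_(y <- s2) expectationC P (fun w => expC (- v * (W y w)%:C)) =
    weight_lst v ^+ size s2.
  by rewrite -prodr_const_seq; apply: eq_bigr => y _; exact: expectationC_weight_exp.
rewrite size_cat !exprMn !exprD; ring.
Qed.

End marks.

Section nodes_law.
Context {d : measure_display} {T : measurableType d} {R : realType}.
Context {P : probability T R} {n : nat} {lambda mu xi a : R}.
Variable S : network_attack P n lambda mu xi a.
Hypotheses (a_gt0 : 0 < a) (a_lt1 : a < 1).
Local Open Scope ereal_scope.

Let mnode k (A : set nat) : measurable (nodes S k @^-1` A).
Proof. by rewrite -[X in measurable X]setTI; exact: measurable_funP. Qed.

(** Geometric probabilities on the positive integers already sum to 1. *)
Lemma nodes_neq0 k : P [set w | nodes S k w = 0%N] = 0.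
Proof.
pose F j := [set w | nodes S k w = j.+1].
have mF j : measurable (F j) by exact: (mnode k [set j.+1]).
have PF : P (\bigcup_j F j) = 1.
  rewrite measure_bigcup//; last first.
    by move=> i j _ _ [w []]; rewrite /F /= => -> -[].
  transitivity (limn (EFin \o series (geometric a (1 - a)))).
    apply: congr_lim; apply/funext => m /=; rewrite /series /= -sumEFin big_mkcond.
    apply: eq_bigr => j _; by rewrite mem_set// /F nodes_geometric.
  rewrite EFin_lim; last by apply: is_cvg_geometric_series; rewrite ger0_norm ?subr_ge0 1?ltW// gtrBl.
  congr EFin; apply/cvg_lim => //.
  have := @cvg_geometric_series R a (1 - a); rewrite subKr divff ?gt_eqF//.
  by apply; rewrite ger0_norm ?subr_ge0 1?ltW// gtrBl.
have -> : [set w | nodes S k w = 0%N] = ~` \bigcup_j F j.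
  apply/seteqP; split => w /=.
    by move=> w0 [j _]; rewrite /F /= w0.
  by move=> nF; case E : (nodes S k w) => [//|j]; case: nF; exists j.
by rewrite probability_setC ?PF ?subee//; exact: bigcupT_measurable.
Qed.

Lemma nodes_gt0 k : {ae P, forall w, (0 < nodes S k w)%N}.
Proof.
exists [set w | nodes S k w = 0%N]; split; first exact: (mnode k [set 0%N]).
  exact: nodes_neq0.
by move=> w /= /negP; rewrite -eqn0Ngt => /eqP.
Qed.

Definition node_pmf (j : nat) : R := if j is j'.+1 then a * (1 - a) ^+ j' else 0.

Lemma nodes_pmf k j : P [set w | nodes S k w = j] = (node_pmf j)%:E.
Proof. by case: j => [|j]; [exact: nodes_neq0|rewrite nodes_geometric]. Qed.

Lemma nodes_identical k (A : set nat) : measurable A ->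
  distribution P (nodes S k) A = distribution P (nodes S 0) A.
Proof.
move=> _.
have law l : distribution P (nodes S l) A = \sum_(0 <= j <oo | j \in A) (node_pmf j)%:E.
  rewrite /distribution /= /pushforward.
  have -> : nodes S l @^-1` A = \bigcup_(j in A) [set w | nodes S l w = j].
    by apply/seteqP; split => [w Aw|w [j Aj /= ->]]; [exists (nodes S l w)|].
  rewrite measure_bigcup//; last 2 first.
    by move=> j _; exact: (mnode l [set j]).
    by move=> i j _ _ [w [/= <- <-]].
  by apply: eq_eseriesr => j _; exact: nodes_pmf.
by rewrite !law.
Qed.

End nodes_law.

Section node_sums.
Context {d : measure_display} {T : measurableType d} {R : realType}.
Context {P : probability T R} {n : nat} {lambda mu xi a : R}.
Variable S : network_attack P n lambda mu xi a.

Definition node_sum (i j : nat) (w : T) : nat := (\sum_(i <= l < j) nodes S l w)%N.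

Lemma measurable_wrt_node_sum (G : set_system T) i j :
  (forall l, (i <= l < j)%N -> measurable_wrt G (nodes S l)) ->
  measurable_wrt G (node_sum i j).
Proof.
move=> mG; rewrite /node_sum.
have -> : (fun w => \sum_(i <= l < j) nodes S l w)%N =
    (fun w => \sum_(l <- [seq l <- index_iota i j | (i <= l < j)%N]) nodes S l w)%N.
  apply/funext => w; rewrite big_filter big_seq_cond [RHS]big_seq_cond.
  by apply: eq_bigl => l; rewrite mem_index_iota; case: (_ <= _ < _)%N.
have : forall l, l \in [seq l <- index_iota i j | (i <= l < j)%N] ->
    measurable_wrt G (nodes S l).
  by move=> l; rewrite mem_filter => /andP[/mG].
elim: [seq _ <- _ | _] => [|l s IH] ms.
  rewrite (_ : (fun w => _) = fun=> 0%N); first exact: measurable_cst.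
  by apply/funext => w; rewrite big_nil.
rewrite (_ : (fun w => _) = fun w => (nodes S l w + \sum_(k <- s) nodes S k w)%N); last first.
  by apply/funext => w; rewrite big_cons.
apply: measurable_fun_addn; first by apply: ms; exact: mem_head.
by apply: IH => k ks; apply: ms; rewrite inE ks orbT.
Qed.

Lemma measurableC_nat (phi : nat -> R[i]) : cmeasurable phi.
Proof. by split. Qed.

End node_sums.

Section absolute_parameters.
Context {d : measure_display} {T : measurableType d} {R : realType}.
Context {P : probability T R} {n : nat} {lambda mu xi a : R}.
Variable S : network_attack P n lambda mu xi a.
Implicit Types (z v : R[i]) (beta : n.-tuple R[i]).

(** Arguments at which the transforms bound those at [z], [v] and [beta]: the
    integrand there is the modulus of the original one. *)
Definition real_part (v : R[i]) : R[i] := (Re v)%:C.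
Definition modulus (z : R[i]) : R[i] := (absC z)%:C.
Definition real_parts beta : n.-tuple R[i] := map_tuple real_part beta.

Lemma Re_dotC beta (x : n.-tuple R) :
  Re (dotC beta x) = dot (map_tuple (@complex.Re R) beta) x.
Proof.
rewrite /dotC /dot complexRe_sum; apply: eq_bigr => i _.
by rewrite tnth_map complexReM /= mulr0 subr0.
Qed.

Lemma dotC_real_parts beta (x : n.-tuple R) :
  dotC (real_parts beta) x = (dot (map_tuple (@complex.Re R) beta) x)%:C.
Proof.
rewrite /dotC /dot rmorph_sum; apply: eq_bigr => i _.
by rewrite !tnth_map /real_part rmorphM.
Qed.

Lemma absC_exp_real_part v (x : R) :
  (absC (expC (- v * x%:C)))%:C = expC (- real_part v * x%:C).
Proof.
rewrite absC_expC complexReM complexReN /= mulr0 subr0.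
by rewrite -rmorphN -rmorphM expC_real.
Qed.

Lemma absC_passive_exp beta y w :
  (absC (passive_exp S beta y w))%:C = passive_exp S (real_parts beta) y w.
Proof. by rewrite /passive_exp absC_expC Re_dotC dotC_real_parts expC_real. Qed.

Lemma absC_weight_exp v y w :
  (absC (weight_exp S v y w))%:C = weight_exp S (real_part v) y w.
Proof. exact: absC_exp_real_part. Qed.

End absolute_parameters.

Section marked_attacks.
Context {d : measure_display} {T : measurableType d} {R : realType}.
Context {P : probability T R} {n : nat} {lambda mu xi a : R}.
Variable S : network_attack P n lambda mu xi a.
Hypotheses (xi_gt0 : 0 < xi) (a_gt0 : 0 < a) (a_lt1 : a < 1).
Variables (M : nat) (V : R).
Hypothesis V_gt0 : 0 < V.
Implicit Types (z v : R[i]) (beta : n.-tuple R[i]).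

Definition node_mark z v beta (y : nat * nat) (w : T) : R[i] :=
  z * weight_exp S v y w * passive_exp S beta y w.

(** Mark transform of the first [j] attacks on the event that the first [i]
    leave the process below both thresholds; the node numbers are read at [w],
    the weights and passive changes at [w']. *)
Definition frozen_marks z v beta (i j : nat) (w w' : T) : R[i] :=
  (node_sum S 0 i w < M)%N%:R *
  ((\sum_(y <- slots 0 i (nodes S ^~ w)) weight S y.1 y.2 w' < V)%R%:R *
   \prod_(y <- slots 0 i (nodes S ^~ w) ++ slots i j (nodes S ^~ w))
     node_mark z v beta y w').

Definition node_factor z v beta : R[i] :=
  z * weight_lst S v * passive_mgf S beta.

Definition box_transform z v beta (i : nat) (w : T) : R[i] :=
  (node_sum S 0 i w < M)%N%:R *
  ((z * passive_mgf S beta) ^+ node_sum S 0 i w *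
   gamma_transform xi (xi%:C + v) V (node_sum S 0 i w)).

Lemma absC_frozen_marks z v beta i j w w' :
  (absC (frozen_marks z v beta i j w w'))%:C =
  frozen_marks (modulus z) (real_part v) (real_parts beta) i j w w'.
Proof.
rewrite /frozen_marks !absCM !absC_bool absC_prod !rmorphM !rmorph_nat rmorph_prod /=.
do 2 congr (_ * _); apply: eq_bigr => y _.
by rewrite /node_mark !absCM !rmorphM /= absC_weight_exp absC_passive_exp.
Qed.

Let mnode_mark (G : set_system T) z v beta y :
  measurable_wrt G (weight S y.1 y.2) -> measurable_wrt G (passive S y.1 y.2) ->
  measurableC_wrt G (node_mark z v beta y).
Proof.
move=> mW mX; apply: measurableCM; last first.
  apply: measurableC_exp; rewrite /dotC.
  apply: (@measurableC_sum _ (g_sigma_algebraType G) R _ _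
    (fun l w => tnth beta l * (tnth (passive S y.1 y.2 w) l)%:C)) => l.
  apply: measurableCM; first exact: measurableC_cst.
  apply: measurableC_real; have := measurableT_comp (measurable_tnth l) mX.
  exact.
apply: measurableCM; first exact: measurableC_cst.
apply: measurableC_exp; apply: measurableCM; first exact: measurableC_cst.
by apply: measurableC_real.
Qed.

(** Jointly in both outcomes, since the products run up to a random index that
    depends on the frozen outcome only. *)
Lemma measurableC_frozen_marks (G H : set_system T) z v beta i j :
  (forall l, measurable_wrt G (nodes S l)) ->
  (forall y : nat * nat, measurable_wrt H (weight S y.1 y.2)) ->
  (forall y : nat * nat, measurable_wrt H (passive S y.1 y.2)) ->
  @cmeasurable _ (g_sigma_algebraType G * g_sigma_algebraType H)%type R
    (fun u => frozen_marks z v beta i j u.1 u.2).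
Proof.
move=> mN mW mX; rewrite /frozen_marks.
pose TGH : measurableType _ := (g_sigma_algebraType G * g_sigma_algebraType H)%type.
apply: measurableCM.
  apply: measurableC_bool; apply: measurable_fun_ltn; last exact: measurable_cst.
  apply: (measurable_wrt_fst _ (g := node_sum S 0 i)).
  by apply: measurable_wrt_node_sum.
have mN1 l := @measurable_wrt_fst _ _ G H _ _ _ (mN l).
have mprod (r : seq nat) : @cmeasurable _ (g_sigma_algebraType G * g_sigma_algebraType H)%type R
    (fun u => \prod_(l <- r) \prod_(0 <= x < nodes S l u.1) node_mark z v beta (l, x) u.2).
  apply: measurableC_prod => l.
  apply: (@measurableC_random_index _ TGH R (fun u => nodes S l u.1)
    (fun m u => \prod_(0 <= x < m) node_mark z v beta (l, x) u.2)) => //.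
  move=> m; apply: measurableC_prod => x.
  by apply: measurableC_wrt_snd; apply: mnode_mark; [exact: (mW (l, x))|exact: (mX (l, x))].
apply: measurableCM.
  apply: measurableC_bool; apply: measurable_fun_ltr; last exact: measurable_cst.
  under eq_fun do rewrite big_slots.
  apply: measurable_sum => l.
  apply: (@measurable_fun_random_index _ TGH _ _ (fun u => nodes S l u.1)
    (fun m u => \sum_(0 <= x < m) weight S l x u.2)) => //.
  move=> m; apply: measurable_sum => x.
  exact: (@measurable_wrt_snd _ _ G H _ _ _ (mW (l, x))).
under eq_fun do rewrite big_cat !big_slots.
exact: measurableCM.
Qed.

Let geometric_power (q : R[i]) i j w :
  \prod_(l <- index_iota i j) q ^+ nodes S l w = q ^+ node_sum S i j w.
Proof. by rewrite /node_sum (big_morph _ (exprD q) (expr0 q)). Qed.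

Let mN l : measurable_fun setT (nodes S l).
Proof. exact: measurable_funP. Qed.

Let mbox (J : set nat) z v beta i : (forall l, (l < i)%N -> J l) ->
  measurableC_wrt (RV_block (nodes S) J) (box_transform z v beta i).
Proof.
move=> Ji; have ms : measurable_wrt (RV_block (nodes S) J) (node_sum S 0 i).
  apply: measurable_wrt_node_sum => l /andP[_ li].
  by apply: measurable_wrt_RV_block; exact: Ji.
exact: (measurableC_comp (f := fun r => (r < M)%N%:R * ((z * passive_mgf S beta) ^+ r *
  gamma_transform xi (xi%:C + v) V r)) ms (measurableC_nat _)).
Qed.

Lemma integrableC_box_transform z v beta i : integrableC P (box_transform z v beta i).
Proof.
pose phi r : R[i] := (z * passive_mgf S beta) ^+ r * gamma_transform xi (xi%:C + v) V r.
apply: (@integrableC_bounded _ _ _ _ _ (\sum_(r < M) absC (phi r))).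
  apply: measurableC_wrtW (mbox (J := setT) _ _ _ _) => //.
  exact: (RV_block_measurable mN).
apply: aeW => w; rewrite /box_transform absCM absC_bool -/(phi _).
have [rM|_] := ltnP; last by rewrite mul0r sumr_ge0// => r _; exact: absC_ge0.
by rewrite mul1r (bigD1 (Ordinal rM))//= lerDl sumr_ge0// => r _; exact: absC_ge0.
Qed.

(** The numbers of nodes lost in later attacks are independent of those lost in
    the first [i], which determine [box_transform]. *)
Lemma expectationC_box_transform (q : R[i]) z v beta i j : (i <= j)%N ->
  integrableC P (fun w => q ^+ nodes S 0 w) ->
  integrableC P (fun w => box_transform z v beta i w * q ^+ node_sum S i j w) /\
  expectationC P (fun w => box_transform z v beta i w * q ^+ node_sum S i j w) =
  expectationC P (box_transform z v beta i) *
  expectationC P (fun w => q ^+ nodes S 0 w) ^+ (j - i).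
Proof.
move=> ij q0; have iN := @nodes_independent _ _ _ _ _ _ _ _ _ S.
have mq : cmeasurable (fun r : nat => q ^+ r) by exact: measurableC_nat.
have iq l : integrableC P (fun w => q ^+ nodes S l w).
  apply: (integrableC_eq_law (Y := nodes S 0) (Z := nodes S l) _ mq q0).
  by move=> A mA; rewrite [RHS]nodes_identical.
have [] := expectationC_indep_prod mN iN (J := [set l | (l < i)%N]) mq iq
  (mbox (i := i) z v beta (fun l li => li)) (integrableC_box_transform z v beta i)
  (iota_uniq i (j - i)).
  by move=> l; rewrite mem_iota => /andP[il _] /=; rewrite ltnNge il.
move=> I E; split.
  by move: I; under eq_fun do rewrite geometric_power.
move: E; under eq_fun do rewrite geometric_power.
move=> ->; congr (_ * _); rewrite -[X in _ ^+ X](size_iota i) -prodr_const_seq.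
apply: eq_bigr => l _.
apply: (expectationC_eq_law (Y := nodes S l) (Z := nodes S 0) _ mq).
by move=> A mA; rewrite nodes_identical.
Qed.

Let frozen_expectation z v beta i j w : 0 <= Re v ->
  integrableC P (passive_exp S beta (0, 0)%N) -> (i <= j)%N ->
  integrableC P (frozen_marks z v beta i j w) /\
  expectationC P (frozen_marks z v beta i j w) =
  box_transform z v beta i w * node_factor z v beta ^+ node_sum S i j w.
Proof.
move=> v0 ib ij.
have u12 : uniq (slots 0 i (nodes S ^~ w) ++ slots i j (nodes S ^~ w)).
  by rewrite -(perm_uniq (slots_cat (nodes S ^~ w) (leq0n i) ij)) slots_uniq.
have [fi fE] := expectationC_frozen_marks xi_gt0 z v0 ib V_gt0 u12.
split; first exact: integrableCZ.
by rewrite /frozen_marks expectationCZ// fE !size_slots mulrA.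
Qed.

(** Freezing the node numbers leaves independent weights and passive changes; the
    remaining expectation over the node numbers splits at attack [i]. *)
Theorem expectationC_marks z v beta i j : 0 <= Re v ->
  integrableC P (passive_exp S beta (0, 0)%N) ->
  integrableC P (fun w =>
    node_factor (modulus z) (real_part v) (real_parts beta) ^+ nodes S 0 w) ->
  integrableC P (fun w => node_factor z v beta ^+ nodes S 0 w) ->
  (i <= j)%N ->
  integrableC P (fun w => frozen_marks z v beta i j w w) /\
  expectationC P (fun w => frozen_marks z v beta i j w w) =
  expectationC P (box_transform z v beta i) *
  expectationC P (fun w => node_factor z v beta ^+ nodes S 0 w) ^+ (j - i).
Proof.
move=> v0 ib qa q ij.
pose G := families S [:: 1%N]; pose H := families S [:: 2; 3]%N.
have ibA : integrableC P (passive_exp S (real_parts beta) (0, 0)%N).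
  by apply: integrableC_abs ib _ => w; exact: absC_passive_exp.
have [hi hE] := expectationC_box_transform z v beta ij q.
have [hAi hAE] := expectationC_box_transform (modulus z) (real_part v) (real_parts beta) ij qa.
pose k (w : T) : \bar R := (Re (box_transform (modulus z) (real_part v) (real_parts beta) i w *
  node_factor (modulus z) (real_part v) (real_parts beta) ^+ node_sum S i j w))%:E.
have kE w : (\int[P]_w' (absC (frozen_marks z v beta i j w w'))%:E = k w)%E.
  have [fi _] := frozen_expectation z w v0 ib ij.
  rewrite integral_absC//; congr (Re _)%:E.
  have [_ <-] := frozen_expectation (modulus z) w (v0 : 0 <= Re (real_part v)) ibA ij.
  by congr expectationC; apply/funext => w'; exact: absC_frozen_marks.
have k0 w : (0 <= k w)%E.
  by rewrite -kE; apply: integral_ge0 => w' _; rewrite lee_fin absC_ge0.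
have [kRe _] := hAi.
rewrite -hE.
apply: (@freezing_systems _ _ _ P G H _ _ k).
- exact: families_measurable.
- exact: families_measurable.
- by apply: indep_families => x; rewrite !inE => /eqP ->.
- apply: measurableC_frozen_marks => [l|y|y].
  + exact: measurable_nodes.
  + exact: measurable_weight.
  + exact: measurable_passive.
- exact: integrableC_measurable hi.
- exact: measurable_int kRe.
- exact: k0.
- have /integrableP[_] := kRe; apply: le_lt_trans.
  rewrite le_eqVlt; apply/orP; left; apply/eqP; apply: eq_integral => w _.
  exact/esym/(gee0_abs (k0 w)).
- by apply: aeW => w; rewrite kE.
- by apply: aeW => w; have [_ ->] := frozen_expectation z w v0 ib ij.
Qed.

End marked_attacks.

(** * The attack count at the observation times *)

Section attack_counts.
Context {d : measure_display} {T : measurableType d} {R : realType}.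
Context {P : probability T R} {n : nat} {lambda mu xi a : R}.
Variable S : network_attack P n lambda mu xi a.
Hypothesis lambda_gt0 : 0 < lambda.

(** As the attack times increase, two consecutive ones decide whether exactly [i]
    attacks occur up to time [s]. *)
Definition attack_count (s : R) (i : nat) (w : T) : bool :=
  ((i == 0)%N || (attack_time S i.-1 w <= s)) && (s < attack_time S i w).

Let time_gt0 w : 0 < attack_time S 0 w.
Proof. by have [h _] := attack_time_poisson S; exact: h. Qed.

Let time_lt w k l : (k < l)%N -> attack_time S k w < attack_time S l w.
Proof.
have [_ [h _]] := attack_time_poisson S.
elim: l => // l IH; rewrite ltnS leq_eqVlt => /orP[/eqP ->|/IH]; first exact: h.
by move/lt_trans; apply; exact: h.
Qed.

Let time_le w k l : (k <= l)%N -> attack_time S k w <= attack_time S l w.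
Proof. by rewrite leq_eqVlt => /orP[/eqP -> //|/(time_lt w)/ltW]. Qed.

Let time_all_gt0 w k : 0 < attack_time S k w.
Proof. exact: lt_le_trans (time_gt0 w) (time_le w (leq0n k)). Qed.

Lemma attack_countE s i w k : attack_count s i w ->
  (attack_time S k w <= s) = (k < i)%N.
Proof.
move=> /andP[i1 i2]; apply/idP/idP => [ks|ki].
  rewrite ltnNge; apply/negP => ik.
  by have := lt_le_trans i2 (le_trans (time_le w ik) ks); rewrite ltxx.
case: i => // i in i1 i2 ki *; move: i1; rewrite orFb.
exact/le_trans/time_le.
Qed.

Lemma attacks_upto_count s i w : attack_count s i w -> attacks_upto S s w = `I_i.
Proof.
by move=> ci; apply/seteqP; split => k; rewrite /attacks_upto /= (attack_countE k ci).
Qed.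

Lemma attack_count_inj s i j w : attack_count s i w -> attack_count s j w -> i = j.
Proof.
move=> ci cj.
have ij k : (k < i)%N = (k < j)%N by rewrite -(attack_countE k ci) (attack_countE k cj).
by case: (ltngtP i j) => // h; [have := ij i|have := ij j]; rewrite ltnn h.
Qed.

Lemma attack_count_mono s s' i j w : s <= s' ->
  attack_count s i w -> attack_count s' j w -> (i <= j)%N.
Proof.
move=> ss' ci cj; rewrite leqNgt; apply/negP => ji.
have := attack_countE j ci; rewrite ji => /le_trans /(_ ss').
by rewrite (attack_countE j cj) ltnn.
Qed.

Lemma attack_count0 i w : attack_count 0 i w = (i == 0%N).
Proof.
case: i => [|i]; rewrite /attack_count /= ?time_all_gt0//.
by rewrite leNgt time_all_gt0.
Qed.

(** The first attack after [s], if any, determines the count. *)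
Lemma attack_count_total s w :
  (exists i, attack_count s i w) \/ (forall k, attack_time S k w <= s).
Proof.
have [|no] := pselect (exists k, s < attack_time S k w); last first.
  by right => k; rewrite leNgt; apply/negP => sk; apply: no; exists k.
move=> ex; left; have := ex_minnP ex => -[i si mi]; exists i.
rewrite /attack_count si andbT; case: i si mi => //= i si mi.
rewrite leNgt; apply/negP => /mi.
by rewrite ltnn.
Qed.

(** An infinite set of attacks has no finite cardinality. *)
Let finite_count s w i : 0 <= s ->
  attack_count s i w <-> ([set k | 0 < attack_time S k w <= s] #= `I_i)%card.
Proof.
move=> s0; have E : [set k | 0 < attack_time S k w <= s] = attacks_upto S s w.
  by apply/seteqP; split => k; rewrite /attacks_upto /= time_all_gt0.
rewrite E; split; first by move/attacks_upto_count ->.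
have [[m cm]|all] := attack_count_total s w.
  by rewrite (attacks_upto_count cm) => /card_eq_II <-.
have -> : attacks_upto S s w = setT by apply/seteqP; split => // k _; exact: all.
move=> ci; have : finite_set [set: nat] by apply/finite_setP; exists i.
by move/infinite_nat.
Qed.

Let finite_increment s s' w i j : s <= s' -> (i <= j)%N -> attack_count s i w ->
  attack_count s' j w <->
  ([set k | s < attack_time S k w <= s'] #= `I_(j - i))%card.
Proof.
move=> ss' ij ci.
have E m : attack_count s' m w ->
    ([set k | s < attack_time S k w <= s'] #= `I_(m - i))%card.
  move=> cm.
  have -> : [set k | s < attack_time S k w <= s'] = `I_m `\` `I_i.
    apply/seteqP; split => k /=; rewrite ltNge (attack_countE k ci) (attack_countE k cm).
      by move=> /andP[/negP].
    by move=> [-> /negP ->].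
  exact: card_IID.
split; first exact: E.
have [[m cm]|all] := attack_count_total s' w.
  move=> cj; have := card_eq_trans (card_esym (E _ cm)) cj.
  move=> /card_eq_II mij; have im := attack_count_mono ss' ci cm.
  have -> : j = m by rewrite -(subnK ij) -(subnK im) mij.
  exact: cm.
have -> : [set k | s < attack_time S k w <= s'] = ~` `I_i.
  apply/seteqP; split => k /=; rewrite all andbT ltNge (attack_countE k ci).
    by move/negP.
  by move/negP.
move=> ci'; have : finite_set [set: nat].
  rewrite -(setvU `I_i) finite_setU; split => //.
  by apply/finite_setP; exists (j - i)%N.
by move/infinite_nat.
Qed.

(** [poisson_pmf 0] is not the mass function of the constant 0. *)
Definition count_pmf (s : R) (i : nat) : R :=
  if 0 < s then poisson_pmf (lambda * s) i else (i == 0%N)%:R.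

Lemma probability_attack_count s i : 0 <= s ->
  P [set w | attack_count s i w] = (count_pmf s i)%:E.
Proof.
rewrite le_eqVlt => /orP[/eqP <-|s0].
  rewrite /count_pmf ltxx; case: i => [|i].
    rewrite (_ : [set w | _] = setT) ?probability_setT//.
    by apply/seteqP; split => // w _; rewrite /= attack_count0.
  rewrite (_ : [set w | _] = set0) ?measure0//.
  by apply/seteqP; split => // w; rewrite /= attack_count0.
have [_ [_ h]] := attack_time_poisson S.
have := h 1%N (fun l => l%:R * s) (fun=> i); rewrite mul0r big_ord1 /=.
rewrite mul1r mul0r subr0 /count_pmf s0.
move=> <- //; last by move=> l; rewrite ltr_pM2r// ltr_nat.
congr (P _); apply/seteqP; split => w /=.
  move=> ci [|l] //= _; rewrite mul0r mul1r.
  by apply/finite_count => //; exact: ltW.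
move=> /(_ 0%N isT) /=; rewrite mul0r mul1r => /finite_count; apply; exact: ltW.
Qed.

Lemma probability_attack_counts s s' i j : 0 <= s -> s < s' -> (i <= j)%N ->
  P [set w | attack_count s i w && attack_count s' j w] =
  (count_pmf s i * poisson_pmf (lambda * (s' - s)) (j - i))%:E.
Proof.
rewrite le_eqVlt => /orP[/eqP <-|s0] ss' ij.
  rewrite subr0 /count_pmf ltxx; case: i ij => [|i] ij.
    rewrite mul1r subn0 (_ : [set w | _] = [set w | attack_count s' j w]).
      by rewrite probability_attack_count ?ltW// /count_pmf ss'.
    by apply/seteqP; split => w /=; rewrite attack_count0.
  rewrite (_ : [set w | _] = set0) ?measure0 ?mul0r//.
  by apply/seteqP; split => // w; rewrite /= attack_count0.
have [_ [_ h]] := attack_time_poisson S.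
pose ss l := if l is l'.+1 then s + l'%:R * (s' - s) else 0.
have := h 2%N ss (fun l => if l is 0%N then i else (j - i)%N).
rewrite /ss big_ord_recl big_ord1 /= mul0r mul1r addr0 subr0 [s + _]addrC subrK.
rewrite /count_pmf s0 -EFinM => <- //.
  congr (P _); apply/seteqP; split => w /=.
    move=> /andP[ci cj] [|[|l]] //= _; rewrite mul0r addr0 ?mul1r.
      by apply/finite_count => //; exact: ltW.
    by rewrite addrC subrK; apply/finite_increment => //; exact: ltW.
  move=> hw; have := hw 0%N isT; have := hw 1%N isT => /=.
  rewrite mul0r addr0 mul1r addrC subrK => c1 c0.
  have ci : attack_count s i w by apply/finite_count => //; exact: ltW.
  by rewrite ci /=; apply/(finite_increment _ _ ci) => //; exact: ltW.
move=> [|l]; first by rewrite mul0r addr0.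
by rewrite ltrD2l ltr_pM2r ?subr_gt0// ltr_nat.
Qed.

Lemma measurable_attack_count s i : measurable [set w | attack_count s i w].
Proof.
rewrite (_ : [set w | _] =
    (if i == 0%N then setT else attack_time S i.-1 @^-1` `]-oo, s]) `&`
    attack_time S i @^-1` `]s, +oo[); last first.
  apply/seteqP; split => w; rewrite /attack_count /= in_itv /= andbT.
    by move=> /andP[+ ->]; case: ifP => //= _ ?; rewrite in_itv.
  by move=> [+ ->]; case: ifP => //= _; rewrite in_itv /= => ->.
have mt k A : measurable A -> measurable (attack_time S k @^-1` A).
  by move=> mA; rewrite -[X in measurable X]setTI; exact: measurable_funP.
by apply: measurableI; [case: ifP => // _|]; exact: mt.
Qed.

(** Poisson probabilities sum to 1, so that at each positive integer time some
    count exists almost surely; attacks that all precede [s] would contradict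
    this at the next integer. *)
Lemma attack_count_exists :
  {ae P, forall w, forall s : R, exists i, attack_count s i w}.
Proof.
have unb (m : nat) : {ae P, forall w, exists i, attack_count m.+1%:R i w}.
  pose B := \bigcup_i [set w | attack_count m.+1%:R i w].
  have mB : measurable B by apply: bigcupT_measurable => i; exact: measurable_attack_count.
  have PB : (P B = 1)%E.
    rewrite measure_bigcup//; last 2 first.
      by move=> i _; exact: measurable_attack_count.
      by move=> i j _ _ [w [/= ci cj]]; exact: attack_count_inj ci cj.
    have <- := @probability_setT _ _ _ (@poisson_prob R (lambda * m.+1%:R) 0).
    rewrite /= /poisson_prob mulr_gt0// -nneseries_esumT; last first.
      by move=> i; rewrite lee_fin poisson_pmf_ge0.
    apply: congr_lim; apply/funext => r; rewrite big_mkcond; apply: eq_bigr => i _.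
    rewrite mem_set//; apply: etrans (probability_attack_count _ _) _ => //.
    by rewrite /count_pmf ltr0Sn.
  exists (~` B); split.
  - exact: measurableC.
  - by rewrite probability_setC// PB subee.
  - by move=> w nw [i _ ci]; apply: nw; exists i.
have := ae_foralln unb; apply: filterS => w all s.
have [//|before] := attack_count_total s w.
have [i /andP[_]] := all (Num.truncn s).
rewrite ltNge => /negP[]; apply: le_trans (before i) _.
have [s0|s0] := leP 0 s; last by rewrite (le_trans (ltW s0)).
by have /andP[_ /ltW] := truncn_itv s0.
Qed.

Lemma expectationC_bool (b : T -> bool) : measurable [set w | b w] ->
  expectationC P (fun w => (b w)%:R) = (fine (P [set w | b w]))%:C.
Proof.
move=> mb; have -> : (fun w => (b w)%:R : R[i]) = fun w => (\1_[set w | b w] w)%:C.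
  apply/funext => w; rewrite indicE; case: (boolP (b w)) => bw.
    by rewrite mem_set.
  by rewrite memNset//=; exact/negP.
by rewrite expectationC_real expectation_indic.
Qed.

End attack_counts.

Arguments count_pmf {R} lambda s i.

Section clock.
Context {d : measure_display} {T : measurableType d} {R : realType}.
Context {P : probability T R} {n : nat} {lambda mu xi a : R}.
Variable S : network_attack P n lambda mu xi a.
Hypotheses (lambda_gt0 : 0 < lambda) (mu_gt0 : 0 < mu).
Variable theta : R[i].
Hypothesis theta_ge0 : 0 <= Re theta.

Lemma delay_gt0 : {ae P, forall w, forall k, 0 < delay S k w}.
Proof.
by apply: ae_foralln => k; exact: (exponential_law_gt0 (delay_exponential S k)).
Qed.

Lemma tauS k w : tau S k.+1 w = tau S k w + delay S k w.
Proof. by rewrite /tau big_ord_recr. Qed.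

Lemma tau0 w : tau S 0 w = 0.
Proof. by rewrite /tau big_ord0. Qed.

Lemma tau_ge0 w k : (forall l, 0 < delay S l w) -> 0 <= tau S k w.
Proof. by move=> dl; apply: sumr_ge0 => l _; exact: ltW. Qed.

Lemma measurable_wrt_tau (G : set_system T) k :
  (forall l, (l < k)%N -> measurable_wrt G (delay S l)) ->
  measurable_wrt G (tau S k).
Proof.
elim: k => [|k IH] mG.
  rewrite (_ : tau S 0 = fun=> 0); first exact: measurable_cst.
  by apply/funext => w; rewrite tau0.
rewrite (_ : tau S k.+1 = fun w => tau S k w + delay S k w); last first.
  by apply/funext => w; rewrite tauS.
apply: measurable_funD; last exact: mG.
by apply: IH => l lk; apply: mG; rewrite ltnS ltnW.
Qed.

Let delays := families S [:: 4]%N.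
Let times := families S [:: 0]%N.
Let DT : measurableType _ := (g_sigma_algebraType delays * g_sigma_algebraType times)%type.

Let mtau k : measurable_wrt delays (tau S k).
Proof. by apply: measurable_wrt_tau => l _; exact: measurable_delay. Qed.

Let mcount k i : measurable_fun (setT : set DT)
  (fun z : DT => attack_count S (tau S k z.1) i z.2).
Proof.
have m1 := @measurable_wrt_fst _ _ delays times _ _ _ (mtau k).
have m2 l := @measurable_wrt_snd _ _ delays times _ _ _
  (@measurable_attack_time _ _ _ _ _ _ _ _ _ S [:: 0]%N l isT).
apply: measurable_and; last exact: measurable_fun_ltr.
by apply: measurable_or; [exact: measurable_cst|exact: measurable_fun_ler].
Qed.

Let mexp_tau (G : set_system T) k : measurable_wrt G (tau S k) ->
  measurableC_wrt G (fun w => expC (- theta * (tau S k w)%:C)).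
Proof.
move=> mt; apply: measurableC_exp; apply: measurableCM; first exact: measurableC_cst.
exact: measurableC_real.
Qed.

Let exp_tau_le1 k : {ae P, forall w, absC (expC (- theta * (tau S k w)%:C)) <= 1}.
Proof.
apply: filterS delay_gt0 => w dl.
rewrite absC_expC complexReM complexReN /= mulr0 subr0.
by rewrite -expR0 ler_expR mulNr oppr_le0 mulr_ge0// tau_ge0.
Qed.

Lemma measurable_count_pmf i : measurable_fun setT (fun s => count_pmf lambda s i).
Proof.
apply: measurable_fun_ifT; [exact: measurable_fun_ltr| |exact: measurable_cst].
apply: (measurableT_comp (f := fun r => poisson_pmf r i)).
  exact: measurable_poisson_pmf.
by apply: measurable_funM => //; exact: measurable_cst.
Qed.

Lemma count_pmf_itv s i : 0 <= count_pmf lambda s i <= 1.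
Proof.
rewrite /count_pmf; case: ltP => s0; last by case: (_ == _); rewrite ?ler01 ?lexx.
rewrite poisson_pmf_ge0 /poisson_pmf mulr_gt0//.
by rewrite poisson_term_le1// mulr_ge0// ltW.
Qed.

Let measurable_section (B : DT -> bool) (w : T) : measurable_fun setT B ->
  measurable [set w' : T | B (w, w')].
Proof.
move=> mB; have mw : measurable_wrt times (fun w' => B (w, w')).
  exact: (measurableT_comp mB (measurable_pair1 (w : g_sigma_algebraType delays))).
have := measurable_wrtW (@families_measurable _ _ _ _ _ _ _ _ _ S _) mw.
by move=> /(_ measurableT [set true] I); rewrite setTI => mBw; exact: mBw.
Qed.

(** Freezing the observation times: an event about the attack times is replaced
    by its probability. *)
Let freeze_times (k : nat) (B : DT -> bool) (p : T -> R) :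
  measurable_fun setT B -> measurable_fun setT p ->
  {ae P, forall w : T, P [set w' : T | B (w, w')] = (p w)%:E} ->
  let f w := expC (- theta * (tau S k w)%:C) * (B (w, w))%:R in
  integrableC P f /\
  expectationC P f = expectationC P (fun w => expC (- theta * (tau S k w)%:C) * (p w)%:C).
Proof.
move=> mB mp pE f.
have mtauT : measurable_fun setT (tau S k).
  exact: (measurable_wrtW (@families_measurable _ _ _ _ _ _ _ _ _ S _) (mtau k)).
apply: (@freezing_systems _ _ _ P delays times
  (fun w w' => expC (- theta * (tau S k w)%:C) * (B (w, w'))%:R) _ (fun=> 1%E)).
- exact: families_measurable.
- exact: families_measurable.
- by apply: indep_families => x; rewrite !inE => /eqP ->.
- apply: measurableCM.
    apply: (measurableC_wrt_fst _ (g := fun w => expC (- theta * (tau S k w)%:C))).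
    exact: mexp_tau.
  apply: measurableC_bool; rewrite (_ : (fun z => _) = B)//.
  by apply/funext => -[].
- apply: measurableCM; last exact: measurableC_real.
  apply: measurableC_exp; apply: measurableCM; first exact: measurableC_cst.
  exact: measurableC_real.
- exact: measurable_cst.
- by [].
- by rewrite integral_cst// mul1e (le_lt_trans (probability_le1 _ _))// ltry.
- apply: filterS (exp_tau_le1 k) => w e1.
  rewrite -[leRHS](_ : \int[P]_w' 1 = 1)%E; last first.
    by rewrite integral_cst// mul1e; exact: probability_setT.
  have mBw := measurable_section w mB.
  apply: ge0_le_integral => //.
  + by move=> w' _; rewrite lee_fin absC_ge0.
  + apply/measurable_EFinP; apply: measurableC_absC; apply: measurableCM.
      exact: measurableC_cst.
    apply: measurableC_bool; apply: (measurable_fun_bool true).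
    by rewrite setTI.
  + move=> w' _; rewrite lee_fin absCM absC_bool mulr_ile1 ?absC_ge0//.
    by case: (B _).
- apply: filterS pE => w pw.
  have mBw := measurable_section w mB.
  rewrite expectationCZ; last first.
    apply: (@integrableC_bounded _ _ _ _ _ 1).
      apply: measurableC_bool; apply: (measurable_fun_bool true).
      by rewrite setTI.
    by apply: aeW => w'; rewrite absC_bool; case: (B _).
  by rewrite expectationC_bool// pw.
Qed.

Definition clock_transform (k i : nat) : R[i] := expectationC P
  (fun w => expC (- theta * (tau S k w)%:C) * (attack_count S (tau S k w) i w)%:R).

Let clock_frozen k i :
  integrableC P (fun w => expC (- theta * (tau S k w)%:C)
    * (attack_count S (tau S k w) i w)%:R) /\
  clock_transform k i = expectationC P
    (fun w => expC (- theta * (tau S k w)%:C) * (count_pmf lambda (tau S k w) i)%:C).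
Proof.
apply: (@freeze_times k (fun z => attack_count S (tau S k z.1) i z.2)).
- exact: mcount.
- apply: (measurableT_comp (measurable_count_pmf i)).
  exact: (measurable_wrtW (@families_measurable _ _ _ _ _ _ _ _ _ S _) (mtau k)).
- apply: filterS delay_gt0 => w dl.
  exact: (@probability_attack_count _ _ _ _ _ _ _ _ _ S _ i (tau_ge0 k dl)).
Qed.

Lemma integrableC_clock k i : integrableC P (fun w => expC (- theta * (tau S k w)%:C)
    * (attack_count S (tau S k w) i w)%:R).
Proof. by have [] := clock_frozen k i. Qed.

Definition delay_transform (l : nat) : R[i] :=
  mu%:C * lambda%:C ^+ l / (lambda%:C + theta + mu%:C) ^+ l.+1.

(** Independent increments: the next delay and the attacks during it are
    independent of the past of the clock. *)
Lemma expectationC_clock_step k i j : (i <= j)%N ->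
  integrableC P (fun w => expC (- theta * (tau S k.+1 w)%:C)
    * (attack_count S (tau S k w) i w && attack_count S (tau S k.+1 w) j w)%:R) /\
  expectationC P (fun w => expC (- theta * (tau S k.+1 w)%:C)
    * (attack_count S (tau S k w) i w && attack_count S (tau S k.+1 w) j w)%:R) =
  clock_transform k i * delay_transform (j - i).
Proof.
move=> ij.
have mD l : measurable_fun setT (delay S l) by exact: measurable_funP.
have iD := @delay_independent _ _ _ _ _ _ _ _ _ S.
have mtauT : measurable_fun setT (tau S k).
  exact: (measurable_wrtW (@families_measurable _ _ _ _ _ _ _ _ _ S _) (mtau k)).
have mlD : measurable_fun setT (fun w => lambda * delay S k w).
  by apply: measurable_funM => //; exact: measurable_cst.
have [|||fi ->] := @freeze_times k.+1
  (fun z => attack_count S (tau S k z.1) i z.2 && attack_count S (tau S k.+1 z.1) j z.2)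
  (fun w => count_pmf lambda (tau S k w) i
    * poisson_pmf (lambda * delay S k w) (j - i)).
- by apply: measurable_and; exact: mcount.
- apply: measurable_funM; first exact: (measurableT_comp (measurable_count_pmf i)).
  by apply: (measurableT_comp (f := fun r => poisson_pmf r (j - i))) => //;
    exact: measurable_poisson_pmf.
- apply: filterS delay_gt0 => w dl.
  have lt_tau : tau S k w < tau S k.+1 w by rewrite tauS ltrDl.
  have -> : delay S k w = tau S k.+1 w - tau S k w by rewrite tauS addrC addKr.
  exact: (@probability_attack_counts _ _ _ _ _ _ _ _ _ S _ _ i j (tau_ge0 k dl)
    lt_tau ij).
split => //.
have [di dE] := expectationC_exponential_poisson mu_gt0 (delay_exponential S k)
  (j - i) lambda_gt0 theta_ge0.
have ci : integrableC P (fun w => expC (- theta * (tau S k w)%:C)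
    * (count_pmf lambda (tau S k w) i)%:C).
  apply: (@integrableC_bounded _ _ _ _ _ 1).
    apply: measurableCM.
      apply: measurableC_exp; apply: measurableCM; first exact: measurableC_cst.
      exact: measurableC_real.
    by apply: measurableC_real; exact: (measurableT_comp (measurable_count_pmf i)).
  apply: filterS (exp_tau_le1 k) => w e1.
  have /andP[c0 c1] := count_pmf_itv (tau S k w) i.
  by rewrite absCM absC_real ger0_norm// mulr_ile1// absC_ge0.
have [_ ->] := clock_frozen k i.
have mt G : (forall l, (l < k)%N -> measurable_wrt G (delay S l)) ->
    measurableC_wrt G (fun w => expC (- theta * (tau S k w)%:C)
      * (count_pmf lambda (tau S k w) i)%:C).
  move=> mG; have mtG := measurable_wrt_tau mG.
  apply: measurableCM; first exact: mexp_tau.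
  apply: measurableC_real; exact: (measurableT_comp (measurable_count_pmf i) mtG).
have mdk G : measurable_wrt G (delay S k) ->
    measurableC_wrt G (fun w => expC (- theta * (delay S k w)%:C)
      * (poisson_pmf (lambda * delay S k w) (j - i))%:C).
  move=> mG; apply: measurableCM.
    apply: measurableC_exp; apply: measurableCM; first exact: measurableC_cst.
    exact: measurableC_real.
  apply: measurableC_real.
  apply: (measurableT_comp (f := fun r => poisson_pmf r (j - i))).
    exact: measurable_poisson_pmf.
  by apply: measurable_funM => //; exact: measurable_cst.
have kk : [set l | (l < k)%N] `&` [set k] = set0.
  by apply/seteqP; split => // l [/= + lk]; rewrite lk ltnn.
have past l : (l < k)%N ->
    measurable_wrt (RV_block (delay S) [set l | (l < k)%N]) (delay S l).
  by move=> lk; exact: measurable_wrt_RV_block.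
have present : measurable_wrt (RV_block (delay S) [set k]) (delay S k).
  exact: measurable_wrt_RV_block.
have [_] := @expectationC_indepM _ _ _ P (RV_block (delay S) [set l | (l < k)%N])
  (RV_block (delay S) [set k]) _ _ (@RV_block_measurable _ _ _ _ _ _ mD _)
  (@RV_block_measurable _ _ _ _ _ _ mD _)
  (indep_RV_blocks mD iD kk)
  (mt _ past) (mdk _ present) ci di.
rewrite dE /delay_transform => <-; congr expectationC; apply/funext => w.
rewrite rmorphM tauS rmorphD mulrDr expCD /=; ring.
Qed.

Lemma clock_transform0 i : clock_transform 0 i = (i == 0%N)%:R.
Proof.
rewrite /clock_transform -[RHS](expectationC_cst P); congr expectationC.
by apply/funext => w; rewrite tau0 attack_count0 mulr0 expC0 mul1r.
Qed.

End clock.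

Arguments delay_transform {R} lambda mu theta l.

(** * Summation over the observations and over the attacks *)

Section clock_series.
Context {R : realType}.
Variables (lambda mu : R) (theta : R[i]).
Hypotheses (lambda_gt0 : 0 < lambda) (mu_gt0 : 0 < mu) (theta_ge0 : 0 <= Re theta).
Local Notation lam := (lambda%:C : R[i]).
Local Notation e := (delay_transform lambda mu theta).

Let s : R[i] := lam + theta.
Let kappa : R[i] := lam + theta + mu%:C.

Let Re_s : 0 < Re s.
Proof. by rewrite /s complexReD ltr_wpDr. Qed.

Let s_neq0 : s != 0. Proof. exact: Re_gt0_neq0. Qed.

Let Re_kappa : lambda + mu <= Re kappa.
Proof. by rewrite /kappa !complexReD /= addrAC lerDl. Qed.

Let kappa_neq0 : kappa != 0.
Proof. by apply: Re_gt0_neq0; apply: lt_le_trans Re_kappa; rewrite addr_gt0. Qed.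

(** The transform at 1/2 of the number of attacks during one delay. *)
Definition decay_rate : R := mu / (mu + lambda / 2).

Lemma decay_rate_itv : 0 <= decay_rate < 1.
Proof.
have h : 0 < mu + lambda / 2 by rewrite addr_gt0 ?divr_gt0.
by rewrite /decay_rate divr_ge0 ?ltW//= ltr_pdivrMr// mul1r ltrDl divr_gt0.
Qed.

Let absC_e l : absC (e l) <= mu * lambda ^+ l / (lambda + mu) ^+ l.+1.
Proof.
rewrite /delay_transform !absCM absCV !absCX !absC_real.
rewrite (ger0_norm (ltW mu_gt0)) (ger0_norm (ltW lambda_gt0)).
apply: ler_pM => //.
- by rewrite mulr_ge0 ?exprn_ge0 ?ltW.
- by rewrite invr_ge0 exprn_ge0 ?absC_ge0.
have h : 0 < lambda + mu by rewrite addr_gt0.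
have k0 : lambda + mu <= absC kappa.
  by apply: le_trans Re_kappa _; apply: le_trans (Re_le_absC _); exact: ler_norm.
rewrite lef_pV2 ?posrE ?exprn_gt0//; last exact: lt_le_trans k0.
by rewrite lerXn2r// nnegrE ltW// (lt_le_trans h).
Qed.

Let sum_e i : \sum_(j < i.+1) (2 ^- (i - j)) * absC (e (i - j)) <= decay_rate.
Proof.
have -> : \sum_(j < i.+1) (2 ^- (i - j)) * absC (e (i - j)) =
    \sum_(l < i.+1) 2 ^- l * absC (e l).
  by rewrite (reindex_inj rev_ord_inj) /=; apply: eq_bigr => j _; rewrite subSS subKn// -ltnS.
have h : 0 < lambda + mu by rewrite addr_gt0.
pose y := lambda / (2 * (lambda + mu)).
have y1 : 0 < 1 - y.
  rewrite subr_gt0 /y ltr_pdivrMr ?mulr_gt0// mul1r.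
  by rewrite mulrDr -[X in X < _]addr0 ltr_leD ?mulr_ge0 ?ltW// ltr_pMl// ltr1n.
apply: (@le_trans _ _ (\sum_(l < i.+1) mu / (lambda + mu) * y ^+ l)).
  apply: ler_sum => l _; apply: (@le_trans _ _
      (2 ^- l * (mu * lambda ^+ l / (lambda + mu) ^+ l.+1))).
    by rewrite ler_wpM2l// invr_ge0 exprn_ge0.
  rewrite /y expr_div_n exprMn exprS le_eqVlt; apply/orP; left; apply/eqP.
  by field; rewrite !gt_eqF ?exprn_gt0.
rewrite -mulr_sumr.
have -> : decay_rate = mu / (lambda + mu) * (1 - y)^-1.
  rewrite /decay_rate /y; field.
  have d0 : 0 < 2 * (lambda + mu) - lambda by move: lambda_gt0 mu_gt0; lra.
  by rewrite (gt_eqF h) (gt_eqF d0).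
rewrite ler_wpM2l ?divr_ge0 ?(ltW mu_gt0) ?(ltW h)//.
rewrite -[leRHS]mul1r ler_pdivlMr// mulrC.
have -> : (1 - y) * \sum_(l < i.+1) y ^+ l = 1 - y ^+ i.+1.
  by have := subrX1 y i.+1; rewrite -[y - 1]opprB -[y ^+ _ - 1]opprB mulNr => /oppr_inj.
by rewrite gerBl exprn_ge0// /y divr_ge0 ?mulr_ge0 ?(ltW h) ?(ltW lambda_gt0).
Qed.

(** Convolution with [e] contracts the weighted norm [sup_i |x i| / 2^i]. *)
Lemma convolution_decay (x : nat -> nat -> R[i]) (c : R) :
  (forall k i, x k.+1 i = \sum_(j < i.+1) x k j * e (i - j)) ->
  (forall i, absC (x 0%N i) <= c * 2 ^+ i) ->
  forall k i, absC (x k i) <= c * 2 ^+ i * decay_rate ^+ k.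
Proof.
move=> xS x0 k; elim: k => [|k IH] i; first by rewrite expr0 mulr1.
rewrite xS (le_trans (absC_sum _ _ _))//.
have c0 : 0 <= c by have := le_trans (absC_ge0 _) (x0 0%N); rewrite expr0 mulr1.
have [r0 _] := andP decay_rate_itv.
apply: (@le_trans _ _ (\sum_(j < i.+1) (c * 2 ^+ i * decay_rate ^+ k)
    * (2 ^- (i - j) * absC (e (i - j))))).
  apply: ler_sum => j _; rewrite absCM.
  have -> : c * 2 ^+ i * decay_rate ^+ k * (2 ^- (i - j) * absC (e (i - j))) =
      (c * 2 ^+ j * decay_rate ^+ k) * absC (e (i - j)).
    have ji : (j <= i)%N by rewrite -ltnS.
    have <- : 2 ^+ (i - j) * 2 ^+ j = 2 ^+ i :> R by rewrite -exprD subnK.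
    by field; rewrite expf_neq0.
  by rewrite ler_wpM2r ?absC_ge0.
rewrite -mulr_sumr exprSr mulrA ler_wpM2l// ?sum_e//.
by rewrite !mulr_ge0 ?exprn_ge0.
Qed.

(** [clock_total i] is the sum over [k] of the clock transforms at count [i]:
    the potential of a Poisson process of rate [mu], atom at time 0 included. *)
Definition clock_total (i : nat) : R[i] :=
  (i == 0%N)%:R + mu%:C / s * (lam / s) ^+ i.

Let clock_totalE i :
  clock_total i = (i == 0%N)%:R + \sum_(j < i.+1) clock_total j * e (i - j).
Proof.
rewrite /clock_total; congr (_ + _).
under eq_bigr do rewrite mulrDl.
rewrite big_split /= big_ord_recl /= mul1r subn0 big1 ?addr0; last first.
  by move=> j _; rewrite mul0r.
rewrite /delay_transform -/kappa.
pose A := s^-1; pose B := kappa^-1.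
have AB : A - B = mu%:C * A * B.
  rewrite /A /B; have -> : kappa = s + mu%:C by [].
  by field; apply/andP; split; [exact: kappa_neq0|exact: s_neq0].
have pw := subrXX A B i.+1.
have -> : \sum_(j < i.+1) mu%:C / s * (lam / s) ^+ j
    * (mu%:C * lam ^+ (i - j) / kappa ^+ (i - j).+1) =
    mu%:C * lam ^+ i * ((A - B) * \sum_(j < i.+1) A ^+ (i.+1.-1 - j) * B ^+ j).
  rewrite AB (reindex_inj rev_ord_inj) /= !mulr_sumr; apply: eq_bigr => j _.
  have ji : (j <= i)%N by rewrite -ltnS.
  rewrite subSS subKn// !exprMn.
  have <- : lam ^+ (i - j) * lam ^+ j = lam ^+ i by rewrite -exprD subnK.
  by rewrite -exprVn exprS -/A -/B; ring.
by rewrite -pw -exprVn -/A -/B exprMn -/A !exprS; ring.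
Qed.

Lemma clock_total_bound i : absC (clock_total i) <= (1 + mu / lambda) * 2 ^+ i.
Proof.
have l_s : lambda <= absC s.
  apply: le_trans (Re_le_absC s); apply: le_trans (ler_norm _).
  by rewrite /s complexReD lerDl.
have s0 : 0 < absC s by apply: lt_le_trans l_s.
have p2 : 1 <= 2 ^+ i :> R by rewrite exprn_ege1// ler1n.
apply: (@le_trans _ _ (1 + mu / lambda)); last first.
  by rewrite ler_peMr// addr_ge0// divr_ge0 ?(ltW mu_gt0) ?(ltW lambda_gt0).
rewrite (le_trans (absCD _ _))// lerD//.
  by rewrite absC_bool; case: (_ == _).
rewrite !absCM absCX absCM absCV !absC_real (ger0_norm (ltW mu_gt0)) (ger0_norm (ltW lambda_gt0)).
rewrite -[leRHS]mulr1; apply: ler_pM.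
- by rewrite mulr_ge0 ?invr_ge0 ?(ltW mu_gt0) ?(ltW s0).
- by rewrite exprn_ge0// mulr_ge0 ?invr_ge0 ?(ltW lambda_gt0) ?(ltW s0).
- by rewrite ler_wpM2l ?(ltW mu_gt0)// lef_pV2.
rewrite exprn_ile1 ?mulr_ge0 ?invr_ge0 ?(ltW lambda_gt0) ?(ltW s0)//.
by rewrite ler_pdivrMr// mul1r.
Qed.

(** Both [clock_total] and the partial sums of [c] satisfy the same convolution
    equation, so that the error is convolved once more in each step. *)
Lemma clock_total_limit (c : nat -> nat -> R[i]) :
  (forall i, c 0%N i = (i == 0%N)%:R) ->
  (forall k i, c k.+1 i = \sum_(j < i.+1) c k j * e (i - j)) ->
  forall m i, absC (clock_total i - \sum_(k < m) c k i) <=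
    (1 + mu / lambda) * 2 ^+ i * decay_rate ^+ m.
Proof.
move=> c0 cS; apply: (@convolution_decay
  (fun m i => clock_total i - \sum_(k < m) c k i)) => [m i|i]; last first.
  by rewrite big_ord0 subr0 clock_total_bound.
under [RHS]eq_bigr do rewrite mulrBl.
rewrite sumrB [clock_total i in LHS]clock_totalE [X in _ - X]big_ord_recl /= c0.
rewrite opprD addrACA subrr add0r.
congr (_ - _).
under [LHS]eq_bigr do rewrite cS.
by rewrite exchange_big /=; apply: eq_bigr => j _; rewrite mulr_suml.
Qed.

End clock_series.

Section node_renewal.
Context {R : realType}.
Variables (a : R) (x : R[i]).
Local Notation b := ((1 - a)%:C : R[i]).
Local Notation pmf r := ((@node_pmf R a r)%:C : R[i]).

(** Renewal sum of geometric node numbers weighted by [x] per attack. *)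
Definition node_renewal (r : nat) : R[i] :=
  if r is r'.+1 then a%:C * x * (b + a%:C * x) ^+ r' else 1.

Lemma node_renewalE r :
  node_renewal r = (r == 0%N)%:R + x * \sum_(j < r.+1) node_renewal (r - j) * pmf j.
Proof.
case: r => [|r].
  by rewrite big_ord_recl big_ord0 /= mulr0 addr0 mulr0 addr0.
rewrite add0r big_ord_recl /= mulr0 add0r big_ord_recr /= subSS subnn mul1r.
have sumE : \sum_(j < r) node_renewal (r.+1 - lift ord0 (widen_ord (leqnSn r) j))
      * pmf (lift ord0 (widen_ord (leqnSn r) j)) =
    a%:C * (((b + a%:C * x) - b) * \sum_(j < r) (b + a%:C * x) ^+ (r.-1 - j) * b ^+ j).
  rewrite !mulr_sumr; apply: eq_bigr => j _; rewrite lift0 /= subSS.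
  have -> : (r - j = (r.-1 - j).+1)%N.
    by have := ltn_ord j; lia.
  by rewrite /= rmorphM rmorphXn /=; ring.
rewrite [X in x * (X + _)](_ : _ = a%:C * (((b + a%:C * x) - b)
    * \sum_(j < r) (b + a%:C * x) ^+ (r.-1 - j) * b ^+ j)) -?subrXX; last first.
  by rewrite subrXX -sumE.
by rewrite /bump /= rmorphM rmorphXn /=; ring.
Qed.

(** With [q i] the law of the number of nodes lost in [i] attacks, conditioning
    on the last attack gives the recursion of [node_renewal]. Attacks take at
    least one node, so that fewer than [m] attacks matter for [r < m]. *)
Lemma sum_node_renewal (q : nat -> nat -> R[i]) :
  (forall r, q 0%N r = (r == 0%N)%:R) ->
  (forall i r, q i.+1 r = \sum_(j < r.+1) q i (r - j)%N * pmf j) ->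
  forall m r, (r < m)%N -> \sum_(i < m) x ^+ i * q i r = node_renewal r.
Proof.
move=> q0 qS; elim=> // m IH r rm.
rewrite big_ord_recl expr0 mul1r q0 node_renewalE; congr (_ + _).
under eq_bigr do rewrite lift0 qS mulr_sumr.
rewrite exchange_big mulr_sumr /=; apply: eq_bigr => -[[|j] jr] _ /=.
  by rewrite mulr0 mulr0 big1// => i _; rewrite !mulr0.
rewrite -IH; last by lia.
by rewrite mulr_suml mulr_sumr; apply: eq_bigr => i _; rewrite exprS; ring.
Qed.

End node_renewal.

Section closed_form.
Context {R : realType}.
Implicit Types (D xi u E V : R[i]).

(** By induction on [m]: the increments of the right-hand side are the terms of
    the sum. *)
Lemma sum_gamma_transform D xi u E V m : u != 0 -> u - D * xi != 0 ->
  \sum_(r < m.+1) D ^+ r * ((xi / u) ^+ r * (1 - E * exp_poly (u * V) r)) =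
  u / (u - D * xi)
  - (D * xi) ^+ m.+1 * (1 - E * exp_poly (u * V) m) / ((u - D * xi) * u ^+ m)
  - D * xi * E * exp_poly (D * xi * V) m / (u - D * xi).
Proof.
move=> u0 d0; elim: m => [|m IH].
  rewrite big_ord_recl big_ord0 /exp_poly !big_ord0 /=; field.
  by rewrite d0.
rewrite big_ord_recr IH /= /exp_poly !(big_ord_recr m) /= -!/(exp_poly _ _).
rewrite expr_div_n !exprS !exprMn; field.
rewrite d0 u0 expf_neq0//= pnatr_eq0 -lt0n fact_gt0.
by [].
Qed.

End closed_form.

(** * The observed process *)

Section covers.
Context {d d' : measure_display} {T : measurableType d} {T' : measurableType d'}.

Lemma measurable_fun_cover (B : (set T)^nat) (f g : T -> T') (F : nat -> T -> T') :
  (forall m, measurable (B m)) -> (forall m, measurable_fun setT (F m)) ->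
  measurable_fun setT g -> (forall m w, B m w -> f w = F m w) ->
  (forall w, (forall m, ~ B m w) -> f w = g w) -> measurable_fun setT f.
Proof.
move=> mB mF mg fF fg _ A mA; rewrite setTI.
have -> : f @^-1` A =
    \bigcup_m (B m `&` F m @^-1` A) `|` (~` (\bigcup_m B m) `&` g @^-1` A).
  apply/seteqP; split => [w /= Aw|w [[m _ [Bm Am]]|[nB Aw]]] /=.
  - have [[m Bm]|nB] := pselect (exists m, B m w).
      by left; exists m => //; split => //=; rewrite -fF.
    right; split; first by move=> [m _ Bm]; apply: nB; exists m.
    by rewrite /= -fg// => m Bm; apply: nB; exists m.
  - by rewrite (fF m).
  - by rewrite fg// => m Bm; apply: nB; exists m.
apply: measurableU; last apply: measurableI.
- by apply: bigcup_measurable => m _; apply: measurableI => //;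
    rewrite -[X in measurable X]setTI; exact: mF.
- by apply: measurableC; exact: bigcup_measurable.
- by rewrite -[X in measurable X]setTI; exact: mg.
Qed.

Variables (idx : T') (op : Monoid.com_law idx) (F : nat -> T -> T').
Hypothesis m_idx : measurable [set idx].
Hypothesis mF : forall l, measurable_fun setT (F l).
Hypothesis m_sum : forall m, measurable_fun setT (fun w => \big[op/idx]_(0 <= l < m) F l w).

(** The sum stops at any bound of its support; when the support is infinite it
    takes the default value [idx]. *)
Lemma measurable_fsbig_nat :
  measurable_fun setT (fun w => \big[op/idx]_(l \in [set: nat]) F l w).
Proof.
pose B m := [set w | forall l, (m <= l)%N -> F l w = idx].
apply: (@measurable_fun_cover B _ (fun=> idx)
  (fun m w => \big[op/idx]_(0 <= l < m) F l w)) => //.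
- move=> m; have -> : B m = \bigcap_(l in [set l | (m <= l)%N]) (F l @^-1` [set idx]).
    by apply/seteqP; split => w Bw l; [exact: Bw|move=> ml; exact: (Bw l ml)].
  by apply: bigcap_measurableType => l _; rewrite -[X in measurable X]setTI; exact: mF.
- move=> m w Bm; rewrite (fsbigE (index_iota 0 m)) ?iota_uniq//.
    by apply: eq_bigl => l; rewrite in_setT.
  by move=> l _; rewrite mem_index_iota /= -leqNgt => /Bm.
- move=> w nB; apply: fsbig_dflt => fin; set A := (X in finite_set X) in fin.
  apply: (nB (\max_(l <- fset_set A) l).+1) => l lm; apply: contrapT => Fl.
  have lA : l \in fset_set A by rewrite in_fset_set// inE; split.
  by move: lm; rewrite ltnNge (@leq_bigmax_seq _ _ xpredT id l lA isT).
Qed.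

End covers.

Section observed_process.
Context {d : measure_display} {T : measurableType d} {R : realType}.
Context {P : probability T R} {n : nat} {lambda mu xi a : R}.
Variable S : network_attack P n lambda mu xi a.

Lemma measurable_tau k : measurable_fun setT (tau S k).
Proof.
have mT : (@measurable _ T) `<=` measurable by [].
apply: (@measurable_wrtW _ _ (families S [:: 4]%N)).
  exact: families_measurable.
by apply: measurable_wrt_tau => l _; exact: measurable_delay.
Qed.

Lemma measurable_count_tau k i : measurable [set w | attack_count S (tau S k w) i w].
Proof.
have mt := measurable_tau k.
rewrite -[X in measurable X]setTI.
have mb : measurable_fun setT (fun w => attack_count S (tau S k w) i w).
  apply: measurable_and; last exact: measurable_fun_ltr.
  by apply: measurable_or; [exact: measurable_cst|exact: measurable_fun_ler].
exact: (mb measurableT [set true]).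
Qed.

Lemma attacks_upto_all s w : (forall i, ~ attack_count S s i w) ->
  attacks_upto S s w = setT.
Proof.
move=> nc; apply/seteqP; split => // k _.
by have [[i /nc//]|] := attack_count_total S s w; apply.
Qed.

(** On the negligible event of infinitely many attacks up to [tau k] the sum
    ranges over all attacks. *)
Lemma measurable_observed_sum d' (T' : measurableType d') (idx : T')
    (op : Monoid.com_law idx) (F : nat -> T -> T') k :
  measurable [set idx] -> (forall l, measurable_fun setT (F l)) ->
  (forall m, measurable_fun setT (fun w => \big[op/idx]_(0 <= l < m) F l w)) ->
  measurable_fun setT
    (fun w => \big[op/idx]_(l \in attacks_upto S (tau S k w) w) F l w).
Proof.
move=> m_idx mF m_sum; apply: (measurable_fun_cover (measurable_count_tau k) m_sum
  (measurable_fsbig_nat m_idx mF m_sum)) => [i w cw|w nc] /=.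
  by rewrite (attacks_upto_count cw) -fsbig_ord big_mkord.
by rewrite attacks_upto_all.
Qed.

Lemma measurable_node_total (g : nat * nat -> T -> R) l :
  (forall y, measurable_fun setT (g y)) ->
  measurable_fun setT (fun w => \sum_(j < nodes S l w) g (l, j : nat) w).
Proof.
move=> mg; apply: (@measurable_fun_random_index _ _ _ _ (nodes S l)
  (fun m w => \sum_(j < m) g (l, j : nat) w)) => // m.
exact: measurable_sum.
Qed.

Lemma measurable_attack_total (g : nat * nat -> T -> R) k :
  (forall y, measurable_fun setT (g y)) ->
  measurable_fun setT (fun w => \sum_(l \in attacks_upto S (tau S k w) w)
    \sum_(j < nodes S l w) g (l, j : nat) w).
Proof.
move=> mg; apply: measurable_observed_sum => // [l|m].
  exact: measurable_node_total.
by apply: measurable_sum => l; exact: measurable_node_total.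
Qed.

Lemma measurable_total_nodes k :
  measurable_fun setT (fun w => total_nodes S (tau S k w) w).
Proof.
apply: measurable_observed_sum => // m.
apply: (@measurable_wrtW _ _ (families S [:: 1]%N)).
  exact: families_measurable.
by apply: measurable_wrt_node_sum => l _; exact: measurable_nodes.
Qed.

Lemma measurable_total_weight k :
  measurable_fun setT (fun w => total_weight S (tau S k w) w).
Proof. exact: (measurable_attack_total (g := fun y w => weight S y.1 y.2 w)). Qed.

Lemma measurable_total_passive k (i : 'I_n) :
  measurable_fun setT (fun w => tnth (total_passive S (tau S k w) w) i).
Proof.
under eq_fun do rewrite tnth_mktuple.
apply: (measurable_attack_total (g := fun y w => tnth (passive S y.1 y.2 w) i)) => y.
exact: (measurableT_comp (measurable_tnth i)).
Qed.

Lemma measurableC_state z v theta beta k :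
  cmeasurable (state_transform S z v theta beta k).
Proof.
have mr (f : T -> R) c : measurable_fun setT f ->
    cmeasurable (fun w => expC (- c * (f w)%:C)).
  move=> mf; apply: measurableC_exp; apply: measurableCM; first exact: measurableC_cst.
  exact: measurableC_real.
apply: measurableCM; first apply: measurableCM; first apply: measurableCM.
- exact: (measurableC_comp (measurable_total_nodes k) (measurableC_nat (fun r => z ^+ r))).
- exact/mr/measurable_total_weight.
- exact/mr/measurable_tau.
apply: measurableC_exp; apply: measurableC_sum => i; apply: measurableCM.
  exact: measurableC_cst.
exact/measurableC_real/measurable_total_passive.
Qed.

Lemma measurable_passed M V k : measurable [set w | passed S M V k w].
Proof.
have -> : [set w | passed S M V k w] =
    ~` ((fun w => total_nodes S (tau S k w) w) @^-1` [set r | (r < M)%N] `&`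
        (fun w => total_weight S (tau S k w) w) @^-1` `[0, V[%classic).
  apply/seteqP; split => w pw; apply: contra_not pw => -[Nw Ww].
    by split=> //; move: Ww; rewrite /= in_itv.
  by split=> //; rewrite /= in_itv.
apply/measurableC/measurableI; rewrite -[X in measurable X]setTI.
  exact: measurable_total_nodes.
exact: measurable_total_weight.
Qed.

Lemma measurable_rho M V : measurable_fun setT (rho S M V).
Proof.
pose B k := [set w | passed S M V k w /\ forall j, (j < k)%N -> ~ passed S M V j w].
apply: (@measurable_fun_cover _ _ _ _ B _ (fun=> 0%N) (fun k _ => k)) => //.
- move=> k; have -> : B k = [set w | passed S M V k w] `&`
      \bigcap_(j in [set j | (j < k)%N]) ~` [set w | passed S M V j w].
    by apply/seteqP; split => w [pw nw]; split => // j jk; exact: nw.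
  apply: measurableI; first exact: measurable_passed.
  by apply: bigcap_measurableType => j _; apply: measurableC; exact: measurable_passed.
- move=> k w [pk nk]; rewrite /rho; case: xgetP => [m _ [pm nm]|nx]; last first.
    by have := nx k; case.
  by case: (ltngtP m k) => // [/nk//|/nm].
- by move=> w nB; rewrite /rho; case: xgetP => // m _ Bm; case: (nB m).
Qed.

End observed_process.

(** * One observation step *)

Section observed_state.
Context {d : measure_display} {T : measurableType d} {R : realType}.
Context {P : probability T R} {n : nat} {lambda mu xi a : R}.
Variable S : network_attack P n lambda mu xi a.
Variables (M : nat) (V : R).
Implicit Types (z v theta : R[i]) (beta : n.-tuple R[i]).

Definition inside (i : nat) (w : T) : bool :=
  (node_sum S 0 i w < M)%N &&
  (\sum_(y <- slots 0 i (nodes S ^~ w)) weight S y.1 y.2 w < V).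

Lemma total_nodes_count k i w : attack_count S (tau S k w) i w ->
  total_nodes S (tau S k w) w = node_sum S 0 i w.
Proof.
by move=> cw; rewrite /total_nodes (attacks_upto_count cw) -fsbig_ord /node_sum big_mkord.
Qed.

Let slots_total (F : nat * nat -> R) i w :
  \sum_(l \in `I_i) \sum_(j < nodes S l w) F (l, j : nat) =
  \sum_(y <- slots 0 i (nodes S ^~ w)) F y.
Proof.
rewrite -fsbig_ord big_slots big_mkord; apply: eq_bigr => l _.
by rewrite big_mkord.
Qed.

Lemma total_weight_count k i w : attack_count S (tau S k w) i w ->
  total_weight S (tau S k w) w =
  \sum_(y <- slots 0 i (nodes S ^~ w)) weight S y.1 y.2 w.
Proof.
move=> cw; rewrite /total_weight (attacks_upto_count cw).
exact: (slots_total (fun y => weight S y.1 y.2 w)).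
Qed.

Lemma dotC_total_passive beta k i w : attack_count S (tau S k w) i w ->
  dotC beta (total_passive S (tau S k w) w) =
  \sum_(y <- slots 0 i (nodes S ^~ w)) dotC beta (passive S y.1 y.2 w).
Proof.
move=> cw; rewrite /dotC exchange_big /=; apply: eq_bigr => m _.
rewrite tnth_mktuple (attacks_upto_count cw).
rewrite (slots_total (fun y => tnth (passive S y.1 y.2 w) m)).
by rewrite raddf_sum mulr_sumr.
Qed.

Lemma state_transform_count z v theta beta k i w :
  attack_count S (tau S k w) i w ->
  state_transform S z v theta beta k w =
  \prod_(y <- slots 0 i (nodes S ^~ w)) node_mark S z v beta y w *
  expC (- theta * (tau S k w)%:C).
Proof.
move=> cw; rewrite /state_transform (total_nodes_count cw) (total_weight_count cw).
rewrite (dotC_total_passive beta cw) expC_sum raddf_sum mulr_sumr expC_sum.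
by rewrite /node_mark !big_split /= prodr_const_seq size_slots; ring.
Qed.

Lemma frozen_marks_diag z v beta i j w : (i <= j)%N ->
  frozen_marks S M V z v beta i j w w =
  (inside i w)%:R * \prod_(y <- slots 0 j (nodes S ^~ w)) node_mark S z v beta y w.
Proof.
move=> ij; rewrite /frozen_marks /inside mulrA -natrM mulnb; congr (_ * _).
exact/esym/perm_big/slots_cat.
Qed.

(** Positive weights leave only the upper threshold to be tested. *)
Lemma passed_count k i w : (forall l j, 0 < weight S l j w) ->
  attack_count S (tau S k w) i w -> passed S M V k w <-> ~~ inside i w.
Proof.
move=> w0 cw; rewrite /passed (total_nodes_count cw) (total_weight_count cw) /inside.
rewrite sumr_ge0 ?andTb; last by move=> y _; exact: ltW.
split => [np|/negP np [h1 h2]]; last by apply: np; rewrite h1 h2.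
by apply/negP => /andP[h1 h2]; apply: np.
Qed.

Lemma absC_state_transform z v theta beta k w :
  (absC (state_transform S z v theta beta k w))%:C =
  state_transform S (modulus z) (real_part v) (real_part theta) (real_parts beta) k w.
Proof.
rewrite /state_transform !absCM !complex_realM; congr (_ * _ * _ * _).
- by rewrite absCX; exact: rmorphXn.
- exact: absC_exp_real_part.
- exact: absC_exp_real_part.
- by rewrite absC_expC Re_dotC dotC_real_parts -expC_real.
Qed.

Let measurable_nodes_slots_sum i :
  measurable_fun setT (fun w => \sum_(y <- slots 0 i (nodes S ^~ w)) weight S y.1 y.2 w).
Proof.
under eq_fun do rewrite big_slots big_mkord.
apply: measurable_sum => l; under eq_fun do rewrite big_mkord.
exact: (measurable_node_total S (g := fun y w => weight S y.1 y.2 w)).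
Qed.

Lemma measurable_inside i : measurable_fun setT (inside i).
Proof.
apply: measurable_and; last exact: measurable_fun_ltr.
have mN : measurable_fun setT (node_sum S 0 i).
  apply: (@measurable_wrtW _ _ (families S [:: 1]%N)); first exact: families_measurable.
  by apply: measurable_wrt_node_sum => l _; exact: measurable_nodes.
exact: (@measurableT_comp _ _ _ _ _ _ (fun r => (r < M)%N) _ (node_sum S 0 i)).
Qed.

End observed_state.

Section observation_step.
Context {d : measure_display} {T : measurableType d} {R : realType}.
Context {P : probability T R} {n : nat} {lambda mu xi a : R}.
Variable S : network_attack P n lambda mu xi a.
Variables (M : nat) (V : R).
Hypotheses (lambda_gt0 : 0 < lambda) (mu_gt0 : 0 < mu) (xi_gt0 : 0 < xi).
Hypotheses (a_gt0 : 0 < a) (a_lt1 : a < 1) (M_gt0 : (0 < M)%N) (V_gt0 : 0 < V).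
Implicit Types (z v theta : R[i]) (beta : n.-tuple R[i]).

(** The conditions under which all transforms of marks converge absolutely;
    they are inherited by the moduli and real parts of the arguments. *)
Definition summable_marks z v beta : Prop :=
  [/\ 0 <= Re v, integrableC P (passive_exp S beta (0, 0)%N),
      integrableC P (fun w =>
        node_factor S (modulus z) (real_part v) (real_parts beta) ^+ nodes S 0 w) &
      integrableC P (fun w => node_factor S z v beta ^+ nodes S 0 w)].

Definition box_mean z v beta i : R[i] :=
  expectationC P (box_transform S M V z v beta i).

Definition attack_factor z v beta : R[i] :=
  expectationC P (fun w => node_factor S z v beta ^+ nodes S 0 w).

Definition inside_at (k i : nat) (w : T) : bool :=
  attack_count S (tau S k w) i w && inside S M V i w.

Lemma summable_marks_abs z v beta : summable_marks z v beta ->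
  summable_marks (modulus z) (real_part v) (real_parts beta).
Proof.
have mm : modulus (modulus z) = modulus z.
  by rewrite /modulus absC_real ger0_norm// absC_ge0.
have rr : real_part (real_part v) = real_part v by [].
have bb : real_parts (real_parts beta) = real_parts beta.
  by apply: eq_from_tnth => i; rewrite !tnth_map.
case=> v0 ip iq _; split; rewrite ?mm ?rr ?bb//.
by apply: (integrableC_abs ip) => w; exact: absC_passive_exp.
Qed.

Let marks := families S [:: 1; 2; 3]%N.
Let clock := families S [:: 0; 4]%N.

Let measurable_marks z v beta i j :
  measurableC_wrt marks (fun w => frozen_marks S M V z v beta i j w w).
Proof.
have mf : @cmeasurable _ (g_sigma_algebraType marks * g_sigma_algebraType marks)%type R
    (fun u => frozen_marks S M V z v beta i j u.1 u.2).
  apply: measurableC_frozen_marks.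
  - by move=> l; exact: measurable_nodes.
  - by move=> y; exact: measurable_weight.
  - by move=> y; exact: measurable_passive.
apply: (@measurableC_comp _ _ _ _ (g_sigma_algebraType marks)
  (fun w => (w, w)) (fun u => frozen_marks S M V z v beta i j u.1 u.2)) => //.
exact: measurable_fun_pair.
Qed.

Let mtau k : measurable_wrt clock (tau S k).
Proof. by apply: measurable_wrt_tau => l _; exact: measurable_delay. Qed.

Let mcount k i : measurable_wrt clock (fun w => attack_count S (tau S k w) i w).
Proof.
have mt : measurable_fun (setT : set (g_sigma_algebraType clock)) (tau S k) := mtau k.
have ma l : measurable_fun (setT : set (g_sigma_algebraType clock)) (attack_time S l).
  exact: measurable_attack_time.
apply: measurable_and; last exact: measurable_fun_ltr.
by apply: measurable_or; [exact: measurable_cst|exact: measurable_fun_ler].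
Qed.

Let measurable_clock theta k (b : T -> bool) : measurable_wrt clock b ->
  measurableC_wrt clock (fun w => expC (- theta * (tau S k w)%:C) * (b w)%:R).
Proof.
move=> mb; apply: measurableCM; last exact: measurableC_bool.
apply: measurableC_exp; apply: measurableCM; first exact: measurableC_cst.
by apply: measurableC_real; exact: (mtau k).
Qed.

Let indep_marks_clock : indep_systems P marks clock.
Proof. by apply: indep_families => x; rewrite !inE => /or3P[] /eqP ->. Qed.

Let marks_clock z v theta beta k i j (b : T -> bool) :
  summable_marks z v beta -> (i <= j)%N -> measurable_wrt clock b ->
  integrableC P (fun w => expC (- theta * (tau S k w)%:C) * (b w)%:R) ->
  let f w := frozen_marks S M V z v beta i j w w
             * (expC (- theta * (tau S k w)%:C) * (b w)%:R) in
  integrableC P f /\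
  expectationC P f = box_mean z v beta i * attack_factor z v beta ^+ (j - i)
    * expectationC P (fun w => expC (- theta * (tau S k w)%:C) * (b w)%:R).
Proof.
case=> v0 ip iqa iq ij mb ib /=.
have [im Em] := expectationC_marks xi_gt0 a_gt0 a_lt1 M V_gt0 v0 ip iqa iq ij.
have [iu ->] := expectationC_indepM (@families_measurable _ _ _ _ _ _ _ _ _ S _)
  (@families_measurable _ _ _ _ _ _ _ _ _ S _) indep_marks_clock
  (measurable_marks z v beta i j) (measurable_clock theta k mb) im ib.
by split; rewrite ?Em.
Qed.

(** On the event of [i] and then [i + l] attacks the state splits into a factor
    that depends on the marks and a factor that depends on attack times and
    delays; the two are independent. *)
Lemma expectationC_step z v theta beta k i l :
  summable_marks z v beta -> 0 <= Re theta ->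
  let f w := state_transform S z v theta beta k.+1 w *
    (inside_at k i w && attack_count S (tau S k.+1 w) (i + l) w)%:R in
  integrableC P f /\
  expectationC P f = box_mean z v beta i * attack_factor z v beta ^+ l *
    (clock_transform S theta k i * delay_transform lambda mu theta l).
Proof.
move=> sm t0 /=; have il := leq_addr l i.
have [ib Eb] := expectationC_clock_step S lambda_gt0 mu_gt0 t0 k il.
have mb : measurable_wrt clock (fun w => attack_count S (tau S k w) i w
    && attack_count S (tau S k.+1 w) (i + l) w) by apply: measurable_and; exact: (mcount _ _).
have := marks_clock sm il mb ib; rewrite Eb addKn /= => mc.
rewrite [X in integrableC P X /\ expectationC P X = _](_ : _ = fun w =>
  frozen_marks S M V z v beta i (i + l) w w * (expC (- theta * (tau S k.+1 w)%:C) *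
  (attack_count S (tau S k w) i w && attack_count S (tau S k.+1 w) (i + l) w)%:R))//.
apply/funext => w; rewrite /inside_at frozen_marks_diag//.
have [c1|_] := boolP (attack_count S (tau S k.+1 w) _ w); last first.
  by rewrite !andbF !mulr0.
rewrite (state_transform_count z v theta beta c1) !andbT.
case: (attack_count _ _ _ _); last by rewrite !mulr0.
by rewrite mulr1 /= mulrC mulrA.
Qed.

Lemma expectationC_inside_at z v theta beta k i :
  summable_marks z v beta -> 0 <= Re theta ->
  let f w := state_transform S z v theta beta k w * (inside_at k i w)%:R in
  integrableC P f /\
  expectationC P f = box_mean z v beta i * clock_transform S theta k i.
Proof.
move=> sm t0 /=.
have ib := integrableC_clock S t0 k i.
have := marks_clock sm (leqnn i) (mcount k i) ib; rewrite subnn expr0 mulr1 /= => mc.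
rewrite [X in integrableC P X /\ expectationC P X = _](_ : _ = fun w =>
  frozen_marks S M V z v beta i i w w * (expC (- theta * (tau S k w)%:C) *
  (attack_count S (tau S k w) i w)%:R))//.
apply/funext => w; rewrite /inside_at frozen_marks_diag//.
have [c1|_] := boolP (attack_count S (tau S k w) _ w); last by rewrite !mulr0.
by rewrite (state_transform_count z v theta beta c1) mulr1 /= mulrC mulrA.
Qed.

End observation_step.

Section scaled_partition.
Context {d : measure_display} {T : measurableType d} {R : realType}.
Variables (P : probability T R).

Variables (B B' : (set T)^nat).
Hypotheses (mB : forall k, measurable (B k)) (tB : trivIset setT B).
Hypothesis covB : {ae P, forall w, exists k, B k w}.
Hypotheses (mB' : forall k, measurable (B' k)) (tB' : trivIset setT B').
Hypothesis covB' : {ae P, forall w, exists k, B' k w}.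

(** The moduli decide integrability by monotone convergence; the partial sums of
    the expectations over the pieces then converge to the expectations. *)
Lemma expectationC_scaled_partition (f g : T -> R[i]) (c : R[i]) (r : R) :
  cmeasurable f -> integrableC P g ->
  (forall l, (\int[P]_w (absC (f w * (\1_(B l) w)%:C))%:E =
              r%:E * \int[P]_w (absC (g w * (\1_(B' l) w)%:C))%:E)%E) ->
  (forall l, expectationC P (fun w => f w * (\1_(B l) w)%:C) =
             c * expectationC P (fun w => g w * (\1_(B' l) w)%:C)) ->
  integrableC P f /\ expectationC P f = c * expectationC P g.
Proof.
move=> mf gi fgabs fg; have [mg gfin] := (integrableC_absP P g).1 gi.
have fi : integrableC P f.
  apply/integrableC_absP; split => //.
  rewrite (integral_absC_partition mB tB covB)//.
  under eq_eseriesr do rewrite fgabs.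
  rewrite nneseriesZl; last first.
    by move=> l _; apply: integral_ge0 => w _; rewrite lee_fin absC_ge0.
  rewrite -(integral_absC_partition mB' tB' covB')// integral_absC//.
  by rewrite -EFinM ltry.
split => //; have [cR cI] := expectationC_partition mB tB covB fi.
have [gR gI] := expectationC_partition mB' tB' covB' gi.
have sumE n : \sum_(k < n) expectationC P (fun w => f w * (\1_(B k) w)%:C) =
    c * \sum_(k < n) expectationC P (fun w => g w * (\1_(B' k) w)%:C).
  by rewrite mulr_sumr; apply: eq_bigr => k _; exact: fg.
apply: complex_ext; [rewrite complexReM|rewrite complexImM].
- apply: (cvg_unique _ cR); first exact: Rhausdorff.
  rewrite (_ : (fun n => _) = fun n =>
    Re c * Re (\sum_(k < n) expectationC P (fun w => g w * (\1_(B' k) w)%:C))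
    - Im c * Im (\sum_(k < n) expectationC P (fun w => g w * (\1_(B' k) w)%:C))).
    by apply: cvgB; apply: cvgMr.
  by apply/funext => n; rewrite sumE complexReM.
- apply: (cvg_unique _ cI); first exact: Rhausdorff.
  rewrite (_ : (fun n => _) = fun n =>
    Re c * Im (\sum_(k < n) expectationC P (fun w => g w * (\1_(B' k) w)%:C))
    + Im c * Re (\sum_(k < n) expectationC P (fun w => g w * (\1_(B' k) w)%:C))).
    by apply: cvgD; apply: cvgMr.
  by apply/funext => n; rewrite sumE complexImM.
Qed.

End scaled_partition.

Section renewal_step.
Context {d : measure_display} {T : measurableType d} {R : realType}.
Context {P : probability T R} {n : nat} {lambda mu xi a : R}.
Variable S : network_attack P n lambda mu xi a.
Variables (M : nat) (V : R).
Hypotheses (lambda_gt0 : 0 < lambda) (mu_gt0 : 0 < mu) (xi_gt0 : 0 < xi).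
Hypotheses (a_gt0 : 0 < a) (a_lt1 : a < 1) (M_gt0 : (0 < M)%N) (V_gt0 : 0 < V).
Implicit Types (z v theta : R[i]) (beta : n.-tuple R[i]).

Lemma measurable_inside_at k i : measurable [set w | inside_at S M V k i w].
Proof.
have -> : [set w | inside_at S M V k i w] =
    [set w | attack_count S (tau S k w) i w] `&` inside S M V i @^-1` [set true].
  by apply/seteqP; split => [w /andP[]|w [h1 h2]] //; apply/andP; split.
apply: measurableI; first exact: measurable_count_tau.
by rewrite -[X in measurable X]setTI; exact: measurable_inside.
Qed.

Lemma inside_at0 w : inside_at S M V 0 0 w.
Proof.
rewrite /inside_at tau0 attack_count0 /inside /node_sum /slots.
by rewrite big_geq// big_nil M_gt0.
Qed.

Lemma box_mean0 z v beta : box_mean S M V z v beta 0 = 1.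
Proof.
rewrite /box_mean (_ : box_transform S M V z v beta 0 = fun=> 1) ?expectationC_cst//.
apply/funext => w; rewrite /box_transform /node_sum big_geq// M_gt0 expr0 mul1r.
by rewrite /gamma_transform expr0 /exp_poly big_ord0 mulr0 subr0 !mul1r.
Qed.

Let increment (k l : nat) : set T := [set w | exists i,
  attack_count S (tau S k w) i w && attack_count S (tau S k.+1 w) (i + l) w].

Let measurable_increment k l : measurable (increment k l).
Proof.
have -> : increment k l = \bigcup_i ([set w | attack_count S (tau S k w) i w] `&`
    [set w | attack_count S (tau S k.+1 w) (i + l) w]).
  by apply/seteqP; split => [w [i /andP[h1 h2]]|w [i _ [h1 h2]]];
    exists i => //; apply/andP; split.
by apply: bigcup_measurable => i _; apply: measurableI; exact: measurable_count_tau.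
Qed.

Let trivIset_increment k : trivIset setT (increment k).
Proof.
move=> l l' _ _ [w [[i /andP[i1 i2]] [j /andP[j1 j2]]]].
rewrite (attack_count_inj j1 i1) in j2.
by apply/eqP; rewrite -(eqn_add2l i); apply/eqP; exact: attack_count_inj i2 j2.
Qed.

Lemma tau_le_ae : {ae P, forall w, forall k, tau S k w <= tau S k.+1 w}.
Proof.
have := delay_gt0 S; apply: filterS => w dw k.
by rewrite tauS lerDl ltW.
Qed.

Let increment_cover k : {ae P, forall w, exists l, increment k l w}.
Proof.
have := attack_count_exists S lambda_gt0; have := tau_le_ae.
apply: filterS2 => w tk cw.
have [i ci] := cw (tau S k w); have [j cj] := cw (tau S k.+1 w).
exists (j - i)%N; exists i; rewrite ci subnKC//.
exact: attack_count_mono (tk k) ci cj.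
Qed.

Let increment_indic (f : T -> R[i]) k i l w :
  f w * (inside_at S M V k i w)%:R * (\1_(increment k l) w)%:C =
  f w * (inside_at S M V k i w && attack_count S (tau S k.+1 w) (i + l) w)%:R.
Proof.
rewrite /inside_at indicE; have [ci|_] := boolP (attack_count S (tau S k w) i w); last first.
  by rewrite !mulr0 mul0r.
case: (inside _ _ _ _ _); last by rewrite !mulr0 mul0r.
rewrite mulr1 /=; congr (_ * _).
have [cj|cj] := boolP (attack_count S (tau S k.+1 w) (i + l) w).
  by rewrite mem_set//; exists i; rewrite ci cj.
rewrite memNset// => -[j /andP[j1 j2]]; rewrite (attack_count_inj j1 ci) in j2.
by rewrite j2 in cj.
Qed.

(** The increment over the next delay is independent of the past, and its
    transform is that of the first observation: over the partition by the number
    of attacks in the delay, the transforms from the [k]-th and from the 0-th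
    observation are proportional. *)
Lemma expectationC_renewal z v theta beta k i :
  summable_marks S z v beta -> 0 <= Re theta ->
  integrableC P (state_transform S z v theta beta 1) ->
  let f w := state_transform S z v theta beta k.+1 w * (inside_at S M V k i w)%:R in
  integrableC P f /\
  expectationC P f = box_mean S M V z v beta i * clock_transform S theta k i
    * expectationC P (state_transform S z v theta beta 1).
Proof.
move=> sm t0 i1 /=.
pose state_abs := state_transform S (modulus z) (real_part v) (real_part theta)
  (real_parts beta).
have g1 : state_transform S z v theta beta 1 =
    fun w => state_transform S z v theta beta 1 w * (inside_at S M V 0 0 w)%:R.
  by apply/funext => w; rewrite inside_at0 mulr1.
have mt0 : 0 <= Re (real_part theta) by [].
have sma := summable_marks_abs sm.
pose c z v theta beta := box_mean S M V z v beta i * clock_transform S theta k i.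
have step z' v' theta' beta' l : summable_marks S z' v' beta' -> 0 <= Re theta' ->
    expectationC P (fun w => state_transform S z' v' theta' beta' k.+1 w *
      (inside_at S M V k i w)%:R * (\1_(increment k l) w)%:C) =
    c z' v' theta' beta' * expectationC P (fun w =>
      state_transform S z' v' theta' beta' 1 w * (\1_(increment 0 l) w)%:C).
  move=> sm' t0'.
  have [_ E1] := expectationC_step M lambda_gt0 mu_gt0 xi_gt0 a_gt0 a_lt1 V_gt0 k i l sm' t0'.
  have [_ E0] := expectationC_step M lambda_gt0 mu_gt0 xi_gt0 a_gt0 a_lt1 V_gt0 0 0 l sm' t0'.
  rewrite box_mean0 clock_transform0 !mul1r in E0.
  have F1 : (fun w => state_transform S z' v' theta' beta' k.+1 w *
      (inside_at S M V k i w)%:R * (\1_(increment k l) w)%:C) = (fun w =>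
      state_transform S z' v' theta' beta' k.+1 w * (inside_at S M V k i w &&
        attack_count S (tau S k.+1 w) (i + l) w)%:R).
    by apply/funext => w; rewrite increment_indic.
  have F0 : (fun w => state_transform S z' v' theta' beta' 1 w *
      (\1_(increment 0 l) w)%:C) = (fun w =>
      state_transform S z' v' theta' beta' 1 w * (inside_at S M V 0 0 w &&
        attack_count S (tau S 1 w) (0 + l) w)%:R).
    by apply/funext => w; rewrite -increment_indic inside_at0 mulr1.
  by rewrite F1 F0 E1 E0 /c; ring.
have mf : cmeasurable (fun w => state_transform S z v theta beta k.+1 w *
    (inside_at S M V k i w)%:R).
  apply: measurableCM; first exact: measurableC_state.
  exact/measurableC_indicator/measurable_inside_at.
have abs_real (m : nat) (b : T -> bool) (B : set T) w :
    (absC (state_transform S z v theta beta m w * (b w)%:R * (\1_B w)%:C))%:C =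
    state_abs m w
      * (b w)%:R * (\1_B w)%:C.
  rewrite absCM [absC (_ * (b w)%:R)]absCM absC_bool absC_real ger0_norm; last by rewrite indicE.
  by rewrite 2!complex_realM absC_state_transform; congr (_ * _ * _); case: (b w).
have int_absC m (b : T -> bool) (B : set T) :
  integrableC P (fun w => state_transform S z v theta beta m w * (b w)%:R * (\1_B w)%:C) ->
  (\int[P]_w (absC (state_transform S z v theta beta m w * (b w)%:R * (\1_B w)%:C))%:E)%E =
  (Re (expectationC P (fun w => state_abs m w * (b w)%:R * (\1_B w)%:C)))%:E.
  move=> ib; rewrite integral_absC//; do 3 f_equal.
  by apply/funext => w; exact: abs_real.
apply: (@expectationC_scaled_partition _ _ _ _ (increment k) (increment 0) _ _ _ _ _ _
  _ (state_transform S z v theta beta 1) _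
  (Re (c (modulus z) (real_part v) (real_part theta) (real_parts beta)))) => //; last first.
  by move=> l; exact: step.
move=> l.
have F1 : (fun w => state_transform S z v theta beta k.+1 w *
      (inside_at S M V k i w)%:R * (\1_(increment k l) w)%:C) = (fun w =>
      state_transform S z v theta beta k.+1 w * (inside_at S M V k i w &&
        attack_count S (tau S k.+1 w) (i + l) w)%:R).
  by apply/funext => w; rewrite increment_indic.
rewrite int_absC; last first.
  rewrite F1; have [] // := expectationC_step M lambda_gt0 mu_gt0 xi_gt0 a_gt0 a_lt1
    V_gt0 k i l sm t0.
rewrite {1}g1 int_absC; last first.
  by apply: integrableC_indicM => //; rewrite -g1.
rewrite step//.
have -> : expectationC P (fun w => state_abs 1 w * (\1_(increment 0 l) w)%:C) =
  expectationC P (fun w => (absC (state_transform S z v theta beta 1 w *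
    (inside_at S M V 0 0 w)%:R * (\1_(increment 0 l) w)%:C))%:C).
  by congr expectationC; apply/funext => w; rewrite abs_real inside_at0 mulr1.
have -> : expectationC P (fun w => state_abs 1 w * (inside_at S M V 0 0 w)%:R
      * (\1_(increment 0 l) w)%:C) =
  expectationC P (fun w => (absC (state_transform S z v theta beta 1 w *
    (inside_at S M V 0 0 w)%:R * (\1_(increment 0 l) w)%:C))%:C).
  by congr expectationC; apply/funext => w; rewrite abs_real.
by rewrite expectationC_real complexReM /= mulr0 subr0 EFinM.
Qed.

End renewal_step.

(** * Survival of the process below the thresholds *)

Section survival.
Context {d : measure_display} {T : measurableType d} {R : realType}.
Context {P : probability T R} {n : nat} {lambda mu xi a : R}.
Variable S : network_attack P n lambda mu xi a.
Variables (M : nat) (V : R).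
Hypotheses (lambda_gt0 : 0 < lambda) (mu_gt0 : 0 < mu) (xi_gt0 : 0 < xi).
Hypotheses (a_gt0 : 0 < a) (a_lt1 : a < 1) (M_gt0 : (0 < M)%N) (V_gt0 : 0 < V).
Implicit Types (z v theta : R[i]) (beta : n.-tuple R[i]).

(** Partition by the number of attacks up to the previous observation. *)
Lemma clock_transformS theta k i : 0 <= Re theta ->
  clock_transform S theta k.+1 i =
  \sum_(j < i.+1) clock_transform S theta k j * delay_transform lambda mu theta (i - j).
Proof.
move=> t0; pose f (j : 'I_i.+1) w := expC (- theta * (tau S k.+1 w)%:C) *
  (attack_count S (tau S k w) j w && attack_count S (tau S k.+1 w) i w)%:R.
have step (j : 'I_i.+1) := expectationC_clock_step S lambda_gt0 mu_gt0 t0 k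
  (ltn_ord j : (j <= i)%N).
have fi j : integrableC P (f j) by have [] := step j.
transitivity (expectationC P (fun w => \sum_(j < i.+1) f j w)).
  apply: expectationC_ae.
  - by apply: integrableC_measurable; exact: integrableC_clock.
  - by apply: measurableC_sum => j; exact: integrableC_measurable (fi j).
  have := attack_count_exists S lambda_gt0; have := tau_le_ae S.
  apply: filterS2 => w tk cw; rewrite -mulr_sumr; congr (_ * _).
  have [c1|_] := boolP (attack_count S (tau S k.+1 w) i w); last first.
    by rewrite big1// => j _; rewrite andbF.
  have [j cj] := cw (tau S k w).
  have ji : (j < i.+1)%N by rewrite ltnS; exact: attack_count_mono (tk k) cj c1.
  rewrite (bigD1 (Ordinal ji)) //= cj big1 ?addr0// => j' j'j.
  case: (boolP (attack_count S (tau S k w) j' w)) => // cj'.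
  by move: j'j; rewrite -val_eqE /= (attack_count_inj cj' cj) eqxx.
rewrite expectationC_sum//; apply: eq_bigr => j _; by have [_ <-] := step j.
Qed.

Definition alive (k : nat) (w : T) : bool := ~~ `[< passed S M V k w >].

Lemma measurable_alive k : measurable [set w | alive k w].
Proof.
have -> : [set w | alive k w] = ~` [set w | passed S M V k w].
  by apply/seteqP; split => w /asboolPn.
by apply: measurableC; exact: measurable_passed.
Qed.

(** The almost sure properties under which survival is decided by the number of
    attacks and decreases with time. *)
Definition regular (w : T) : Prop :=
  [/\ forall l j, 0 < weight S l j w, forall l, (0 < nodes S l w)%N,
      forall k, tau S k w <= tau S k.+1 w &
      forall s, exists i, attack_count S s i w].

Lemma regular_ae : {ae P, forall w, regular w}.
Proof.
have h1 : {ae P, forall w, forall l j, 0 < weight S l j w}.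
  by apply: ae_foralln => l; apply: ae_foralln => j; exact: weight_gt0.
have h2 : {ae P, forall w, forall l, (0 < nodes S l w)%N}.
  by apply: ae_foralln => l; exact: nodes_gt0.
have h34 : {ae P, forall w, (forall k, tau S k w <= tau S k.+1 w) /\
    forall s, exists i, attack_count S s i w}.
  by apply: filterS2 (tau_le_ae S) (attack_count_exists S lambda_gt0).
by move: h1 h2 h34; apply: filterS3 => w ? ? [? ?].
Qed.

Lemma alive_count k i w : regular w -> attack_count S (tau S k w) i w ->
  alive k w = inside S M V i w.
Proof.
case=> w0 _ _ _ cw; have pc := passed_count M V w0 cw.
rewrite /alive; apply/idP/idP => [/asboolPn np|ins]; last first.
  by apply/asboolPn => /pc; rewrite ins.
by apply: contrapT => /negP ni; exact/np/pc.
Qed.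

Lemma inside_lt i w : regular w -> inside S M V i w -> (i < M)%N.
Proof.
case=> _ n0 _ _ /andP[NM _]; apply: leq_ltn_trans NM.
rewrite /node_sum -[X in (X <= _)%N](subn0 i) -[X in (X <= _)%N]muln1 -sum_nat_const_nat.
exact: leq_sum.
Qed.

Lemma alive_sum k w : regular w ->
  (alive k w)%:R = \sum_(i < M) (inside_at S M V k i w)%:R :> R[i].
Proof.
move=> rw; have [_ _ _ /(_ (tau S k w)) [i ci]] := rw.
rewrite (alive_count rw ci).
have [ins|nins] := boolP (inside S M V i w); last first.
  rewrite big1// => j _; rewrite /inside_at.
  have [cj|//] := boolP (attack_count S _ j w).
  by rewrite (attack_count_inj cj ci) (negbTE nins).
rewrite (bigD1 (Ordinal (inside_lt rw ins))) //= /inside_at ci ins big1 ?addr0// => j ji.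
have [cj|//] := boolP (attack_count S _ j w).
by move: ji; rewrite -val_eqE /= (attack_count_inj cj ci) eqxx.
Qed.

Lemma alive_mono k w : regular w -> alive k.+1 w -> alive k w.
Proof.
move=> rw; have [w0 _ /(_ k) tk cw] := rw.
have [i ci] := cw (tau S k w); have [j cj] := cw (tau S k.+1 w).
have ij := attack_count_mono tk ci cj.
rewrite (alive_count rw ci) (alive_count rw cj) => /andP[NM WV]; apply/andP; split.
  by apply: leq_ltn_trans NM; rewrite /node_sum (big_cat_nat (leq0n i) ij) ?leq_addr.
apply: le_lt_trans WV; rewrite (perm_big _ (slots_cat (nodes S ^~ w) (leq0n i) ij)) big_cat /=.
by rewrite lerDl; apply: sumr_ge0 => y _; exact: ltW.
Qed.

Lemma alive0 w : alive 0 w.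
Proof.
apply/asboolPn; apply; have c0 : attack_count S (tau S 0 w) 0 w by rewrite tau0 attack_count0.
rewrite (total_nodes_count c0) (total_weight_count c0) /node_sum /slots.
by rewrite big_geq// big_nil lexx.
Qed.

Definition alive_mean z v theta beta k : R[i] :=
  \sum_(i < M) box_mean S M V z v beta i * clock_transform S theta k i.

Let mstate_bool z v theta beta k (b : T -> bool) : measurable [set w | b w] ->
  cmeasurable (fun w => state_transform S z v theta beta k w * (b w)%:R).
Proof.
by move=> mb; apply: measurableCM; [exact: measurableC_state|exact: measurableC_indicator].
Qed.

Let alive_ae z v theta beta k m : {ae P, forall w,
  \sum_(i < M) state_transform S z v theta beta m w * (inside_at S M V k i w)%:R =
  state_transform S z v theta beta m w * (alive k w)%:R}.
Proof. by have := regular_ae; apply: filterS => w rw; rewrite alive_sum// mulr_sumr. Qed.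

(** Below the thresholds there are fewer than [M] attacks, as each takes a node. *)
Lemma expectationC_alive z v theta beta k :
  summable_marks S z v beta -> 0 <= Re theta ->
  let f w := state_transform S z v theta beta k w * (alive k w)%:R in
  integrableC P f /\ expectationC P f = alive_mean z v theta beta k.
Proof.
move=> sm t0 /=.
have E i := expectationC_inside_at M xi_gt0 a_gt0 a_lt1 V_gt0 k i sm t0.
pose g (i : 'I_M) w := state_transform S z v theta beta k w * (inside_at S M V k i w)%:R.
have gi i : integrableC P (g i) by have [] := E i.
have ae := alive_ae z v theta beta k k.
have mf := mstate_bool z v theta beta k (measurable_alive k).
split; first by apply: (integrableC_ae mf _ ae); exact: (integrableC_sum _ gi).
rewrite -(expectationC_ae _ mf ae).
  rewrite (expectationC_sum _ gi).
  by apply: eq_bigr => i _; have [_ ->] := E i.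
by apply: (@measurableC_sum _ _ _ _ _ g) => i; exact: integrableC_measurable (gi i).
Qed.

Lemma expectationC_alive_step z v theta beta k :
  summable_marks S z v beta -> 0 <= Re theta ->
  integrableC P (state_transform S z v theta beta 1) ->
  let f w := state_transform S z v theta beta k.+1 w * (alive k w)%:R in
  integrableC P f /\ expectationC P f =
    alive_mean z v theta beta k * expectationC P (state_transform S z v theta beta 1).
Proof.
move=> sm t0 i1 /=.
have E i := expectationC_renewal lambda_gt0 mu_gt0 xi_gt0 a_gt0 a_lt1 M_gt0 V_gt0 k i sm t0 i1.
pose g (i : 'I_M) w := state_transform S z v theta beta k.+1 w * (inside_at S M V k i w)%:R.
have gi i : integrableC P (g i) by have [] := E i.
have ae := alive_ae z v theta beta k k.+1.
have mf := mstate_bool z v theta beta k.+1 (measurable_alive k).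
split; first by apply: (integrableC_ae mf _ ae); exact: (integrableC_sum _ gi).
rewrite -(expectationC_ae _ mf ae).
  rewrite (expectationC_sum _ gi).
  by rewrite mulr_suml; apply: eq_bigr => i _; have [_ ->] := E i.
by apply: (@measurableC_sum _ _ _ _ _ g) => i; exact: integrableC_measurable (gi i).
Qed.

(** The convolution with [delay_transform] contracts at rate [decay_rate]. *)
Lemma clock_transform_bound theta k i : 0 <= Re theta ->
  absC (clock_transform S theta k i) <= 2 ^+ i * decay_rate lambda mu ^+ k.
Proof.
move=> t0; rewrite -[2 ^+ i]mul1r; apply: (convolution_decay lambda_gt0 mu_gt0 t0).
  by move=> k' i'; exact: clock_transformS.
move=> i'; rewrite clock_transform0 absC_bool mul1r.
by apply: (@le_trans _ _ 1); [case: (_ == _)|rewrite exprn_ege1// ler1n].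
Qed.

Lemma alive_mean_bound z v theta beta : 0 <= Re theta ->
  exists c, forall k, absC (alive_mean z v theta beta k) <= c * decay_rate lambda mu ^+ k.
Proof.
move=> t0; exists (\sum_(i < M) absC (box_mean S M V z v beta i) * 2 ^+ i) => k.
rewrite (le_trans (absC_sum _ _ _))// mulr_suml; apply: ler_sum => i _.
by rewrite absCM -mulrA ler_wpM2l ?absC_ge0// clock_transform_bound.
Qed.

(** Summing the geometric decay of the clock transforms over [k]. *)
Lemma sum_alive_mean z v theta beta : 0 <= Re theta ->
  exists c, forall m,
    absC (\sum_(i < M) box_mean S M V z v beta i * clock_total lambda mu theta i
          - \sum_(k < m) alive_mean z v theta beta k) <= c * decay_rate lambda mu ^+ m.
Proof.
move=> t0; exists (\sum_(i < M) absC (box_mean S M V z v beta i)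
  * ((1 + mu / lambda) * 2 ^+ i)) => m.
rewrite /alive_mean exchange_big /= -sumrB (le_trans (absC_sum _ _ _))// mulr_suml.
apply: ler_sum => i _; rewrite -mulr_sumr -mulrBr absCM -mulrA ler_wpM2l ?absC_ge0//.
apply: (clock_total_limit lambda_gt0 mu_gt0 t0 (c := clock_transform S theta)).
  exact: clock_transform0.
by move=> k j; exact: clock_transformS.
Qed.

End survival.

(** * The transform at the first observed passage *)

Section geometric_limits.
Context {R : realType}.
Variables (r : R).
Hypothesis r01 : 0 <= r < 1.

Lemma geometric_dominated_cvg (u : R^nat) (l c : R) :
  (forall k, `|u k - l| <= c * r ^+ k) -> u @ \oo --> l.
Proof.
move=> ul; have [r0 r1] := andP r01.
have g0 : geometric c r @ \oo --> 0 by apply: cvg_geometric; rewrite ger0_norm.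
apply/cvgrPdist_le => e e0.
have h : \forall k \near \oo, `|geometric c r k| <= e by exact: cvgr0_norm_le.
apply: filterS h => k ge; rewrite distrC; apply: le_trans (ul k) _.
exact: le_trans (ler_norm _) ge.
Qed.

Lemma sum_geometric_le (c : R) m : 0 <= c ->
  \sum_(k < m) c * r ^+ k <= c / (1 - r).
Proof.
move=> c0; have [r0 r1] := andP r01.
rewrite -mulr_sumr ler_wpM2l// -[leRHS]mul1r ler_pdivlMr ?subr_gt0// mulrC.
have -> : (1 - r) * \sum_(k < m) r ^+ k = 1 - r ^+ m.
  by have := subrX1 r m; rewrite -[r - 1]opprB -[r ^+ _ - 1]opprB mulNr => /oppr_inj.
by rewrite gerBl exprn_ge0.
Qed.

End geometric_limits.

Section passage.
Context {d : measure_display} {T : measurableType d} {R : realType}.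
Context {P : probability T R} {n : nat} {lambda mu xi a : R}.
Variable S : network_attack P n lambda mu xi a.
Variables (M : nat) (V : R).
Hypotheses (lambda_gt0 : 0 < lambda) (mu_gt0 : 0 < mu) (xi_gt0 : 0 < xi).
Hypotheses (a_gt0 : 0 < a) (a_lt1 : a < 1) (M_gt0 : (0 < M)%N) (V_gt0 : 0 < V).
Implicit Types (z v theta : R[i]) (beta : n.-tuple R[i]).
Local Notation alive := (alive S M V).
Local Notation decay := (decay_rate lambda mu).

Let decay01 : 0 <= decay < 1.
Proof. exact: decay_rate_itv. Qed.

Let zeros : n.-tuple R[i] := nseq_tuple n 0.

Let dotC0 (x : n.-tuple R) : dotC zeros x = 0.
Proof. by rewrite /dotC big1// => i _; rewrite tnth_nseq mul0r. Qed.

Let state0 k w : state_transform S 1 0 0 zeros k w = 1.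
Proof. by rewrite /state_transform expr1n dotC0 oppr0 !mul0r expC0 !mul1r. Qed.

Let summable_marks0 : summable_marks S 1 0 zeros.
Proof.
have p1 y : passive_exp S zeros y = fun=> 1.
  by apply/funext => w; rewrite /passive_exp dotC0 expC0.
have w1 y : weight_exp S 0 y = fun=> 1.
  by apply/funext => w; rewrite /weight_exp oppr0 mul0r expC0.
have f1 : node_factor S 1 0 zeros = 1.
  rewrite /node_factor -(expectationC_passive_exp S zeros (0, 0)%N) /weight_lst w1 p1.
  by rewrite !expectationC_cst !mul1r.
have abs0 : [/\ modulus 1 = 1 :> R[i], real_part 0 = 0 :> R[i] & real_parts zeros = zeros].
  split; rewrite ?/modulus ?absC1//.
  by apply: eq_from_tnth => i; rewrite !tnth_map !tnth_nseq.
case: abs0 => m1 r0 rz; rewrite /summable_marks m1 r0 rz f1; split => //.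
- by rewrite p1; exact: integrableC_cst.
- by under eq_fun do rewrite expr1n; exact: integrableC_cst.
- by under eq_fun do rewrite expr1n; exact: integrableC_cst.
Qed.

(** With trivial arguments the mean over [alive k] is the survival probability,
    which decays geometrically. *)
Lemma absorbed_ae : {ae P, forall w, exists k, ~~ alive k w}.
Proof.
have t0 : 0 <= Re (0 : R[i]) by [].
have [c cP] := alive_mean_bound S M V lambda_gt0 mu_gt0 1 0 zeros t0.
pose bad := \bigcap_k [set w | alive k w].
have mbad : measurable bad.
  by apply: bigcap_measurableType => k _; exact: measurable_alive.
have Pk k : fine (P [set w | alive k w]) <= c * decay ^+ k.
  have [_ Ek] := expectationC_alive M lambda_gt0 xi_gt0 a_gt0 a_lt1 V_gt0 k summable_marks0 t0.
  apply: le_trans (cP k); apply: le_trans (Re_le_absC _); apply: le_trans (ler_norm _).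
  rewrite -Ek; under [in leRHS]eq_fun do rewrite state0 mul1r.
  by rewrite expectationC_bool//; exact: measurable_alive.
exists bad; split => //; last first.
  move=> w /= nw k _; apply: contrapT => /negP nk; apply: nw; by exists k.
have P0 : fine (P bad) = 0.
  have h : (fun=> fine (P bad)) @ \oo --> (0 : R).
    apply: (geometric_dominated_cvg decay01 (c := c)) => k.
    rewrite subr0 ger0_norm ?fine_ge0//; apply: le_trans (Pk k).
    apply: fine_le; rewrite ?fin_num_measure//; first exact: measurable_alive.
    by apply: le_measure; rewrite ?inE//; [exact: measurable_alive|move=> w; apply].
  by apply: (cvg_unique _ (cvg_cst _) h); exact: Rhausdorff.
by rewrite -[LHS]fineK ?fin_num_measure// P0.
Qed.

(** Survival decreases in [k] and starts at [k = 0], hence [rho] is the number of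
    observations that it lasts. *)
Lemma alive_rho w : regular S w -> (exists k, ~~ alive k w) ->
  forall k, alive k w = (k < rho S M V w)%N.
Proof.
move=> rw ex; pose m := ex_minn ex.
have [am mP] : ~~ alive m w /\ forall k, ~~ alive k w -> (m <= k)%N.
  by rewrite /m; case: ex_minnP.
have aliveE k : alive k w = (k < m)%N.
  apply/idP/idP => [ak|km]; last by apply: contraTT km => /mP; rewrite -leqNgt.
  rewrite ltnNge; apply/negP => mk.
  have down j : alive (m + j) w -> alive m w.
    elim: j => [|j IH]; first by rewrite addn0.
    by rewrite addnS => /(alive_mono rw).
  by move: am; rewrite (down (k - m)%N)// subnKC.
suff -> : rho S M V w = m by [].
have passedE k : passed S M V k w <-> ~~ (k < m)%N.
  by rewrite -aliveE /alive negbK; split => [|/asboolP//] h; exact/asboolP.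
rewrite /rho; case: xgetP => [j _ [/passedE jm nj]|nx]; last first.
  case: (nx m); split; first by apply/passedE; rewrite ltnn.
  by move=> j jm; apply/passedE; rewrite jm.
move: jm; rewrite -leqNgt => mj; apply/eqP; rewrite eqn_leq mj andbT leqNgt.
by apply/negP => jm; apply: (nj m jm); apply/passedE; rewrite ltnn.
Qed.

Section transform.
Variables (z v theta : R[i]) (beta : n.-tuple R[i]).
Hypotheses (sm : summable_marks S z v beta) (t0 : 0 <= Re theta).
Hypothesis i1 : integrableC P (state_transform S z v theta beta 1).
Local Notation gamma := (expectationC P (state_transform S z v theta beta 1)).
Local Notation state := (state_transform S z v theta beta).
Local Notation state_abs := (state_transform S (modulus z) (real_part v)
  (real_part theta) (real_parts beta)).
Local Notation Y := (fun w => state (rho S M V w) w).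
Local Notation A := (alive_mean S M V z v theta beta).

Let B (k : nat) : set T := [set w | rho S M V w = k].

Let mB k : measurable (B k).
Proof.
by have := measurable_rho S M V measurableT (Y := [set k]) I; rewrite setTI.
Qed.

Let tB : trivIset setT B.
Proof. by move=> i j _ _ [w [<- <-]]. Qed.

Let covB : {ae P, forall w, exists k, B k w}.
Proof. by apply: aeW => w; exists (rho S M V w). Qed.

Let mY : cmeasurable Y.
Proof.
apply: measurableC_random_index; first exact: measurable_rho.
by move=> k; exact: measurableC_state.
Qed.

Let mYB k : cmeasurable (fun w => Y w * (\1_(B k) w)%:C).
Proof. by apply: measurableCM => //; exact: measurableC_indic. Qed.

Let good : {ae P, forall w, forall k, alive k w = (k < rho S M V w)%N}.
Proof.
have := regular_ae S lambda_gt0 a_gt0 a_lt1; have := absorbed_ae.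
by apply: filterS2 => w ex rw; exact: alive_rho.
Qed.

Let indicB k w : (\1_(B k) w)%:C = (rho S M V w == k)%:R :> R[i].
Proof.
rewrite indicE; have [e|ne] := eqVneq (rho S M V w) k; first by rewrite mem_set.
by rewrite memNset//; exact/eqP.
Qed.

Let YB0 : {ae P, forall w, (fun=> 0) w = Y w * (\1_(B 0%N) w)%:C}.
Proof.
apply: filterS good => w aw; rewrite indicB.
by have := aw 0%N; rewrite alive0// lt0n => /esym/negbTE ->; rewrite mulr0.
Qed.

Let YBS k : {ae P, forall w,
  state k.+1 w * (alive k w)%:R + -1 * (state k.+1 w * (alive k.+1 w)%:R) =
  Y w * (\1_(B k.+1) w)%:C}.
Proof.
apply: filterS good => w aw; rewrite indicB !aw.
case: (ltngtP (rho S M V w) k.+1) => [_|_|->].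
- by rewrite !mulr0 addr0.
- by rewrite mulN1r subrr mulr0.
- by rewrite !mulr0 addr0.
Qed.

Let alive_int k := expectationC_alive M lambda_gt0 xi_gt0 a_gt0 a_lt1 V_gt0 k sm t0.
Let step_int k :=
  expectationC_alive_step lambda_gt0 mu_gt0 xi_gt0 a_gt0 a_lt1 M_gt0 V_gt0 k sm t0 i1.

Let EYB0 : expectationC P (fun w => Y w * (\1_(B 0%N) w)%:C) = 0.
Proof. by rewrite -(expectationC_ae (measurableC_cst _) (mYB 0) YB0) expectationC_cst. Qed.

Let EYBS k : expectationC P (fun w => Y w * (\1_(B k.+1) w)%:C) = A k * gamma - A k.+1.
Proof.
have [ia Ea] := alive_int k.+1; have [ist Es] := step_int k.
have iD := integrableCD ist (integrableCZ (-1) ia).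
rewrite -(expectationC_ae (integrableC_measurable iD) (mYB _) (YBS k)).
by rewrite expectationCD//; [rewrite expectationCZ// Es Ea mulN1r|exact: integrableCZ].
Qed.

Let sum_EYB m : \sum_(k < m.+1) expectationC P (fun w => Y w * (\1_(B k) w)%:C) =
  A 0 - (1 - gamma) * \sum_(k < m) A k - A m.
Proof.
elim: m => [|m IH]; first by rewrite big_ord_recl !big_ord0 EYB0; ring.
by rewrite big_ord_recr IH big_ord_recr EYBS /=; ring.
Qed.

(** Up to the observation [rho] the absolute moments are those at the moduli and
    real parts of the arguments, and they decay geometrically. *)
Let integrable_Y : integrableC P Y.
Proof.
have sma := summable_marks_abs sm.
have t0a : 0 <= Re (real_part theta) by [].
have [c cP] := alive_mean_bound S M V lambda_gt0 mu_gt0 (modulus z) (real_part v)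
  (real_parts beta) t0a.
pose ga := expectationC P (state_abs 1).
have i1a : integrableC P (state_abs 1).
  by apply: (integrableC_abs i1) => w; exact: absC_state_transform.
have c0 : 0 <= c by have := le_trans (absC_ge0 _) (cP 0%N); rewrite expr0 mulr1.
have bound k : (\int[P]_w (absC (Y w * (\1_(B k.+1) w)%:C))%:E <=
    ((c * absC ga) * decay ^+ k)%:E)%E.
  have [ist _] := step_int k.
  apply: (@le_trans _ _ (\int[P]_w (absC (state k.+1 w * (alive k w)%:R))%:E)%E).
    apply: ae_ge0_le_integral => //.
    - by move=> w _; rewrite lee_fin absC_ge0.
    - by apply/measurable_EFinP; exact: measurableC_absC.
    - by move=> w _; rewrite lee_fin absC_ge0.
    - by apply/measurable_EFinP; exact: measurableC_absC (integrableC_measurable ist).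
    apply: filterS good => w aw _; rewrite indicB lee_fin absCM [leRHS]absCM !absC_bool aw.
    have [->|_] := eqVneq (rho S M V w) k.+1; first by rewrite ltnSn.
    by rewrite mulr0 mulr_ge0 ?absC_ge0// ler0n.
  rewrite integral_absC// lee_fin.
  have [_ Ea] := expectationC_alive_step lambda_gt0 mu_gt0 xi_gt0 a_gt0 a_lt1 M_gt0 V_gt0
    k sma t0a i1a.
  rewrite (_ : (fun w => _) = fun w => state_abs k.+1 w * (alive k w)%:R); last first.
    apply/funext => w; rewrite absCM absC_bool complex_realM absC_state_transform.
    by congr (_ * _); case: (alive k w).
  rewrite Ea; apply: le_trans (le_trans (ler_norm _) (Re_le_absC _)) _.
  by rewrite absCM mulrAC ler_wpM2r ?absC_ge0.
apply/integrableC_absP; split => //; rewrite (integral_absC_partition mB tB covB)//.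
have int0 k : (0 <= \int[P]_w (absC (Y w * (\1_(B k) w)%:C))%:E)%E.
  by apply: integral_ge0 => w _; rewrite lee_fin absC_ge0.
apply: (@le_lt_trans _ _ ((c * absC ga) / (1 - decay))%:E); last exact: ltry.
apply: lime_le; first by apply: is_cvg_nneseries => k _ _; exact: int0.
apply: nearW => -[|m].
  by rewrite big_geq// lee_fin divr_ge0 ?mulr_ge0 ?absC_ge0// subr_ge0 ltW//; case/andP: decay01.
rewrite big_nat_recl// (_ : (\int[P]_w _)%E = 0%E) ?add0e; last first.
  rewrite -(ae_eq_integral_absC (measurableC_cst _) (mYB 0) YB0) absC0.
  by rewrite integral0.
apply: (@le_trans _ _ (\sum_(0 <= k < m) ((c * absC ga) * decay ^+ k)%:E)%E).
  by apply: lee_sum => k _; exact: bound.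
rewrite sumEFin lee_fin big_mkord; apply: sum_geometric_le => //.
by rewrite mulr_ge0 ?absC_ge0.
Qed.

(** On the event [rho = k + 1] the state is that of an observation reached alive
    and not survived, which contributes [gamma * A k - A (k + 1)]; the sum over
    [k] telescopes. *)
Theorem expectationC_passage : integrableC P Y /\
  expectationC P Y = 1 - (1 - gamma) *
    \sum_(i < M) box_mean S M V z v beta i * clock_total lambda mu theta i.
Proof.
split; first exact: integrable_Y.
have [c1 c1P] := sum_alive_mean S M V lambda_gt0 mu_gt0 z v beta t0.
have [c2 c2P] := alive_mean_bound S M V lambda_gt0 mu_gt0 z v beta t0.
have A0 : A 0 = 1.
  have [_ <-] := alive_int 0; rewrite (_ : (fun w => _) = fun=> 1) ?expectationC_cst//.
  apply/funext => w; rewrite alive0// mulr1.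
  have c0 : attack_count S (tau S 0 w) 0 w by rewrite tau0 attack_count0.
  rewrite (state_transform_count z v theta beta c0) tau0 mulr0 expC0 mulr1.
  by rewrite /slots big_nil.
set G := (X in _ * X); set l := (X in _ = X).
have dist m : absC (\sum_(k < m.+1) expectationC P (fun w => Y w * (\1_(B k) w)%:C) - l) <=
    (absC (1 - gamma) * c1 + c2) * decay ^+ m.
  have -> : \sum_(k < m.+1) expectationC P (fun w => Y w * (\1_(B k) w)%:C) - l =
      (1 - gamma) * (G - \sum_(k < m) A k) + - A m.
    by rewrite sum_EYB A0 /l; ring.
  rewrite (le_trans (absCD _ _))// absCN absCM mulrDl lerD//.
  by rewrite -mulrA ler_wpM2l ?absC_ge0.
have [cR cI] := expectationC_partition mB tB covB integrable_Y.
apply: complex_ext.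
- apply: (cvg_unique _ cR); first exact: Rhausdorff.
  rewrite /= -cvg_shiftS.
  apply: (geometric_dominated_cvg decay01 (c := absC (1 - gamma) * c1 + c2)) => m.
  rewrite -complexReN -complexReD; exact: le_trans (Re_le_absC _) (dist m).
- apply: (cvg_unique _ cI); first exact: Rhausdorff.
  rewrite /= -cvg_shiftS.
  apply: (geometric_dominated_cvg decay01 (c := absC (1 - gamma) * c1 + c2)) => m.
  rewrite -complexImN -complexImD; exact: le_trans (Im_le_absC _) (dist m).
Qed.

End transform.
End passage.

(** * Node counts and renewal sums *)

Section box_means.
Context {d : measure_display} {T : measurableType d} {R : realType}.
Context {P : probability T R} {n : nat} {lambda mu xi a : R}.
Variable S : network_attack P n lambda mu xi a.
Variables (M : nat) (V : R).
Hypotheses (lambda_gt0 : 0 < lambda) (mu_gt0 : 0 < mu) (xi_gt0 : 0 < xi).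
Hypotheses (a_gt0 : 0 < a) (a_lt1 : a < 1) (M_gt0 : (0 < M)%N) (V_gt0 : 0 < V).
Implicit Types (z v theta : R[i]) (beta : n.-tuple R[i]).

Definition node_sum_law (i r : nat) : R[i] :=
  expectationC P (fun w => (node_sum S 0 i w == r)%:R).

Let mN l : measurable_fun setT (nodes S l).
Proof. by []. Qed.

Let m_eq (G : set_system T) (f : T -> nat) (r : nat) : measurable_wrt G f ->
  measurableC_wrt G (fun w => (f w == r)%:R : R[i]).
Proof.
by move=> mf; exact: (measurableC_comp mf (measurableC_nat (fun m => (m == r)%:R : R[i]))).
Qed.

Let m_sum i : measurable_wrt (RV_block (nodes S) [set l | (l < i)%N]) (node_sum S 0 i).
Proof.
by apply: measurable_wrt_node_sum => l /andP[_ li]; exact: measurable_wrt_RV_block.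
Qed.

Let m_node i : measurable_wrt (RV_block (nodes S) [set i]) (nodes S i).
Proof. exact: measurable_wrt_RV_block. Qed.

Let i_eq (G : set_system T) (f : T -> nat) (r : nat) : G `<=` measurable -> measurable_wrt G f ->
  integrableC P (fun w => (f w == r)%:R : R[i]).
Proof.
move=> GM mf; apply: (@integrableC_bounded _ _ _ _ _ 1).
  exact: (measurableC_wrtW GM (m_eq r mf)).
by apply: aeW => w; rewrite absC_bool; case: (_ == _).
Qed.

Lemma node_sum_law0 r : node_sum_law 0 r = (r == 0%N)%:R.
Proof.
rewrite /node_sum_law (_ : (fun w => _) = fun=> (r == 0%N)%:R) ?expectationC_cst//.
by apply/funext => w; rewrite /node_sum big_geq// eq_sym.
Qed.

Lemma node_sum_lawS i r : node_sum_law i.+1 r =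
  \sum_(j < r.+1) node_sum_law i (r - j)%N * (@node_pmf R a j)%:C.
Proof.
have blockM J : RV_block (nodes S) J `<=` measurable by exact: RV_block_measurable.
have disj : [set l | (l < i)%N] `&` [set i] = set0.
  by apply/seteqP; split => // l [/= li le]; rewrite le ltnn in li.
have E (j : 'I_r.+1) := expectationC_indepM (blockM _) (blockM _)
  (indep_RV_blocks mN (@nodes_independent _ _ _ _ _ _ _ _ _ S) disj)
  (m_eq (r - j)%N (@m_sum i)) (m_eq j (@m_node i))
  (i_eq (r - j)%N (blockM _) (@m_sum i)) (i_eq j (blockM _) (@m_node i)).
pose f (j : 'I_r.+1) w : R[i] := (node_sum S 0 i w == r - j)%N%:R * (nodes S i w == j)%:R.
have fi j : integrableC P (f j) by have [] := E j.
rewrite /node_sum_law (_ : (fun w => _) = fun w => \sum_(j < r.+1) f j w).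
  rewrite (expectationC_sum _ fi); apply: eq_bigr => j _; have [_ ->] := E j.
  congr (_ * _); rewrite expectationC_bool.
    rewrite (_ : [set w | nodes S i w == j] = [set w | nodes S i w = j]).
      by rewrite nodes_pmf.
    by apply/seteqP; split => w /eqP.
  rewrite (_ : [set w | _] = nodes S i @^-1` [set (j : nat)]); first exact: measurable_funPTI.
  by apply/seteqP; split => w /eqP.
apply/funext => w; rewrite /f /node_sum big_nat_recr//= -/(node_sum S 0 i w).
have [le|gt] := leqP (nodes S i w) r; last first.
  rewrite big1 => [|j _].
    by rewrite gtn_eqF// (leq_trans gt)// leq_addl.
  by rewrite [nodes S i w == j]gtn_eqF ?mulr0// (leq_ltn_trans _ gt)// -ltnS.
have lt : (nodes S i w < r.+1)%N by [].
rewrite (bigD1 (Ordinal lt)) //= eqxx mulr1 big1 ?addr0 => [|j jn]; last first.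
  by rewrite [nodes S i w == j](_ : _ = false) ?mulr0//; apply/negbTE; rewrite eq_sym.
by rewrite -[in RHS](eqn_add2r (nodes S i w)) subnK.
Qed.

Lemma box_meanE z v beta i : box_mean S M V z v beta i =
  \sum_(r < M) node_sum_law i r *
    ((z * passive_mgf S beta) ^+ r * gamma_transform xi (xi%:C + v) V r).
Proof.
have blockM J : RV_block (nodes S) J `<=` measurable by exact: RV_block_measurable.
pose c r := (z * passive_mgf S beta) ^+ r * gamma_transform xi (xi%:C + v) V r.
pose f (r : 'I_M) w : R[i] := c r * (node_sum S 0 i w == r)%:R.
have fi r : integrableC P (f r).
  by apply: integrableCZ; exact: i_eq (blockM _) (@m_sum i).
rewrite /box_mean (_ : box_transform _ _ _ _ _ _ _ = fun w => \sum_(r < M) f r w).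
  rewrite (expectationC_sum _ fi); apply: eq_bigr => r _.
  by rewrite expectationCZ 1?mulrC//; exact: i_eq (blockM _) (@m_sum i).
apply/funext => w; rewrite /box_transform /f.
have [lt|ge] := ltnP (node_sum S 0 i w) M; last first.
  rewrite mul0r big1// => r _.
  by rewrite gtn_eqF ?mulr0// (leq_trans _ ge).
rewrite (bigD1 (Ordinal lt)) //= eqxx mulr1 mul1r big1 ?addr0// => r rn.
by rewrite [_ == _](_ : _ = false) ?mulr0//; apply/negbTE; rewrite eq_sym.
Qed.

(** Interchanging the sums over attacks and node numbers turns the potential
    of the attacks into a renewal sum over the nodes. *)
Lemma sum_box_mean z v theta beta (x : R[i]) :
  \sum_(i < M) x ^+ i * box_mean S M V z v beta i =
  \sum_(r < M) node_renewal a x r *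
    ((z * passive_mgf S beta) ^+ r * gamma_transform xi (xi%:C + v) V r).
Proof.
under eq_bigr do rewrite box_meanE mulr_sumr.
rewrite exchange_big /=; apply: eq_bigr => r _.
rewrite -(sum_node_renewal x node_sum_law0 node_sum_lawS (ltn_ord r)) mulr_suml.
by apply: eq_bigr => i _; rewrite mulrA.
Qed.

End box_means.

Section renewal_closed_form.
Context {R : realType}.

(** For [r > 0] the renewal sum is geometric with ratio [b + a x]. *)
Lemma sum_node_renewal_geometric (a : R) (x : R[i]) (h : nat -> R[i]) m :
  (1 - a)%:C + a%:C * x != 0 ->
  \sum_(r < m.+1) node_renewal a x r * h r =
  h 0%N + a%:C * x / ((1 - a)%:C + a%:C * x) *
    (\sum_(r < m.+1) ((1 - a)%:C + a%:C * x) ^+ r * h r - h 0%N).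
Proof.
move=> y0; rewrite !big_ord_recl /= !mul1r addrAC subrr add0r; congr (_ + _).
rewrite mulr_sumr; apply: eq_bigr => r _; rewrite /= exprS.
by rewrite !mulrA divfK.
Qed.

End renewal_closed_form.

(** * Consequences of absolute convergence *)

Section convergence.
Context {d : measure_display} {T : measurableType d} {R : realType}.
Context {P : probability T R} {n : nat} {lambda mu xi a : R}.
Variable S : network_attack P n lambda mu xi a.
Variables (z v theta : R[i]) (beta : n.-tuple R[i]).
Hypothesis v_ge0 : 0 <= Re v.
Hypothesis abs_cvg : converges_absolutely S z v theta beta.

Let passive_abs : expectationC P (passive_exp S (real_parts beta) (0, 0)%N) =
  (fine (real_passive_mgf S (map_tuple (@complex.Re R) beta)))%:C.
Proof.
rewrite /real_passive_mgf -expectationC_real; congr expectationC; apply/funext => w.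
by rewrite /passive_exp dotC_real_parts expC_real.
Qed.

Let weight_abs : weight_lst S (real_part v) = (fine (real_weight_lst S (Re v)))%:C.
Proof.
rewrite /real_weight_lst -expectationC_real; congr expectationC; apply/funext => w.
by rewrite /weight_exp -[RHS]expC_real /real_part rmorphM rmorphN.
Qed.

Let mpassive (g : n.-tuple R[i]) : cmeasurable (passive_exp S g (0, 0)%N).
Proof.
apply: measurableC_exp; apply: measurableC_sum => i; apply: measurableCM.
  exact: measurableC_cst.
apply: measurableC_real.
exact: (measurableT_comp (measurable_tnth i) (measurable_funP (passive S 0 0))).
Qed.

Lemma integrableC_passive : integrableC P (passive_exp S beta (0, 0)%N).
Proof.
have [m_fin _ _] := abs_cvg; apply/integrableC_absP; split; first exact: mpassive.
move: m_fin; rewrite /real_passive_mgf expectation_integral; apply: le_lt_trans.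
rewrite le_eqVlt; apply/orP; left; apply/eqP; apply: eq_integral => w _.
by rewrite /passive_exp absC_expC Re_dotC.
Qed.

(** The modulus of a mean is at most the mean of the modulus. *)
Lemma absC_node_factor : absC (node_factor S z v beta) <=
  Re (node_factor S (modulus z) (real_part v) (real_parts beta)).
Proof.
rewrite /node_factor -(expectationC_passive_exp S beta (0, 0)%N).
rewrite -(expectationC_passive_exp S (real_parts beta) (0, 0)%N) passive_abs weight_abs.
rewrite /modulus !absCM -!rmorphM /=.
have iw := integrableC_weight_exp S (0, 0)%N v_ge0.
have hw : absC (weight_lst S v) <= fine (real_weight_lst S (Re v)).
  have -> : fine (real_weight_lst S (Re v)) = Re (weight_lst S (real_part v)).
    by rewrite weight_abs.
  apply: le_trans (absC_expectationC iw) _; rewrite le_eqVlt; apply/orP; left; apply/eqP.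
  by congr (Re (expectationC P _)); apply/funext => w; exact: absC_weight_exp.
have hp : absC (expectationC P (passive_exp S beta (0, 0)%N)) <=
    fine (real_passive_mgf S (map_tuple (@complex.Re R) beta)).
  have -> : fine (real_passive_mgf S (map_tuple (@complex.Re R) beta)) =
      Re (expectationC P (passive_exp S (real_parts beta) (0, 0)%N)).
    by rewrite passive_abs.
  apply: le_trans (absC_expectationC integrableC_passive) _.
  rewrite le_eqVlt; apply/orP; left; apply/eqP.
  by congr (Re (expectationC P _)); apply/funext => w; exact: absC_passive_exp.
by apply: ler_pM => //; rewrite ?mulr_ge0 ?absC_ge0// ler_wpM2l ?absC_ge0.
Qed.

Lemma converges_summable_marks : summable_marks S z v beta.
Proof.
have [_ q_fin _] := abs_cvg.
pose q := absC z * fine (real_weight_lst S (Re v))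
  * fine (real_passive_mgf S (map_tuple (@complex.Re R) beta)).
have qE : node_factor S (modulus z) (real_part v) (real_parts beta) = q%:C.
  rewrite /node_factor -(expectationC_passive_exp S (real_parts beta) (0, 0)%N).
  by rewrite passive_abs weight_abs /q !rmorphM.
have q0 : 0 <= q.
  by have := le_trans (absC_ge0 _) absC_node_factor; rewrite qE.
have mpow (c : R[i]) : cmeasurable (fun w => c ^+ nodes S 0 w).
  by exact: (measurableC_comp (measurable_funP (nodes S 0)) (measurableC_nat (fun r => c ^+ r))).
have iq : integrableC P (fun w => q%:C ^+ nodes S 0 w).
  apply/integrableC_absP; split; first exact: mpow.
  move: q_fin; rewrite expectation_integral; apply: le_lt_trans.
  rewrite le_eqVlt; apply/orP; left; apply/eqP; apply: eq_integral => w _.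
  by rewrite absCX absC_real ger0_norm.
split; rewrite ?qE//; first exact: integrableC_passive.
apply: (integrableC_le (mpow _) iq) => w; rewrite !absCX absC_real ger0_norm//.
by rewrite lerXn2r ?nnegrE ?absC_ge0//; have := absC_node_factor; rewrite qE.
Qed.

Lemma converges_state : integrableC P (state_transform S z v theta beta 1).
Proof.
have [_ _ g_fin] := abs_cvg; apply/integrableC_absP; split.
  exact: measurableC_state.
by move: g_fin; rewrite expectation_integral.
Qed.

End convergence.

Theorem theorem3p1 (d : measure_display) (T : measurableType d)
    (R : realType) (P : probability T R) (n M : nat) (lambda mu xi a V : R)
    (S : network_attack P n lambda mu xi a)
    (z v theta : R[i]) (beta : n.-tuple R[i])
    (n_ge1 : (1 <= n)%N) (M_ge1 : (1 <= M)%N)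
    (lambda_gt0 : 0 < lambda) (mu_gt0 : 0 < mu) (xi_gt0 : 0 < xi)
    (a_gt0 : 0 < a) (a_lt1 : a < 1) (V_gt0 : 0 < V)
    (z_le1 : absC z <= 1) (v_ge0 : 0 <= complex.Re v)
    (theta_ge0 : 0 <= complex.Re theta)
    (abs_cvg : converges_absolutely S z v theta beta) :
  let b : R[i] := (1 - a)%:C in
  let lam : R[i] := lambda%:C in
  let x : R[i] := xi%:C in
  let D : R[i] :=
    z * passive_mgf S beta * ((lam + b * theta) / (lam + theta)) in
  let gamma : R[i] := expectationC P (state_transform S z v theta beta 1) in
  let phi : R[i] :=
    (x + v) / (v + x * (1 - D))
    - (D * x) ^+ M
      * (1 - expC (- (v + x) * V%:C)
             * \sum_(j < M.-1) ((x + v) * V%:C) ^+ j / (j`!)%:R)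
      / ((v + x * (1 - D)) * (x + v) ^+ M.-1)
    - D * x * expC (- (x + v) * V%:C)
      * (\sum_(j < M.-1) (D * x * V%:C) ^+ j / (j`!)%:R)
      / (x - D * x + v) in
  let Y : T -> R[i] :=
    fun w => state_transform S z v theta beta (rho S M V w) w in
  v + x * (1 - D) != 0 ->
  integrableC P Y /\
  expectationC P Y =
    1 - (1 - gamma)
        * (1 + b * mu%:C / (lam + b * theta)
           + a%:C * lam * mu%:C / ((lam + b * theta) * (lam + theta)) * phi).
Proof.
move=> b lam x D gamma phi Y D_neq.
have sm := converges_summable_marks v_ge0 abs_cvg.
have i1 := converges_state abs_cvg.
have [iY EY] := expectationC_passage lambda_gt0 mu_gt0 xi_gt0 a_gt0 a_lt1 M_ge1 V_gt0
  sm theta_ge0 i1.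
split=> //; rewrite /Y EY -/gamma; congr (1 - (1 - gamma) * _).
have s0 : lam + theta != 0 by apply: Re_gt0_neq0; rewrite complexReD ltr_wpDr.
have t0 : lam + b * theta != 0.
  apply: Re_gt0_neq0; rewrite complexReD complexReM /= mul0r subr0 ltr_wpDr//.
  by rewrite mulr_ge0// subr_ge0 ltW.
have u0 : x + v != 0 by apply: Re_gt0_neq0; rewrite complexReD ltr_wpDr.
pose h r := (z * passive_mgf S beta) ^+ r * gamma_transform xi (x + v) V r.
pose y := b + a%:C * (lam / (lam + theta)).
have bE : b = 1 - a%:C by rewrite /b rmorphB.
have yE : y = (lam + b * theta) / (lam + theta) by rewrite /y bE; field.
have y0 : y != 0 by rewrite yE mulf_neq0 ?invr_eq0.
have h0 : h 0%N = 1 by rewrite /h /gamma_transform !expr0 /exp_poly big_ord0 mulr0 subr0 !mul1r.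
have [m Mm] : exists m, M = m.+1 by exists M.-1; rewrite prednK.
have phiE : \sum_(r < M) y ^+ r * h r = phi.
  have dE : x + v - D * x = v + x * (1 - D) by ring.
  transitivity (\sum_(r < m.+1) D ^+ r * ((x / (x + v)) ^+ r *
      (1 - expC (- (x + v) * V%:C) * exp_poly ((x + v) * V%:C) r))).
    rewrite Mm; apply: eq_bigr => r _.
    by rewrite /h /gamma_transform -/x /D -yE (exprMn r (z * passive_mgf S beta) y); ring.
  rewrite sum_gamma_transform// ?dE// /phi Mm /= /exp_poly.
  have -> : x - D * x + v = v + x * (1 - D) by ring.
  by rewrite [v + x]addrC.
have -> : \sum_(i < M) box_mean S M V z v beta i * clock_total lambda mu theta i =
    1 + mu%:C / (lam + theta) * \sum_(r < M) node_renewal a (lam / (lam + theta)) r * h r.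
  rewrite -sum_box_mean// mulr_sumr.
  rewrite -(box_mean0 S V M_ge1 z v beta).
  under eq_bigr do rewrite /clock_total mulrDr.
  rewrite big_split /=; congr (_ + _).
    rewrite (bigD1 (Ordinal M_ge1)) //= mulr1 big1 ?addr0// => i i0.
    by rewrite (_ : (i == 0%N :> nat) = false) ?mulr0//; exact: negbTE.
  by apply: eq_bigr => i _; ring.
rewrite Mm in phiE *; rewrite (sum_node_renewal_geometric h m y0) phiE h0.
rewrite -/b -/y yE bE; field.
by rewrite -bE s0 t0.
Qed.
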